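(* Let $f=\{f_k\}_{k\ge1}$ be a Leibniz$_\infty$-algebra homomorphism from $(\mathfrak G^\bullet,\{\theta_k\}_{k\ge1})$ to $({\mathfrak G'}^\bullet,\{\theta'_k\}_{k\ge1})$, and let $F:\bar{\mathrm T}(\mathfrak G^\bullet)\to\bar{\mathrm T}({\mathfrak G'}^\bullet)$, $\Phi$, $\Psi$ be as in the context. Then $\Psi^{-1}\circ\Phi\circ F\circ\Phi^{-1}\circ\Psi$ is a homomorphism of codifferential cocommutative coalgebras from $\bar{\mathrm S}^c(\mathrm{Lie}(\mathfrak G^\bullet))$ to $\bar{\mathrm S}^c(\mathrm{Lie}({\mathfrak G'}^\bullet))$, where these carry the codifferentials $\Psi^{-1}\circ\Phi\circ d\circ\Phi^{-1}\circ\Psi$ and $\Psi^{-1}\circ\Phi\circ d'\circ\Phi^{-1}\circ\Psi$. It gives an $L_\infty$-algebra homomorphism from $\mathrm{Lie}(\mathfrak G^\bullet)$ to $\mathrm{Lie}({\mathfrak G'}^\bullet)$.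
   Context: Ground field of characteristic $0$; graded means $\mathbb Z$-graded; exponents of $-1$ denote degrees; $\varepsilon(\sigma)$ is the Koszul sign; $\mathbb S_{(i,j)}$ is the set of $(i,j)$-shuffles; $\bar{\mathrm T}(V)=\bigoplus_{i\ge1}V^{\otimes i}$, $\bar{\mathrm S}(V)=\bigoplus_{i\ge1}\mathrm S^i(V)$. A Leibniz$_\infty$-algebra is a graded space $\mathfrak G^\bullet$ with degree $1$ maps $\theta_k:\otimes^k\mathfrak G\to\mathfrak G$, $k\ge1$, such that for all $n\ge1$ $$\sum_{i=1}^n\sum_{k=1}^{n-i+1}\sum_{\sigma\in\mathbb S_{(k-1,i-1)}}(-1)^{x_{\sigma(1)}+\dots+x_{\sigma(k-1)}}\varepsilon(\sigma)\theta_{n-i+1}(x_{\sigma(1)},\dots,x_{\sigma(k-1)},\theta_i(x_{\sigma(k)},\dots,x_{\sigma(k+i-2)},x_{k+i-1}),x_{k+i},\dots,x_n)=0.$$ A homomorphism $\{f_k\}$ to $(\mathfrak G',\{\theta'_k\})$ is a collection of degree $0$ maps $f_k:\otimes^k\mathfrak G\to\mathfrak G'$ such that for all $n\ge1$ $$\sum_{i=1}^n\sum_{k=1}^{n-i+1}\sum_{\sigma\in\mathbb S_{(k-1,i-1)}}(-1)^{x_{\sigma(1)}+\dots+x_{\sigma(k-1)}}\varepsilon(\sigma)f_{n-i+1}(x_{\sigma(1)},\dots,x_{\sigma(k-1)},\theta_i(x_{\sigma(k)},\dots,x_{\sigma(k+i-2)},x_{k+i-1}),x_{k+i},\dots,x_n)$$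 $$=\sum_{p=1}^n\sum_{k_1+\dots+k_p=n}\sum_{\sigma\in\mathbb E_{(k_1,\dots,k_p)}}\varepsilon(\sigma)\theta'_p\big(f_{k_1}(x_{\sigma(1)},\dots,x_{\sigma(k_1)}),\dots,f_{k_p}(x_{\sigma(n-k_p+1)},\dots,x_{\sigma(n)})\big),$$ where $\mathbb E_{(k_1,\dots,k_p)}$ is the set of $(k_1,\dots,k_p)$-shuffles with $\sigma(k_1)<\sigma(k_1+k_2)<\dots<\sigma(k_1+\dots+k_p)$. The associated map is $$F(x_1\otimes\cdots\otimes x_n)=\sum_{p=1}^n\sum_{k_1+\dots+k_p=n}\sum_{\sigma\in\mathbb E_{(k_1,\dots,k_p)}}\varepsilon(\sigma)f_{k_1}(x_{\sigma(1)},\dots,x_{\sigma(k_1)})\otimes\cdots\otimes f_{k_p}(x_{\sigma(n-k_p+1)},\dots,x_{\sigma(n)}).$$ On $\bar{\mathrm T}(\mathfrak G)$, $d=\sum_kd_k$ with $d_k(x_1\otimes\cdots\otimes x_n)=0$ for $n<k$ and, for $n\ge k$, $$d_k(x_1\otimes\cdots\otimes x_n)=\sum_{j=1}^{n+1-k}\sum_{\sigma\in\mathbb S_{(j-1,k-1)}}(-1)^{x_{\sigma(1)}+\dots+x_{\sigma(j-1)}}\varepsilon(\sigma)\,x_{\sigma(1)}\otimes\cdots\otimes x_{\sigma(j-1)}\otimes\theta_k(x_{\sigma(j)},\dots,x_{\sigma(j+k-2)},x_{j+k-1})\otimes x_{j+k}\otimes\cdots\otimes x_n;$$ $d'$ is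 defined likewise from $\theta'_k$. $\mathrm{Lie}(V)$ is the free graded Lie algebra on $V$ (the graded Lie subalgebra of $\mathrm T(V)$ with graded commutator generated by $V$); $\mathrm U(\mathrm{Lie}(V))$ is its universal enveloping algebra with product $*$ and its standard coproduct. $\Phi:\mathrm T(V)\to\mathrm U(\mathrm{Lie}(V))$, $\Phi(1)=1$, $\Phi(v_1\otimes\cdots\otimes v_n)=v_1*\cdots*v_n$, is an isomorphism of graded bialgebras ($\mathrm T(V)$ with concatenation and coshuffle coproduct). $\Psi:\mathrm S(\mathrm{Lie}(V))\to\mathrm U(\mathrm{Lie}(V))$, $\Psi(1)=1$, $\Psi(x_1\odot\cdots\odot x_m)=\frac1{m!}\sum_{\sigma\in\mathbb S_m}\varepsilon(\sigma)x_{\sigma(1)}*\cdots*x_{\sigma(m)}$, is the Poincaré-Birkhoff-Witt isomorphism of graded coalgebras. They are used for $V=\mathfrak G$ and $V=\mathfrak G'$ and restricted to the reduced coalgebras. $\bar{\mathrm S}^c(\mathfrak g)$ is the cofree conilpotent cocommutative coalgebra on $\mathfrak g$. $L_\infty$-algebra structures on $\mathfrak g$ are equivalent to codifferentials (degree $1$ square-zero coderivations) on $\bar{\mathrm S}^c(\mathfrak g)$, and $L_\infty$-homomorphisms are coalgebra homomorphisms commuting with codifferentials. *)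

(* Defs.v *)
From HB Require Import structures.
From mathcomp Require Import all_boot all_order ssralg ssrnum ssrint perm.
From mathcomp Require Import generic_quotient.
From mathcomp Require Import boolp.
From mathcomp Require Import freeg.

Set Implicit Arguments.
Unset Strict Implicit.
Unset Printing Implicit Defensive.

Import GRing.Theory.
Local Open Scope ring_scope.
Local Open Scope quotient_scope.

(** * Quotient of a module by the submodule spanned by a set of relations *)

Section Quotient.
Variables (K : fieldType) (M : lmodType K) (R : M -> Prop).

Inductive spanned : M -> Prop :=
| spanned0 : spanned 0
| spannedD a r x : R r -> spanned x -> spanned (a *: r + x).

Lemma spanned_rel r : R r -> spanned r.
Proof.
by move=> Rr; rewrite -[r]addr0 -[r]scale1r; apply: spannedD => //; apply: spanned0.
Qed.

Lemma spanned_add x y : spanned x -> spanned y -> spanned (x + y).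
Proof.
move=> sx sy; elim: sx => [|a r z Rr _ IH]; first by rewrite add0r.
by rewrite -addrA; apply: spannedD.
Qed.

Lemma spanned_scale a x : spanned x -> spanned (a *: x).
Proof.
elim=> [|b r z Rr _ IH]; first by rewrite scaler0; apply: spanned0.
by rewrite scalerDr scalerA; apply: spannedD.
Qed.

Definition qequiv (x y : M) : bool := `[< spanned (x - y) >].

Lemma qequiv_refl : reflexive qequiv.
Proof. by move=> x; apply/asboolP; rewrite subrr; apply: spanned0. Qed.

Lemma qequiv_sym : symmetric qequiv.
Proof.
have imp x y : qequiv x y -> qequiv y x.
  move=> /asboolP xy; apply/asboolP.
  by rewrite -opprB -scaleN1r; apply: spanned_scale.
by move=> x y; apply/idP/idP; apply: imp.
Qed.

Lemma qequiv_trans : transitive qequiv.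
Proof.
move=> y x z /asboolP xy /asboolP yz; apply/asboolP.
by have := spanned_add xy yz; rewrite addrA subrK.
Qed.

Canonical qequiv_equiv := EquivRel qequiv qequiv_refl qequiv_sym qequiv_trans.

Definition quot : Type := {eq_quot qequiv}.
HB.instance Definition _ := Choice.on quot.
HB.instance Definition _ := EqQuotient.on quot.

Definition qcl (x : M) : quot := \pi_quot x.

Lemma qcl_eq x y : spanned (x - y) -> qcl x = qcl y.
Proof. by move=> xy; apply/eqmodP/asboolP. Qed.

Lemma spanned_repr x : spanned (repr (qcl x) - x).
Proof.
by have /eqmodP/asboolP : repr (qcl x) = x %[mod quot] by rewrite reprK.
Qed.

Lemma qcl_surj z : exists x, z = qcl x.
Proof. by exists (repr z); rewrite /qcl reprK. Qed.

Definition qadd (x y : quot) : quot := qcl (repr x + repr y).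
Definition qopp (x : quot) : quot := qcl (- repr x).
Definition qscale (a : K) (x : quot) : quot := qcl (a *: repr x).

Lemma qaddE x y : qadd (qcl x) (qcl y) = qcl (x + y).
Proof.
apply: qcl_eq; rewrite opprD addrACA.
by apply: spanned_add; apply: spanned_repr.
Qed.

Lemma qoppE x : qopp (qcl x) = qcl (- x).
Proof.
apply: qcl_eq; rewrite -opprD -[X in spanned X]scaleN1r.
by apply: spanned_scale; apply: spanned_repr.
Qed.

Lemma qscaleE a x : qscale a (qcl x) = qcl (a *: x).
Proof.
by apply: qcl_eq; rewrite -scalerBr; apply: spanned_scale; apply: spanned_repr.
Qed.

Lemma qaddA : associative qadd.
Proof.
move=> z1 z2 z3; have [x ->] := qcl_surj z1; have [y ->] := qcl_surj z2.
by have [z ->] := qcl_surj z3; rewrite (qaddE y z) (qaddE x y) !qaddE addrA.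
Qed.

Lemma qaddC : commutative qadd.
Proof. by move=> x y; rewrite /qadd addrC. Qed.

Lemma qadd0 : left_id (qcl 0) qadd.
Proof. by move=> z; have [x ->] := qcl_surj z; rewrite qaddE add0r. Qed.

Lemma qaddN : left_inverse (qcl 0) qopp qadd.
Proof. by move=> z; have [x ->] := qcl_surj z; rewrite qoppE qaddE addNr. Qed.

HB.instance Definition _ := GRing.isZmodule.Build quot qaddA qaddC qadd0 qaddN.

Lemma qscaleA a b z : qscale a (qscale b z) = qscale (a * b) z.
Proof. by have [x ->] := qcl_surj z; rewrite (qscaleE b) !qscaleE scalerA. Qed.

Lemma qscale1 : left_id 1 qscale.
Proof. by move=> z; have [x ->] := qcl_surj z; rewrite qscaleE scale1r. Qed.

Lemma qscaleDr : right_distributive qscale +%R.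
Proof.
move=> a z1 z2; have [x ->] := qcl_surj z1; have [y ->] := qcl_surj z2.
by rewrite [LHS](congr1 (qscale a) (qaddE x y)) !qscaleE scalerDr -qaddE.
Qed.

Lemma qscaleDl z : {morph qscale^~ z : a b / a + b}.
Proof.
have [x ->] := qcl_surj z => a b.
by rewrite !qscaleE scalerDl -qaddE.
Qed.

HB.instance Definition _ :=
  GRing.Zmodule_isLmodule.Build K quot qscaleA qscale1 qscaleDr qscaleDl.

Lemma qcl_is_linear : linear qcl.
Proof. by move=> a x y; rewrite -qaddE -qscaleE. Qed.

HB.instance Definition _ := GRing.isLinear.Build K M quot _ qcl qcl_is_linear.

Lemma qcl_rel r : R r -> qcl r = 0.
Proof.
move=> Rr; rewrite -[RHS](raddf0 qcl); apply: qcl_eq.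
by rewrite subr0; apply: spanned_rel.
Qed.

(** The map on the quotient induced by [f]; meaningful when [f] is linear and
    kills the relations (see [qliftE]). *)
Definition qlift (N : Type) (f : M -> N) (z : quot) : N := f (repr z).

Lemma qliftE (N : lmodType K) (f : {linear M -> N}) :
  (forall r, R r -> f r = 0) -> forall x, qlift f (qcl x) = f x.
Proof.
move=> fR x; apply/eqP; rewrite -subr_eq0 /qlift -raddfB /=; apply/eqP.
elim: (spanned_repr x) => [|a r y Rr _ IH]; first exact: raddf0.
by rewrite linearP /= IH fR // scaler0 addr0.
Qed.

End Quotient.

Section FreeLift.
Variables (K : fieldType) (X : choiceType) (M : lmodType K) (phi : X -> M).

HB.instance Definition _ := GRing.isZmodMorphism.Build {freeg X / K} M
  (fglift phi) (lift_is_additive phi).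

Lemma fglift_is_scalable : scalable (fglift phi : {freeg X / K} -> M).
Proof.
move=> a x; have -> : a *: x = \sum_(i <- dom x) << a * coeff i x *g i >> by [].
rewrite -[in RHS](freeg_sumE x) [in RHS]raddf_sum [in LHS]raddf_sum scaler_sumr /=.
by apply: eq_bigr => i _; rewrite !liftU scalerA.
Qed.

HB.instance Definition _ := GRing.isScalable.Build K {freeg X / K} M _
  (fglift phi) fglift_is_scalable.

End FreeLift.

(** * Graded vector spaces *)

(** A Z-grading, given by the projections [gpr i] onto the homogeneous
    components V_i = [homog i]; [gprE] and [gdec] say that V is the direct sum
    of the V_i. *)
Record gradedSpace (K : fieldType) := GradedSpace {
  gcarrier :> lmodType K;
  gpr : int -> gcarrier -> gcarrier;
  gpr_linear : forall i, linear (gpr i);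
  gprE : forall i j v, gpr i (gpr j v) = if i == j then gpr j v else 0;
  gdec : forall v, exists2 s : seq int, uniq s & v = \sum_(i <- s) gpr i v
}.

Section Graded.
Variables (K : fieldType) (V : gradedSpace K).

Definition homog (i : int) (v : V) : Prop := gpr i v = v.

Definition gsupp (v : V) : seq int := projT1 (cid2 (gdec v)).

Definition hom : Type := {p : int * V | gpr p.1 p.2 == p.2}.
HB.instance Definition _ := Choice.on hom.

Definition hdeg (x : hom) : int := (val x).1.
Definition hval (x : hom) : V := (val x).2.

Definition mkhom (i : int) (v : V) (iv : homog i v) : hom :=
  exist _ (i, v) (introT eqP iv).

HB.instance Definition _ i :=
  GRing.isLinear.Build K V V _ (@gpr K V i) (gpr_linear i).

Lemma homog0 i : homog i (0 : V).
Proof. exact: raddf0. Qed.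

Definition hom0 : hom := mkhom (homog0 0).

Definition degs (xs : seq hom) : int := \sum_(x <- xs) hdeg x.

End Graded.

Section BuildGraded.
Variables (K : fieldType) (V : lmodType K) (pr : int -> V -> V).
Hypotheses (pr_lin : forall i, linear (pr i))
  (prE : forall i j v, pr i (pr j v) = if i == j then pr j v else 0)
  (pr_span : forall v, exists t : seq (int * V), v = \sum_(p <- t) pr p.1 p.2).

Lemma build_gdec v : exists2 s : seq int, uniq s & v = \sum_(i <- s) pr i v.
Proof.
have [t v_t] := pr_span v; exists (undup (map fst t)); first exact: undup_uniq.
pose A i := GRing.isLinear.Build K V V _ (pr i) (pr_lin i).
pose h i : {linear V -> V} := HB.pack (pr i) (A i).
have prv i : pr i v = \sum_(p <- t | i == p.1) pr p.1 p.2.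
  rewrite -[pr i]/(h i : _ -> _) v_t raddf_sum [RHS]big_mkcond /=.
  by apply: eq_bigr => p _; rewrite prE.
under eq_bigr => i _ do rewrite prv big_mkcond.
rewrite exchange_big /= {1}v_t big_seq [RHS]big_seq; apply: eq_bigr => p pt.
rewrite -big_mkcond /= (eq_bigl (pred1 p.1)) //.
have pin : p.1 \in undup (map fst t) by rewrite mem_undup map_f.
by rewrite -big_filter filter_pred1_uniq ?undup_uniq // big_seq1.
Qed.

Definition buildGraded : gradedSpace K := GradedSpace pr_lin prE build_gdec.
End BuildGraded.

(** * Modules presented by words of homogeneous elements *)

(** Words of length at least [m]; [m = 0] gives the full objects (with unit),
    [m = 1] the reduced ones. *)
Definition words (K : fieldType) (m : nat) (V : gradedSpace K) : Type :=
  {s : seq (hom V) | (m <= size s)%N}.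
HB.instance Definition _ K m (V : gradedSpace K) := Choice.on (words m V).

Section WordModule.
Variables (K : fieldType) (m : nat) (V : gradedSpace K).

Definition freeWords : lmodType K := {freeg (words m V) / K}.

Definition fword (s : seq (hom V)) : freeWords :=
  oapp (fun u : words m V => << u >> : freeWords) 0 (insub s).

Variable R : freeWords -> Prop.

Definition wordMod : lmodType K := quot R.

Definition wcl (s : seq (hom V)) : wordMod := qcl R (fword s).

Definition fwlift (M : lmodType K) (phi : seq (hom V) -> M) : freeWords -> M :=
  fglift (fun u : words m V => phi (val u)).
HB.instance Definition _ M phi := GRing.Linear.on (@fwlift M phi).

(** The linear map determined by its values [phi s] on words, when [phi]
    respects the relations [R] (see [wliftE]). *)
Definition wlift (M : lmodType K) (phi : seq (hom V) -> M) : wordMod -> M :=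
  qlift (fwlift phi).


Lemma fwlift_fword (M : lmodType K) (phi : seq (hom V) -> M) s :
  fwlift phi (fword s) =
  if (m <= size s)%N then phi s else 0.
Proof.
rewrite /fwlift /fword; case: insubP => [u _ <- /=|/negbTE -> /=].
  by rewrite (valP u) liftU scale1r.
exact: raddf0.
Qed.

Lemma wcl_short s : (m <= size s)%N = false -> wcl s = 0.
Proof. by move=> sm; rewrite /wcl /fword insubF // raddf0. Qed.

Lemma wliftE (M : lmodType K) (phi : seq (hom V) -> M) :
  (forall r, R r -> fwlift phi r = 0) ->
  forall s, (m <= size s)%N -> wlift phi (wcl s) = phi s.
Proof.
move=> phiR s sm; rewrite /wlift /wcl.
rewrite (qliftE (f := fwlift phi)) //.
by rewrite /= fwlift_fword sm.
Qed.

Lemma wlift_linear (M : lmodType K) (phi : seq (hom V) -> M) :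
  (forall r, R r -> fwlift phi r = 0) ->
  linear (wlift phi).
Proof.
move=> phiR a z1 z2; have [x ->] := qcl_surj z1; have [y ->] := qcl_surj z2.
rewrite -linearP /wlift.
by rewrite !(qliftE (f := fwlift phi)) // linearP.
Qed.

Lemma wordMod_span z : exists t : seq (K * seq (hom V)),
  all (fun p => m <= size p.2)%N t /\ z = \sum_(p <- t) p.1 *: wcl p.2.
Proof.
have [x ->] := qcl_surj z.
exists [seq (coeff u x, val u) | u <- dom x]; split.
  by apply/allP => _ /mapP[u _ ->]; apply: (valP u).
rewrite big_map -{1}(freeg_sumE x) raddf_sum; apply: eq_bigr => u _ /=.
rewrite /wcl -linearZ_LR; congr (qcl _ _); rewrite /fword valK /=.
apply/eqP/freeg_eqP => k; rewrite coeffZ !coeffU; by rewrite mul1r.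
Qed.

(** The grading by total degree, for relations homogeneous in that degree. *)
Definition wpr (i : int) : wordMod -> wordMod :=
  wlift (fun s => if degs s == i then wcl s else 0).

Definition homog_rel : Prop := forall i r, R r ->
  fwlift (fun s => if degs s == i then wcl s else 0) r = 0.

Hypothesis hR : homog_rel.

Lemma wpr_linear i : linear (wpr i).
Proof.
exact: wlift_linear (hR i).
Qed.

Lemma wpr_wcl i s : wpr i (wcl s) = if degs s == i then wcl s else 0.
Proof.
have [sm|sm] := boolP (m <= size s)%N.
  exact: wliftE (hR i) _ sm.
have s0 := wcl_short (negbTE sm); rewrite s0 if_same.
pose A := GRing.isLinear.Build K _ _ _ (wpr i) (wpr_linear i).
pose h : {linear wordMod -> wordMod} := HB.pack (wpr i) A.
exact: (raddf0 h).
Qed.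

Lemma wpr_span z : exists t : seq (int * wordMod), z = \sum_(p <- t) wpr p.1 p.2.
Proof.
have [t [_ ->]] := wordMod_span z.
exists [seq (degs p.2, p.1 *: wcl p.2) | p <- t]; rewrite big_map.
apply: eq_bigr => p _ /=.
pose A := GRing.isLinear.Build K _ _ _ (wpr (degs p.2)) (wpr_linear (degs p.2)).
pose h : {linear wordMod -> wordMod} := HB.pack (wpr (degs p.2)) A.
by rewrite -[RHS]/(h _) linearZ_LR /= wpr_wcl eqxx.
Qed.

Lemma wprE i j z : wpr i (wpr j z) = if i == j then wpr j z else 0.
Proof.
pose A i := GRing.isLinear.Build K _ _ _ (wpr i) (wpr_linear i).
pose h i : {linear wordMod -> wordMod} := HB.pack (wpr i) (A i).
have [t [_ ->]] := wordMod_span z.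
have hE k (F : K * seq (hom V) -> wordMod) :
    wpr k (\sum_(p <- t) F p) = \sum_(p <- t) wpr k (F p).
  exact: (raddf_sum (h k)).
have hZ k a x : wpr k (a *: x) = a *: wpr k x by exact: (linearZ_LR (h k)).
have h0 k : wpr k 0 = 0 by exact: (raddf0 (h k)).
rewrite !hE -[X in if _ then _ else X](big1_eq (idx := 0) (op := +%R) t xpredT).
have [<-|ij] := eqVneq i j; apply: eq_bigr => p _; rewrite !hZ !wpr_wcl.
  by case: eqP => [pi|_]; rewrite ?h0 // wpr_wcl pi eqxx.
case: (eqVneq (degs p.2) j) => [pj|_]; last by rewrite h0 scaler0.
by rewrite wpr_wcl pj eq_sym (negbTE ij) scaler0.
Qed.

Definition gradedWordMod : gradedSpace K := buildGraded wpr_linear wprE wpr_span.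

End WordModule.

(** ** Tensor powers *)

Section Tensor.
Variables (K : fieldType) (m : nat) (V : gradedSpace K).

(** Multilinearity in each slot, one degree at a time: the quotient is the
    direct sum of the V_(i1) (x) ... (x) V_(in) with n >= m. *)
Inductive tensor_rel : freeWords m V -> Prop :=
| tensor_relP s t a (x y z : hom V) :
    hdeg x = hdeg z -> hdeg y = hdeg z -> hval z = a *: hval x + hval y ->
    tensor_rel (fword m (s ++ z :: t)
                - a *: fword m (s ++ x :: t) - fword m (s ++ y :: t)).

Lemma tensor_rel_homog (R : freeWords m V -> Prop) i r :
  (forall r, tensor_rel r -> R r) -> tensor_rel r ->
  fwlift (fun s => if degs s == i then wcl R s else 0) r = 0.
Proof.
move=> TR rT; have := TR _ rT; case: rT => s t a x y z xz yz zE Rr.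
rewrite !linearB /= linearZ_LR /=.
rewrite !fwlift_fword /degs !big_cat !big_cons /= xz yz !size_cat /=.
case: ifP => _; last by rewrite scaler0 !subr0.
case: ifP => _; last by rewrite scaler0 !subr0.
by have := qcl_rel Rr; rewrite !linearB /= linearZ_LR.
Qed.

Lemma tensor_homog : homog_rel tensor_rel.
Proof. by move=> i r; apply: tensor_rel_homog. Qed.

(** [Tge 0 V] is T(V) and [Tge 1 V] is its reduced version. *)
Definition Tge : gradedSpace K := gradedWordMod tensor_homog.

(** [tw [:: v1; ...; vn]] is v1 (x) ... (x) vn *)
Definition tw (s : seq (hom V)) : Tge := wcl tensor_rel s.

End Tensor.

(** ** Symmetric powers *)

Section Symmetric.
Variables (K : fieldType) (m : nat) (V : gradedSpace K).

Inductive sym_rel : freeWords m V -> Prop :=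
| sym_tensor r : tensor_rel r -> sym_rel r
| sym_swap s t (x y : hom V) :
    sym_rel (fword m (s ++ x :: y :: t)
             - (-1) ^ (hdeg x * hdeg y) *: fword m (s ++ y :: x :: t)).

Lemma sym_homog : homog_rel sym_rel.
Proof.
move=> i r rS; have := rS; case: rS => [{}r rT _|s t x y Rr].
  exact: tensor_rel_homog sym_tensor rT.
rewrite !linearB /= linearZ_LR /=.
rewrite !fwlift_fword /degs !big_cat !big_cons /= !size_cat /= (addrCA (hdeg y)).
case: ifP => _; last by rewrite scaler0 !subr0.
case: ifP => _; last by rewrite scaler0 !subr0.
by have := qcl_rel Rr; rewrite linearB /= linearZ_LR.
Qed.

(** [Sge 0 V] is S(V) and [Sge 1 V] is its reduced version. *)
Definition Sge : gradedSpace K := gradedWordMod sym_homog.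

(** [sw [:: v1; ...; vn]] is the symmetric product of v1, ..., vn *)
Definition sw (s : seq (hom V)) : Sge := wcl sym_rel s.

End Symmetric.

(** * Products and the universal enveloping algebra *)

(** The product induced by concatenation of words. *)
Definition wmul (K : fieldType) (V : gradedSpace K) (R : freeWords 0 V -> Prop)
    (x y : wordMod R) : wordMod R :=
  wlift (fun s => wlift (fun t => wcl R (s ++ t)) y) x.

(** Graded commutator, extended bilinearly from homogeneous elements. *)
Definition gcomm (K : fieldType) (A : gradedSpace K) (mul : A -> A -> A)
    (x y : A) : A :=
  \sum_(i <- gsupp x) \sum_(j <- gsupp y)
    (mul (gpr i x) (gpr j y) - (-1) ^ (i * j) *: mul (gpr j y) (gpr i x)).

Section Enveloping.
Variables (K : fieldType) (L : gradedSpace K) (br : L -> L -> L).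

(** T(L) modulo the two-sided ideal of the x y - (-1)^(|x||y|) y x - [x, y] *)
Inductive env_rel : freeWords 0 L -> Prop :=
| env_tensor r : tensor_rel r -> env_rel r
| env_br s t (x y z : hom L) :
    hdeg z = hdeg x + hdeg y -> hval z = br (hval x) (hval y) ->
    env_rel (fword 0 (s ++ x :: y :: t)
             - (-1) ^ (hdeg x * hdeg y) *: fword 0 (s ++ y :: x :: t)
             - fword 0 (s ++ z :: t)).

Definition Uenv : lmodType K := wordMod env_rel.
Definition umul : Uenv -> Uenv -> Uenv := @wmul K L env_rel.
Definition uone : Uenv := wcl env_rel [::].
Definition uin (x : hom L) : Uenv := wcl env_rel [:: x].
Definition uprod (xs : seq (hom L)) : Uenv := foldr umul uone (map uin xs).

End Enveloping.

(** * The free graded Lie algebra *)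

Section FreeLie.
Variables (K : fieldType) (V : gradedSpace K).
Let T := Tge 0 V.

Definition tmul : T -> T -> T := @wmul K V (@tensor_rel K 0 V).
Definition tbr : T -> T -> T := gcomm tmul.

(** The smallest graded subspace of T(V) containing V and closed under the
    graded commutator. *)
Inductive inLie : T -> Prop :=
| inLie_gen (v : hom V) : inLie (tw 0 [:: v])
| inLie0 : inLie 0
| inLieP a x y : inLie x -> inLie y -> inLie (a *: x + y)
| inLie_pr i x : inLie x -> inLie (gpr i x)
| inLie_br x y : inLie x -> inLie y -> inLie (tbr x y).

Definition LieP : {pred T} := fun x => `[< inLie x >].

Lemma LieP_submod : submod_closed LieP.
Proof.
split=> [|a x y /asboolP xL /asboolP yL]; apply/asboolP; first exact: inLie0.
exact: inLieP.
Qed.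

HB.instance Definition _ := GRing.isSubmodClosed.Build K T LieP LieP_submod.

Definition LieT : Type := {x : T | LieP x}.
HB.instance Definition _ := SubChoice.on LieT.
HB.instance Definition _ := [SubChoice_isSubLmodule of LieT by <:].

Definition lpr (i : int) (x : LieT) : LieT :=
  exist _ (gpr i (val x)) (asboolT (inLie_pr i (asboolW (valP x)))).

Lemma lpr_linear i : linear (lpr i).
Proof.
move=> a x y; apply: val_inj; rewrite [RHS]linearP -[RHS]gpr_linear.
by congr (gpr _ _); apply: linearP.
Qed.

Lemma lprE i j x : lpr i (lpr j x) = if i == j then lpr j x else 0.
Proof.
apply: val_inj; rewrite -[LHS]/(gpr i (gpr j (val x))) gprE.
by case: ifP => _ //; rewrite raddf0.
Qed.

Lemma lpr_dec x : exists2 s : seq int, uniq s & x = \sum_(i <- s) lpr i x.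
Proof.
have [s us xE] := gdec (val x); exists s => //.
by apply: val_inj; rewrite {1}xE raddf_sum.
Qed.

Definition Lie : gradedSpace K := GradedSpace lpr_linear lprE lpr_dec.

Definition lbr (x y : Lie) : Lie :=
  exist _ (tbr (val x) (val y))
    (asboolT (inLie_br (asboolW (valP x)) (asboolW (valP y)))).

Lemma lin_homog (v : hom V) : gpr (hdeg v) (tw 0 [:: v]) = tw 0 [:: v].
Proof.
by rewrite [LHS](wpr_wcl (@tensor_homog K 0 V)) /degs big_seq1 eqxx.
Qed.

Definition lin_val (v : hom V) : Lie := exist _ (tw 0 [:: v]) (asboolT (inLie_gen v)).

Lemma lin_val_homog v : homog (hdeg v) (lin_val v).
Proof. by apply: val_inj; exact: lin_homog. Qed.

(** The inclusion of V into Lie(V), on homogeneous elements. *)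
Definition lin (v : hom V) : hom Lie := mkhom (lin_val_homog v).

End FreeLie.

Definition ULie (K : fieldType) (V : gradedSpace K) : lmodType K := Uenv (@lbr K V).

(** * Shuffles and Koszul signs *)

Section Shuffles.
Variables (n : nat) (s : {perm 'I_n}).

(** s(1), ..., s(n), with values numbered from 0 *)
Definition perm_seq : seq nat := [seq val (s i) | i <- enum 'I_n].

(** [(k1, ..., kp)]-shuffles, for [ks = [:: k1; ...; kp]] summing to [n] *)
Definition shuffle (ks : seq nat) : bool :=
  all (sorted ltn) (reshape ks perm_seq).

(** Shuffles with s(k1) < s(k1 + k2) < ... < s(k1 + ... + kp) *)
Definition Eshuffle (ks : seq nat) : bool :=
  shuffle ks && sorted ltn (map (last 0%N) (reshape ks perm_seq)).

Variables (K : fieldType) (V : gradedSpace K) (xs : seq (hom V)).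

(** [permw] is the word x_s(1) ... x_s(n); [xs] may be longer than [n]. *)
Definition permw : seq (hom V) := [seq nth (hom0 V) xs i | i <- perm_seq].

Definition koszul : K :=
  \prod_(i < n) \prod_(j < n | (i < j)%N && (s j < s i)%N)
    (-1) ^ (hdeg (nth (hom0 V) xs (s i)) * hdeg (nth (hom0 V) xs (s j))).

End Shuffles.

(** * Leibniz-infinity algebras *)

Section Multi.
Variables (K : fieldType).

(** A family of degree [r] multilinear maps V x ... x V -> W (k factors) for
    k >= 1: the k-th map is the restriction to lists of length k. *)
Record gmulti (r : int) (V W : gradedSpace K) := GMulti {
  gm_fun :> seq V -> W;
  gm_nil : gm_fun [::] = 0;
  gm_linear : forall s t a u v,
    gm_fun (s ++ (a *: u + v) :: t) =
    a *: gm_fun (s ++ u :: t) + gm_fun (s ++ v :: t);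
  gm_deg : forall xs : seq (hom V), homog (degs xs + r) (gm_fun (map (@hval K V) xs))
}.

Definition hvals (V : gradedSpace K) (xs : seq (hom V)) : seq V := map (@hval K V) xs.

Definition gapp r (V W : gradedSpace K) (f : gmulti r V W) (xs : seq (hom V)) : hom W :=
  mkhom (gm_deg f xs).

(** For a shuffle [s] in S_(k-1,i-1), the word
    x_s(1), ..., x_s(k-1), theta_i(x_s(k), ..., x_s(k+i-2), x_(k+i-1)),
    x_(k+i), ..., x_n *)
Definition theta_word (V : gradedSpace K) (theta : gmulti 1 V V) (i k : nat)
    (s : {perm 'I_(k.-1 + i.-1)%N}) (xs : seq (hom V)) : seq (hom V) :=
  take k.-1 (permw s xs) ++
  gapp theta (rcons (drop k.-1 (permw s xs)) (nth (hom0 V) xs (k.-1 + i.-1)%N)) ::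
  drop (k.-1 + i.-1)%N.+1 xs.

(** With [phi] = theta (resp. f) this is the common left-hand side of the
    identities defining Leibniz-infinity algebras (resp. homomorphisms); with
    [phi] = [tw 1] it is the value of d on a word. *)
Definition theta_sum (V : gradedSpace K) (theta : gmulti 1 V V) (M : lmodType K)
    (phi : seq (hom V) -> M) (xs : seq (hom V)) : M :=
  let n := size xs in
  \sum_(1 <= i < n.+1) \sum_(1 <= k < (n - i + 1)%N.+1)
    \sum_(s : {perm 'I_(k.-1 + i.-1)%N} | shuffle s [:: k.-1; i.-1])
      ((-1) ^ degs (take k.-1 (permw s xs)) * koszul s xs) *:
        phi (theta_word theta s xs).

(** With [phi] = theta' this is the right-hand side of the identity defining
    homomorphisms; with [phi] = [tw 1] it is the value of F on a word. *)
Definition block_sum (V W : gradedSpace K) (f : gmulti 0 V W) (M : lmodType K)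
    (phi : seq (hom W) -> M) (xs : seq (hom V)) : M :=
  let n := size xs in
  \sum_(1 <= p < n.+1)
    \sum_(k : p.-tuple 'I_n.+1 |
            all (ltn 0) (map val k) && (sumn (map val k) == n))
      \sum_(s : {perm 'I_n} | Eshuffle s (map val k))
        koszul s xs *: phi [seq gapp f b | b <- reshape (map val k) (permw s xs)].

Record leibnizInf := LeibnizInf {
  lz_space :> gradedSpace K;
  lz_theta : gmulti 1 lz_space lz_space;
  lz_axiom : forall xs : seq (hom lz_space),
    theta_sum lz_theta (fun w => lz_theta (hvals w)) xs = 0
}.

Record leibnizInfHom (G G' : leibnizInf) := LeibnizInfHom {
  lh_fun : gmulti 0 G G';
  lh_axiom : forall xs : seq (hom G),
    theta_sum (lz_theta G) (fun w => lh_fun (hvals w)) xs =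
    block_sum lh_fun (fun w => lz_theta G' (hvals w)) xs
}.

Definition Tbar (V : gradedSpace K) : gradedSpace K := Tge 1 V.
Definition Sbar (V : gradedSpace K) : gradedSpace K := Sge 1 V.

(** The sum over [i] in [theta_sum] is d = d_1 + d_2 + ...: on words of length
    n, d_i vanishes for i > n. *)
Definition dT (G : leibnizInf) : Tbar G -> Tbar G :=
  wlift (theta_sum (lz_theta G) (@tw K 1 G)).

Definition FT (G G' : leibnizInf) (f : leibnizInfHom G G') : Tbar G -> Tbar G' :=
  wlift (block_sum (lh_fun f) (@tw K 1 G')).

(** * The isomorphisms Phi and Psi *)

Definition Phi (m : nat) (V : gradedSpace K) : Tge m V -> ULie V :=
  wlift (fun vs => uprod (@lbr K V) (map (@lin K V) vs)).

Definition Psi (m : nat) (V : gradedSpace K) : Sge m (Lie V) -> ULie V :=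
  wlift (fun xs => ((size xs)`!%:R)^-1 *:
    \sum_(s : {perm 'I_(size xs)}) koszul s xs *: uprod (@lbr K V) (permw s xs)).

(** The inverse of [f] on its image (and 0 elsewhere). *)
Definition invf (A : lmodType K) (B : Type) (f : A -> B) (y : B) : A :=
  if pselect (exists x, f x = y) is left e then projT1 (cid e) else 0.

(** Psi^-1 o Phi o E o Phi^-1 o Psi, with Phi and Psi restricted to the reduced
    coalgebras: both are injective there, with image the augmentation ideal of
    U(Lie(V)). *)
Definition PBWconj (V W : gradedSpace K) (E : Tbar V -> Tbar W) :
    Sbar (Lie V) -> Sbar (Lie W) :=
  invf (@Psi 1 W) \o @Phi 1 W \o E \o invf (@Phi 1 V) \o @Psi 1 V.

End Multi.

(** * Coalgebras *)

Section TensorProduct.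
Variable K : fieldType.

Inductive bilin_rel (A B : lmodType K) : {freeg (A * B)%type / K} -> Prop :=
| bilinl a x y z :
    bilin_rel (<< (a *: x + y, z) >> - a *: << (x, z) >> - << (y, z) >>)
| bilinr a x y z :
    bilin_rel (<< (x, a *: y + z) >> - a *: << (x, y) >> - << (x, z) >>).

Definition tprod (A B : lmodType K) : lmodType K := quot (@bilin_rel A B).

Definition tens (A B : lmodType K) (x : A) (y : B) : tprod A B :=
  qcl (@bilin_rel A B) << (x, y) >>.

(** f (x) g, without sign, for linear f and g *)
Definition tmap (A B A' B' : lmodType K) (f : A -> A') (g : B -> B') :
    tprod A B -> tprod A' B' :=
  qlift (fglift (fun p : A * B => tens (f p.1) (g p.2))
           : {freeg (A * B)%type / K} -> tprod A' B').

End TensorProduct.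

Section Coalgebra.
Variable K : fieldType.

(** Only the data of a coalgebra; the coalgebra below, [Sc g], is coassociative
    and graded cocommutative. *)
Record gcoalg := GCoalg {
  gc_space :> gradedSpace K;
  gc_delta : gc_space -> tprod gc_space gc_space
}.

(** x |-> (-1)^|x| x *)
Definition gsign (V : gradedSpace K) (x : V) : V :=
  \sum_(i <- gsupp x) (-1) ^ i *: gpr i x.

(** The second summand is (id (x) D), whose value on x (x) y is
    (-1)^|x| x (x) D y since D has degree 1. *)
Definition is_coderivation1 (C : gcoalg) (D : C -> C) : Prop :=
  [/\ linear D,
      forall i x, homog i x -> homog (i + 1) (D x) &
      forall x, gc_delta (D x) =
        tmap D id (gc_delta x) + tmap (@gsign C) D (gc_delta x)].

Definition is_codifferential (C : gcoalg) (D : C -> C) : Prop :=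
  is_coderivation1 D /\ forall x, D (D x) = 0.

Definition is_coalg_hom (C C' : gcoalg) (H : C -> C') : Prop :=
  [/\ linear H,
      forall i x, homog i x -> homog i (H x) &
      forall x, gc_delta (H x) = tmap H H (gc_delta x)].

(** Homomorphism (C, D) -> (C', D') of codifferential coalgebras *)
Definition is_codiff_hom (C C' : gcoalg) (D : C -> C) (D' : C' -> C')
    (H : C -> C') : Prop :=
  [/\ is_codifferential D, is_codifferential D', is_coalg_hom H &
      forall x, H (D x) = D' (H x)].

(** The reduced unshuffle coproduct on the reduced symmetric coalgebra. *)
Definition Sdelta (g : gradedSpace K) : Sbar g -> tprod (Sbar g) (Sbar g) :=
  wlift (fun xs => let n := size xs in
    \sum_(1 <= i < n)
      \sum_(s : {perm 'I_n} | shuffle s [:: i; (n - i)%N])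
        koszul s xs *:
          @tens K (Sbar g) (Sbar g) (sw 1 (take i (permw s xs)))
            (sw 1 (drop i (permw s xs)))).

Definition Sc (g : gradedSpace K) : gcoalg := GCoalg (@Sdelta g).

(** An L-infinity structure on g is a codifferential on [Sc g] (so all brackets
    have degree 1 and are graded symmetric). *)
Record LinfAlg := LinfAlgebra {
  li_space :> gradedSpace K;
  li_codiff : Sc li_space -> Sc li_space;
  li_axiom : is_codifferential li_codiff
}.

Definition is_Linf_hom (g g' : LinfAlg) (H : Sc g -> Sc g') : Prop :=
  is_coalg_hom H /\ forall x, H (li_codiff x) = li_codiff (H x).

End Coalgebra.

(* Main.v *)
(**
  On a word w y of homogeneous elements, d and F satisfy, with Sweedler notation
  for the coshuffle coproduct of w,
    d (w y) = d(w) y + sum (-1)^|w'| w' theta(w'' y),   F (w y) = sum F(w') f(w'' y).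
  By induction on the length, d is a coderivation and F a coalgebra homomorphism
  for the coshuffle coproduct, and the defining identities of Leibniz-infinity
  algebras and of their homomorphisms become d^2 = 0 and F d = d' F on the
  reduced tensor coalgebra.

  It remains to see that Theta = Phi^-1 Psi, from the reduced symmetric coalgebra
  of Lie(V) to the reduced tensor coalgebra of V, is an isomorphism of graded
  coalgebras. Phi is inverted by the map U(Lie(V)) -> T(V) that extends the
  inclusion of Lie(V). Theta is a coalgebra map because Lie elements are primitive.
  Psi is onto because the difference of a product and its symmetrisation is a
  combination of shorter products. Theta is injective because, for a linear
  retraction r of T(V) onto Lie(V), the p-th convolution power of r with values
  in S^p(Lie(V)) maps Theta(x_1 ... x_n) to p! x_1 ... x_p if n = p and to 0 if
  n < p.
*)
From HB Require Import structures.
Require Import Defs.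
From mathcomp Require Import all_boot all_order ssralg ssrnum ssrint perm.
From mathcomp Require Import generic_quotient boolp freeg.
From mathcomp Require classical_sets.
Set Implicit Arguments.
Unset Strict Implicit.
Unset Printing Implicit Defensive.
Import GRing.Theory.
Local Open Scope ring_scope.

(** * Formal sums and unshuffles *)

(** Koszul signs are read off homogeneous letters, so identities are proved for formal sums of words
    whose letters carry a degree, evaluated at an arbitrary function [phi] of words. Multilinearity
    of [phi] enters where an axiom is applied inside a slot of a larger word, and in the passage to
    the quotients. A theta block is anchored at its last letter, and the blocks of F are ordered by
    their last letters; hence the recursions for d and F remove the last letter of a word. The sums
    over permutations in the definitions are turned into such recursions by listing permutations as
    words of positions. No law is verified directly on the symmetric side. Each is an equation or a
    homogeneity statement that is pulled back along Theta, through injectivity of Theta and of its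
    tensor square. Surjectivity of Theta supplies a linear inverse, and the preimages behind the
    conjugation, which is written with chosen preimages. Characteristic 0 enters through the n! of
    the symmetrisation and the p! of the convolution power. *)

Section FormalSums.
Variable K : fieldType.

(** The linear extension of [phi], evaluated at the formal sum [t]. *)
Definition ev (A : eqType) (M : lmodType K) (t : seq (K * A)) (phi : A -> M) : M :=
  \sum_(p <- t) p.1 *: phi p.2.

Variables (A B : eqType) (M N : lmodType K).
Implicit Types (t : seq (K * A)) (s : seq (K * B)) (phi psi : A -> M).

Lemma ev1 a phi : ev [:: (1, a)] phi = phi a.
Proof. by rewrite /ev big_seq1 scale1r. Qed.

Lemma ev_cat t t' phi : ev (t ++ t') phi = ev t phi + ev t' phi.
Proof. exact: big_cat. Qed.

Lemma ev_map (g : K * B -> K * A) s phi :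
  ev (map g s) phi = \sum_(p <- s) (g p).1 *: phi (g p).2.
Proof. exact: big_map. Qed.

Lemma eq_ev_in t phi psi :
  (forall p, p \in t -> phi p.2 = psi p.2) -> ev t phi = ev t psi.
Proof. by move=> e; apply: eq_big_seq => p pt; rewrite e. Qed.

Lemma eq_ev t phi psi : phi =1 psi -> ev t phi = ev t psi.
Proof. by move=> e; apply: eq_ev_in => p _. Qed.

Lemma evD t phi psi : ev t (fun a => phi a + psi a) = ev t phi + ev t psi.
Proof. by rewrite /ev -big_split; apply: eq_bigr => p _; rewrite scalerDr. Qed.

Lemma evZ t c phi : ev t (fun a => c *: phi a) = c *: ev t phi.
Proof.
by rewrite /ev scaler_sumr; apply: eq_bigr => p _; rewrite !scalerA mulrC.
Qed.

Lemma ev0 t : ev t (fun=> 0 : M) = 0.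
Proof. by rewrite /ev big1 // => p _; rewrite scaler0. Qed.

Lemma ev_lin (f : M -> N) t phi : linear f ->
  f (ev t phi) = ev t (fun a => f (phi a)).
Proof.
move=> lf; pose h : {linear M -> N} :=
  HB.pack f (GRing.isLinear.Build K M N _ f lf).
rewrite -[f]/(h : M -> N) raddf_sum; apply: eq_bigr => p _.
exact: linearZ_LR.
Qed.

Lemma lin0 (f : M -> N) : linear f -> f 0 = 0.
Proof.
move=> lf; pose h : {linear M -> N} :=
  HB.pack f (GRing.isLinear.Build K M N _ f lf).
exact: (raddf0 h).
Qed.

Lemma lin_sum (I : Type) (r : seq I) (F : I -> M) (f : M -> N) : linear f ->
  f (\sum_(i <- r) F i) = \sum_(i <- r) f (F i).
Proof.
move=> lf; pose h : {linear M -> N} :=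
  HB.pack f (GRing.isLinear.Build K M N _ f lf).
exact: (raddf_sum h).
Qed.

Lemma ev_ev t s (phi : A -> B -> M) :
  ev t (fun a => ev s (phi a)) = ev s (fun b => ev t (phi^~ b)).
Proof.
rewrite /ev.
under eq_bigr do rewrite scaler_sumr.
rewrite exchange_big; apply: eq_bigr => q _.
by rewrite scaler_sumr; apply: eq_bigr => p _; rewrite !scalerA mulrC.
Qed.

Definition bind t (k : A -> seq (K * B)) : seq (K * B) :=
  flatten [seq [seq (p.1 * q.1, q.2) | q <- k p.2] | p <- t].

Lemma ev_bind t k (phi : B -> M) : ev (bind t k) phi = ev t (fun a => ev (k a) phi).
Proof.
rewrite /ev big_flatten big_map; apply: eq_bigr => p _; rewrite big_map.
by rewrite scaler_sumr; apply: eq_bigr => q _; rewrite scalerA.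
Qed.

End FormalSums.

Lemma lin_comp (K : fieldType) (A B C : lmodType K) (f : A -> B) (g : B -> C) :
  linear f -> linear g -> linear (fun x => g (f x)).
Proof. by move=> lf lg a x y; rewrite lf lg. Qed.

Lemma lin_add (K : fieldType) (A B : lmodType K) (f g : A -> B) :
  linear f -> linear g -> linear (fun x => f x + g x).
Proof. by move=> lf lg a x y; rewrite lf lg scalerDr addrACA. Qed.

(** Only the parity of a degree matters for a Koszul sign. The lemmas below take an abstract parity,
    so that they serve elements of V, positions in a word and Lie elements alike. *)
Definition hp (K : fieldType) (V : gradedSpace K) (x : hom V) : bool := odd `|hdeg x|%N.

Section Unshuffles.
Variables (K : fieldType) (T : eqType) (p : T -> bool).
Implicit Types (w a b : seq T) (x y : T).

Definition pw w : bool := \big[addb/false]_(x <- w) p x.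

Lemma pw_nil : pw [::] = false. Proof. exact: big_nil. Qed.
Lemma pw_cons x w : pw (x :: w) = p x (+) pw w. Proof. exact: big_cons. Qed.
Lemma pw_cat a b : pw (a ++ b) = pw a (+) pw b. Proof. exact: big_cat. Qed.
Lemma pw_rcons w x : pw (rcons w x) = pw w (+) p x.
Proof. by rewrite -cats1 pw_cat pw_cons pw_nil addbF. Qed.
Lemma pw_perm a b : perm_eq a b -> pw a = pw b.
Proof. exact: perm_big. Qed.

(** A letter sent to the second word has to pass the first one, whence the sign. *)
Fixpoint unsh w : seq (K * (seq T * seq T)) :=
  if w is x :: w' then
    [seq (q.1, (x :: q.2.1, q.2.2)) | q <- unsh w'] ++
    [seq ((-1) ^+ (p x && pw q.2.1) * q.1, (q.2.1, x :: q.2.2)) | q <- unsh w']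
  else [:: (1, ([::], [::]))].

(** Sweedler notation for the signed coshuffle coproduct of the word [w]. *)
Definition U (M : lmodType K) w (phi : seq T -> seq T -> M) : M :=
  ev (unsh w) (fun q => phi q.1 q.2).

Lemma unsh_perm w q : q \in unsh w -> perm_eq (q.2.1 ++ q.2.2) w.
Proof.
elim: w q => [|x w IH] q /=; first by rewrite inE => /eqP->.
rewrite mem_cat => /orP[] /mapP[r /IH rw ->] /=; first by rewrite perm_cons.
by rewrite (perm_catCA _ [:: x] _) /= perm_cons.
Qed.

Variable M : lmodType K.
Implicit Types phi psi : seq T -> seq T -> M.

Lemma eq_U_in w phi psi :
  (forall a b, perm_eq (a ++ b) w -> phi a b = psi a b) -> U w phi = U w psi.
Proof. by move=> e; apply: eq_ev_in => q /unsh_perm/e. Qed.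

Lemma eq_U w phi psi : phi =2 psi -> U w phi = U w psi.
Proof. by move=> e; apply: eq_U_in => a b _. Qed.

Lemma UD w phi psi : U w (fun a b => phi a b + psi a b) = U w phi + U w psi.
Proof. exact: evD. Qed.

Lemma UZ w c phi : U w (fun a b => c *: phi a b) = c *: U w phi.
Proof. exact: evZ. Qed.

Lemma U0 w : U w (fun _ _ => 0 : M) = 0. Proof. exact: ev0. Qed.

Lemma U_lin (N : lmodType K) (f : M -> N) w phi : linear f ->
  f (U w phi) = U w (fun a b => f (phi a b)).
Proof. exact: ev_lin. Qed.

Lemma U_ev (A : eqType) (t : seq (K * A)) w (phi : seq T -> seq T -> A -> M) :
  U w (fun a b => ev t (phi a b)) = ev t (fun c => U w (fun a b => phi a b c)).
Proof. exact: ev_ev. Qed.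

Lemma U_nil phi : U [::] phi = phi [::] [::].
Proof. exact: ev1. Qed.

Lemma U_cons x w phi : U (x :: w) phi =
  U w (fun a b => phi (x :: a) b) +
  U w (fun a b => (-1) ^+ (p x && pw a) *: phi a (x :: b)).
Proof.
rewrite /U [unsh (x :: w)]/= ev_cat !ev_map; congr (_ + _).
by apply: eq_bigr => q _ /=; rewrite scalerA mulrC.
Qed.

End Unshuffles.

(** Identities between parities are settled by a truth table over the words and letters that
    occur. *)
Ltac parity :=
  rewrite ?(pw_cons, pw_cat, pw_rcons, pw_nil);
  repeat match goal with |- context [@pw ?T ?p ?w] => destruct (@pw T p w) end;
  repeat match goal with |- context [@hp ?K ?V ?x] => destruct (@hp K V x) end;
  repeat match goal with q : _ -> bool |- _ =>
    match goal with |- context [q ?x] => destruct (q x) end end;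
  done.

Ltac signs := rewrite ?scalerA -?signr_addb;
  match goal with |- (-1) ^+ (nat_of_bool ?a) *: _ = (-1) ^+ (nat_of_bool ?b) *: _ =>
    (have -> : a = b by parity) end; done.

Section UnshuffleTheory.
Variables (K : fieldType) (T : eqType) (p : T -> bool) (M : lmodType K).
Implicit Types (w a b : seq T) (x y : T) (phi : seq T -> seq T -> M).
Local Notation U := (U p).
Local Notation pw := (pw p).

(** Multiplicativity of the coshuffle coproduct for concatenation; the sign moves [c] past [b]. *)
Lemma U_cat u w phi : U (u ++ w) phi =
  U u (fun a b => U w (fun c e => (-1) ^+ (pw b && pw c) *: phi (a ++ c) (b ++ e))).
Proof.
elim: u phi => [|x u IH] phi /=.
  by rewrite U_nil; apply: eq_U => a b; rewrite pw_nil scale1r.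
rewrite !U_cons !IH; congr (_ + _).
apply: eq_U => a b; rewrite -UZ; apply: eq_U => c e.
by signs.
Qed.

Lemma U_rcons w y phi : U (rcons w y) phi =
  U w (fun a b => (-1) ^+ (p y && pw b) *: phi (rcons a y) b) +
  U w (fun a b => phi a (rcons b y)).
Proof.
rewrite -cats1 U_cat -UD; apply: eq_U => a b.
by rewrite U_cons !U_nil !pw_nil !cats0 !andbF !scale1r !cats1 pw_cons pw_nil
  addbF andbC.
Qed.

Lemma U_C w phi : U w phi = U w (fun a b => (-1) ^+ (pw a && pw b) *: phi b a).
Proof.
elim: w phi => [|x w IH] phi; first by rewrite !U_nil pw_nil scale1r.
rewrite !U_cons addrC; congr (_ + _); rewrite IH; apply: eq_U => a b; signs.
Qed.

(** Coassociativity: both sides distribute the letters over three words, and the first letter is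
    followed to each of its three destinations. *)
Lemma U_A w (phi : seq T -> seq T -> seq T -> M) :
  U w (fun a b => U a (fun a1 a2 => phi a1 a2 b)) =
  U w (fun a b => U b (fun b1 b2 => phi a b1 b2)).
Proof.
elim: w phi => [|x w IH] phi; first by rewrite !U_nil.
rewrite !U_cons.
have -> : U w (fun a b => U (x :: a) (fun a1 a2 => phi a1 a2 b)) =
  U w (fun a b => U a (fun a1 a2 => phi (x :: a1) a2 b)) +
  U w (fun a b => U a (fun a1 a2 => (-1) ^+ (p x && pw a1) *: phi a1 (x :: a2) b)).
  by rewrite -UD; apply: eq_U => a b; rewrite U_cons.
rewrite IH -addrA; congr (_ + _).
have -> : U w (fun a b => (-1) ^+ (p x && pw a) *: U (x :: b) (phi a)) =
  U w (fun a b => U b (fun b1 b2 => (-1) ^+ (p x && pw a) *: phi a (x :: b1) b2)) +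
  U w (fun a b => U b (fun b1 b2 => (-1) ^+ (p x && pw a) *:
       ((-1) ^+ (p x && pw b1) *: phi a b1 (x :: b2)))).
  by rewrite -UD; apply: eq_U => a b; rewrite U_cons scalerDr !UZ.
congr (_ + _).
  by rewrite IH.
rewrite -IH; apply: eq_U_in => a b _; rewrite -UZ; apply: eq_U_in => c e ce.
by rewrite -(pw_perm p ce); signs.
Qed.

End UnshuffleTheory.

(** * Symmetrisation of words *)

Section Symmetrizer.
Variables (K : fieldType) (T : eqType) (p : T -> bool).
Implicit Types (w a b u v : seq T) (x y : T).
Local Notation U := (U p).
Local Notation pw := (pw p).

(** Each step chooses the first letter of the rearrangement and divides by the number of choices, so
    the weights multiply to the inverse factorial. *)
Fixpoint sl n w : seq (K * seq T) :=
  if n is n'.+1 then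
    bind (unsh K p w) (fun q => if q.1 is [:: x] then
      [seq (n%:R^-1 * r.1, x :: r.2) | r <- sl n' q.2] else [::])
  else if w is [::] then [:: (1, [::])] else [::].

(** The normalised symmetriser: the sum over all signed permutations of [w],
    divided by [(size w)`!]. *)
Definition avg (M : lmodType K) w (phi : seq T -> M) : M := ev (sl (size w) w) phi.

(** The signed sum over all ways to extract one letter from [w]. *)
Definition pick1 (M : lmodType K) w (psi : T -> seq T -> M) : M :=
  U w (fun a b => if a is [:: x] then psi x b else 0).

(** Graded symmetry of functions of words: with [mlin], they factor through [Sge]. *)
Definition symf (M : lmodType K) (phi : seq T -> M) :=
  forall s x y t, phi (s ++ x :: y :: t) = (-1) ^+ (p x && p y) *: phi (s ++ y :: x :: t).

Section Theory.
Variable M : lmodType K.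
Implicit Types (phi : seq T -> M) (psi : T -> seq T -> M).

Lemma U_AC w (phi : seq T -> seq T -> seq T -> M) :
  U w (fun a b => U b (fun b1 b2 => phi a b1 b2)) =
  U w (fun b1 c => U c (fun a b2 => (-1) ^+ (pw a && pw b1) *: phi a b1 b2)).
Proof.
rewrite -U_A -[RHS]U_A; apply: eq_U => c b2; rewrite U_C.
by apply: eq_U => a b1; rewrite andbC.
Qed.

Lemma U_emptyl w (f : seq T -> M) :
  U w (fun a b => if a is [::] then f b else 0) = f w.
Proof.
elim: w f => [|x w IH] f; first by rewrite U_nil.
rewrite U_cons U0 add0r -[RHS](IH (fun b => f (x :: b))); apply: eq_U => -[|y a] b.
  by rewrite pw_nil andbF scale1r.
by rewrite scaler0.
Qed.

Lemma pick1_cons x w psi : pick1 (x :: w) psi =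
  psi x w + pick1 w (fun y v => (-1) ^+ (p x && p y) *: psi y (x :: v)).
Proof.
rewrite /pick1 U_cons; congr (_ + _).
  by rewrite -[RHS](U_emptyl w (psi x)); apply: eq_U => -[].
apply: eq_U => -[|y [|z a]] b; rewrite ?scaler0 //.
by rewrite pw_cons pw_nil addbF.
Qed.

Lemma pick1_nil psi : pick1 [::] psi = 0.
Proof. exact: U_nil. Qed.

Lemma eq_pick1_in w psi psi' :
  (forall x v, perm_eq (x :: v) w -> psi x v = psi' x v) ->
  pick1 w psi = pick1 w psi'.
Proof. by move=> e; apply: eq_U_in => -[|x [|? ?]] b // /e. Qed.

Lemma Sn_rec n w phi : ev (sl n.+1 w) phi =
  n.+1%:R^-1 *: pick1 w (fun x v => ev (sl n v) (fun u => phi (x :: u))).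
Proof.
rewrite /= ev_bind /pick1 -UZ; apply: eq_ev => -[[|x [|y a]] b] /=;
  rewrite ?scaler0 /ev ?big_nil // big_map scaler_sumr.
by apply: eq_bigr => r _; rewrite scalerA.
Qed.

Lemma sl_perm n w r : size w = n -> r \in sl n w -> perm_eq r.2 w.
Proof.
elim: n w r => [|n IH] w r /=; first by case: w => // _; rewrite inE => /eqP->.
move=> sw /flatten_mapP[q /unsh_perm qw /mapP[r' + ->]] /=.
case: q.2 qw => -[|x [|y a]] b //= qw /mapP[r0 r0b ->] /=.
apply: (perm_trans _ qw); rewrite /= perm_cons IH //.
by move: (perm_size qw) => /=; rewrite sw => -[].
Qed.

Lemma avg_nil phi : avg [::] phi = phi [::].
Proof. exact: ev1. Qed.

Lemma eq_avg_in w phi phi' : (forall v, perm_eq v w -> phi v = phi' v) ->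
  avg w phi = avg w phi'.
Proof. by move=> e; apply: eq_ev_in => q /sl_perm/e->. Qed.

Lemma eq_avg w phi phi' : phi =1 phi' -> avg w phi = avg w phi'.
Proof. by move=> e; apply: eq_avg_in => v _. Qed.

Lemma avgD w phi phi' : avg w (fun v => phi v + phi' v) = avg w phi + avg w phi'.
Proof. exact: evD. Qed.

Lemma avgZ w c phi : avg w (fun v => c *: phi v) = c *: avg w phi.
Proof. exact: evZ. Qed.

Lemma avg_single x phi : avg [:: x] phi = phi [:: x].
Proof.
rewrite /avg Sn_rec pick1_cons pick1_nil addr0.
by rewrite (ev1 _ (fun u => phi (x :: u))) invr1 scale1r.
Qed.

(** Two neighbouring letters either go to the same side, where [phi] is symmetric, or are separated;
    the swap exchanges the two separated terms. *)
Lemma U_symf (phi : seq T -> seq T -> M) :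
  (forall b, symf (phi^~ b)) -> (forall a, symf (phi a)) -> symf (fun w => U w phi).
Proof.
move=> + + s x y t; elim: s phi => [|u s IH] phi sl sr /=.
  rewrite !U_cons !scalerDr -!UZ -!UD; apply: eq_U => a b.
  have := sl b [::] x y a; have := sr a [::] x y b; rewrite /= => -> ->; rewrite -?addrA !scalerA -!signr_addb.
  congr (_ + _); rewrite addrCA; congr (_ + (_ + _)); signs.
have pws z z' r r' : pw (r ++ z :: z' :: r') = pw (r ++ z' :: z :: r') by parity.
rewrite !U_cons scalerDr; congr (_ + _).
  by apply: IH => [b|a] s' x' y' t'; [apply: (sl _ (u :: s'))|apply: sr].
apply: IH => [b|a] s' x' y' t'.
  by rewrite sl pws !scalerA mulrC.
by rewrite (sr a (u :: s')) !scalerA mulrC.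
Qed.

(** Extraction of the first letter is a case of [U_symf]: as a function of the first factor it
    vanishes on words of two or more letters, hence is symmetric, and in the second factor induction
    applies. *)
Lemma avg_symf phi : symf (fun w => avg w phi).
Proof.
have sn n (f : seq T -> M) : symf (fun w => ev (sl n w) f).
  elim: n f => [|n IH] f s x y t; first by case: s => [|? ?] /=; rewrite /ev !big_nil scaler0.
  rewrite !Sn_rec scalerA mulrC -scalerA; congr (_ *: _); move: s x y t.
  apply: U_symf => [b|a] s x y t; last first.
    case: a => [|z [|z' a]]; rewrite ?scaler0 //; exact: (IH (fun u => f (z :: u))).
  by case: s => [|z [|z' s]]; rewrite scaler0.
move=> s x y t.
have -> : avg (s ++ x :: y :: t) phi = ev (sl (size (s ++ y :: x :: t)) (s ++ x :: y :: t)) phi.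
  by rewrite /avg !size_cat.
exact: sn.
Qed.

Hypothesis char0 : [pchar K] =i pred0.

Lemma natr_neq0 n : n.+1%:R != 0 :> K.
Proof. by have /pcharf0P-> := char0. Qed.

Lemma avg_pick w phi :
  (size w)%:R *: avg w phi = pick1 w (fun x v => avg v (fun u => phi (x :: u))).
Proof.
case sw: (size w) => [|n].
  by rewrite scale0r (size0nil sw) pick1_nil.
rewrite /avg sw Sn_rec scalerA mulfV ?natr_neq0 // scale1r.
apply: eq_pick1_in => x v /perm_size /=; rewrite sw => -[->] //.
Qed.

(** Both sides are multiplied by [size w]. On the left, the first letter of the rearranged word goes
    left or right; on the right, [size w] splits as [size a + size b], and each summand extracts a
    first letter from [a] or from [b]. *)
Lemma avg_U w (phi : seq T -> seq T -> M) :
  avg w (fun v => U v phi) = U w (fun a b => avg a (fun a' => avg b (phi a'))).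
Proof.
elim: {w}(size w) {-2}w (erefl (size w)) phi => [|n IH] w sw phi.
  by rewrite (size0nil sw) avg_nil !U_nil !avg_nil.
apply: (scalerI (natr_neq0 n)); rewrite -{1}sw avg_pick.
have IHv x v : perm_eq (x :: v) w -> size v = n.
  by move/perm_size; rewrite /= sw => -[].
have -> : pick1 w (fun x v => avg v (fun u => U (x :: u) phi)) =
   pick1 w (fun x v => U v (fun a b => avg a (fun a' => avg b (phi (x :: a')))))
 + pick1 w (fun x v => U v (fun a b => (-1) ^+ (p x && pw a) *:
             avg a (fun a' => avg b (fun b' => phi a' (x :: b'))))).
  rewrite /pick1 -UD; apply: eq_U_in => -[|x [|y a]] b; rewrite ?addr0 // => xb.
  have sb := IHv _ _ xb.
  rewrite (eq_avg _ (fun v => U_cons p x v phi)) avgD !IH //; congr (_ + _).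
  apply: eq_U => a b0; rewrite -avgZ; apply: eq_avg_in => a' a'a.
  by rewrite avgZ (pw_perm p a'a).
have -> : n.+1%:R *: U w (fun a b => avg a (fun a' => avg b (phi a'))) =
  U w (fun a b => (size a)%:R *: avg a (fun a' => avg b (phi a'))) +
  U w (fun a b => avg a (fun a' => (size b)%:R *: avg b (phi a'))).
  rewrite -UD -UZ; apply: eq_U_in => a b /perm_size; rewrite size_cat sw => <-.
  by rewrite avgZ natrD scalerDl.
congr (_ + _).
  transitivity (U w (fun a b => U a (fun a1 a2 =>
    if a1 is [:: x] then avg a2 (fun u => avg b (phi (x :: u))) else 0))); last first.
    by apply: eq_U => a b; rewrite avg_pick.
  rewrite U_A; apply: eq_U => -[|x [|y a]] b //; by rewrite U0.
transitivity (U w (fun a b => U b (fun b1 b2 =>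
    if b1 is [:: x] then avg a (fun a' => avg b2 (fun u => phi a' (x :: u))) else 0))).
  rewrite U_AC; apply: eq_U => -[|x [|y a]] b.
  - by rewrite -[LHS](U0 p M b); apply: eq_U => ? ?; rewrite scaler0.
  - by apply: eq_U => a b2; rewrite pw_cons pw_nil addbF andbC.
  - by rewrite -[LHS](U0 p M b); apply: eq_U => ? ?; rewrite scaler0.
apply: eq_U => a b.
rewrite (eq_avg _ (fun a' => avg_pick b (phi a'))).
by rewrite /pick1 [RHS]ev_ev; apply: eq_ev => -[[|x [|y b1]] b2] /=; rewrite ?ev0.
Qed.

(** Only words of the length of [w] are permuted, so symmetry is needed there only. *)
Lemma pick1_sym n w phi : size w = n ->
  (forall s x y t, (size s + size t).+2 = n ->
    phi (s ++ x :: y :: t) = (-1) ^+ (p x && p y) *: phi (s ++ y :: x :: t)) ->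
  pick1 w (fun x v => phi (x :: v)) = n%:R *: phi w.
Proof.
elim: w n phi => [|x w IH] n phi <- sy; first by rewrite pick1_nil scale0r.
rewrite pick1_cons /= -natr1 addrC scalerDl scale1r; congr (_ + _).
rewrite -(IH _ (fun v => phi (x :: v)) erefl) => [|s y z t st].
  apply: eq_pick1_in => y v yv; rewrite (sy [::] y x v) ?signrMK //.
    by rewrite scalerA andbC -signr_addb addbb scale1r.
  by rewrite /= -(perm_size yv).
by apply: (sy (x :: s)); rewrite /= -st.
Qed.

Lemma avg_sym n w phi : size w = n ->
  (forall s x y t, (size s + size t).+2 = n ->
    phi (s ++ x :: y :: t) = (-1) ^+ (p x && p y) *: phi (s ++ y :: x :: t)) ->
  avg w phi = phi w.
Proof.
elim: n w phi => [|n IH] w phi sw sy; first by rewrite (size0nil sw) avg_nil.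
apply: (scalerI (natr_neq0 n)); rewrite -{1}sw avg_pick -(pick1_sym sw) //.
apply: eq_pick1_in => x v /perm_size /=; rewrite sw => -[sv].
rewrite (IH _ (fun u => phi (x :: u))) // => s y z t st.
by apply: (sy (x :: s)); rewrite /= -st.
Qed.

End Theory.
End Symmetrizer.

Section WordMaps.
Variables (K : fieldType) (T T' : eqType) (p : T -> bool) (p' : T' -> bool) (X : T' -> T).
Hypothesis pX : forall x, p (X x) = p' x.
Variable M : lmodType K.
Implicit Types (l : seq T').

Lemma pw_map l : pw p (map X l) = pw p' l.
Proof. by rewrite /pw big_map; apply: eq_bigr. Qed.

(** Used with [X] sending positions to letters: possibly repeated letters are replaced by distinct,
    ordered positions. *)
Lemma U_map l (phi : seq T -> seq T -> M) :
  U p (map X l) phi = U p' l (fun a b => phi (map X a) (map X b)).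
Proof.
elim: l phi => [|x l IH] phi; first by rewrite !U_nil.
by rewrite !U_cons !IH; congr (_ + _); apply: eq_U => a b; rewrite pX pw_map.
Qed.

Lemma avg_map l (phi : seq T -> M) :
  avg p (map X l) phi = avg p' l (fun a => phi (map X a)).
Proof.
rewrite /avg size_map; move: (size l) => n; elim: n l phi => [|n IH] l phi.
  by case: l => [|? ?]; rewrite /ev ?big_nil //= !big_seq1.
rewrite !Sn_rec /pick1 U_map; congr (_ *: _); apply: eq_U => -[|x [|y a]] b //=.
Qed.

End WordMaps.

(** * Splittings of words into blocks *)

Section Blocks.
Variables (K : fieldType) (T : eqType) (p : T -> bool).
Implicit Types (w : seq T).

(** Signed splittings of a word into nonempty blocks whose last letters are in
    order; the fuel [n] should be at least [size w]. *)
Fixpoint ebl n w : seq (K * seq (seq T)) :=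
  if w is x :: w' then
    if n is n'.+1 then
      bind (unsh K p (belast x w')) (fun q =>
        [seq (r.1, rcons r.2 (rcons q.2 (last x w'))) | r <- ebl n' q.1])
    else [::]
  else [:: (1, [::])].

(** The definition inspects the first letter only to see that the word is nonempty; what it splits
    off is the block of the last letter. *)
Lemma ebl_rcons n w y : ebl n.+1 (rcons w y) =
  bind (unsh K p w) (fun q => [seq (r.1, rcons r.2 (rcons q.2 y)) | r <- ebl n q.1]).
Proof.
rewrite headI [LHS]/=.
have /rcons_inj[-> ->//] : rcons (belast (head y w) (behead (rcons w y)))
   (last (head y w) (behead (rcons w y))) = rcons w y by rewrite -lastI -headI.
Qed.

Variable M : lmodType K.
Implicit Types (phi : seq (seq T) -> M).

Lemma ev_ebl_rcons n w y phi : ev (ebl n.+1 (rcons w y)) phi =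
  U p w (fun a b => ev (ebl n a) (fun bs => phi (rcons bs (rcons b y)))).
Proof.
rewrite ebl_rcons ev_bind; apply: eq_ev => q; rewrite ev_map.
by apply: eq_bigr.
Qed.

Lemma ev_ebl_nil n phi : ev (ebl n [::]) phi = phi [::].
Proof. by case: n => [|n]; apply: ev1. Qed.

Lemma ebl_fuel n m w phi : (size w <= n)%N -> (size w <= m)%N ->
  ev (ebl n w) phi = ev (ebl m w) phi.
Proof.
elim: n m w phi => [|n IH] m w phi.
  by rewrite leqn0 => /nilP-> _; rewrite !ev_ebl_nil.
case/lastP: w => [|w y]; first by rewrite !ev_ebl_nil.
rewrite size_rcons ltnS => wn; case: m => // m; rewrite ltnS => wm.
rewrite !ev_ebl_rcons; apply: eq_U_in => a b /perm_size ab; apply: IH.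
  by apply: leq_trans wn; rewrite -ab size_cat leq_addr.
by apply: leq_trans wm; rewrite -ab size_cat leq_addr.
Qed.

End Blocks.

Lemma ev_ebl_map (K : fieldType) (T T' : eqType) (p : T -> bool) (p' : T' -> bool)
    (X : T' -> T) (M : lmodType K) n (l : seq T') (phi : seq (seq T) -> M) :
  (forall x, p (X x) = p' x) ->
  ev (ebl K p n (map X l)) phi = ev (ebl K p' n l) (fun bs => phi (map (map X) bs)).
Proof.
move=> pX; elim: n l phi => [|n IH] l phi.
  by case: l => [|x l]; rewrite /ev ?big_nil //= !big_seq1.
case/lastP: l => [|l y]; first by rewrite !ev_ebl_nil.
rewrite map_rcons !ev_ebl_rcons (U_map pX); apply: eq_U => a b.
by rewrite IH; apply: eq_ev => bs; rewrite map_rcons map_rcons.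
Qed.

Lemma ebl_perm (K : fieldType) (T : eqType) (p : T -> bool) n (w : seq T) q :
  q \in ebl K p n w -> perm_eq (flatten q.2) w.
Proof.
elim: n w q => [|n IH] w q; first by case: w => //; rewrite inE => /eqP->.
case/lastP: w => [|w y]; first by rewrite inE => /eqP->.
rewrite ebl_rcons => /flatten_mapP[u /unsh_perm uw /mapP[r' r'u ->]].
case/mapP: r'u => r /IH ru -> /=.
rewrite -cats1 flatten_cat /= cats0 -cats1 catA -[rcons w y]cats1 perm_cat2r.
by apply: (perm_trans _ uw); rewrite perm_cat2r.
Qed.

(** * Sums over permutations as sums over words *)

Section IndexWords.
Variables (K : fieldType) (p : nat -> bool) (M : lmodType K).
Implicit Types (l a b : seq nat).

(** [ksg l] is the exponent of the Koszul sign of the rearrangement [l] of an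
    increasing sequence: the parity of the number of inversions of odd letters. *)
Definition inv1 i l : bool := \big[addb/false]_(j <- l | (j < i)%N) (p i && p j).
Fixpoint ksg l : bool := if l is i :: l' then inv1 i l' (+) ksg l' else false.

Lemma inv1_perm i a b : perm_eq a b -> inv1 i a = inv1 i b.
Proof. exact: perm_big. Qed.

Lemma ksg_cat a b :
  ksg (a ++ b) = ksg a (+) ksg b (+) \big[addb/false]_(i <- a) inv1 i b.
Proof.
elim: a => [|i a IH] /=; first by rewrite big_nil addbF.
rewrite IH big_cons /inv1 big_cat /=.
by rewrite addbACA !addbA.
Qed.

Lemma inv1_min i l : all (leq i) l -> inv1 i l = false.
Proof.
move=> /allP il; rewrite /inv1 big_seq_cond big1 // => j /andP[/il ij].
by rewrite ltnNge ij.
Qed.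

Lemma ksg_sorted l : sorted ltn l -> ksg l = false.
Proof.
elim: l => //= i l IH il; rewrite inv1_min ?IH ?(path_sorted il) //.
by apply/allP => j /(allP (order_path_min ltn_trans il))/ltnW.
Qed.

(** The recursive signs count inversions: a letter [x] sent to the second word is smaller than all
    letters of the first, and forms an inversion with each of them. *)
Lemma unsh_sorted l q : sorted ltn l -> q \in unsh K p l ->
  [/\ sorted ltn q.2.1, sorted ltn q.2.2 & q.1 = (-1) ^+ ksg (q.2.1 ++ q.2.2)].
Proof.
elim: l q => [|x l IH] q sl /=.
  by rewrite inE => /eqP ->; split.
have xl := order_path_min ltn_trans sl.
have min r : r \in unsh K p l -> all (ltn x) (r.2.1 ++ r.2.2).
  by move/unsh_perm/perm_all => ->.
rewrite mem_cat => /orP[] /mapP[r rl ->] /=;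
  have [sa sb e] := IH _ (path_sorted sl) rl;
  have := min _ rl; rewrite all_cat => /andP[xa xb]; split => //.
- by rewrite path_sortedE ?sa ?xa //; apply: ltn_trans.
- rewrite e inv1_min // all_cat; apply/andP; split; apply/allP => j.
    by move/(allP xa)/ltnW.
  by move/(allP xb)/ltnW.
- by rewrite path_sortedE ?sb ?xb //; apply: ltn_trans.
rewrite e -signr_addb; congr (_ ^+ nat_of_bool _).
rewrite !ksg_cat /= inv1_min; last by apply/allP => j /(allP xb)/ltnW.
rewrite addFb addbC -addbA; congr (_ (+) _).
have -> : \big[addb/false]_(i <- r.2.1) inv1 i (x :: r.2.2) =
   \big[addb/false]_(i <- r.2.1) ((p x && p i) (+) inv1 i r.2.2).
  apply: eq_big_seq => i ia; rewrite /inv1 big_cons.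
  by move/(allP xa): ia => /= ->; rewrite andbC.
rewrite big_split addbC /=; congr (_ (+) _).
rewrite /pw; elim: (r.2.1) => [|i s]; first by rewrite !big_nil andbF.
by rewrite !big_cons => <-; case: (p x).
Qed.

Lemma unsh_uniq l : uniq l -> uniq (map snd (unsh K p l)).
Proof.
elim: l => //= x l IH /andP[xl /IH ul].
rewrite map_cat cat_uniq -!map_comp; apply/and3P; split.
- rewrite (eq_map (g := (fun r => (x :: r.1, r.2)) \o snd)) // map_comp.
  by rewrite map_inj_uniq // => -[a b] [c d] [-> ->].
- apply/hasPn => _ /mapP[q ql ->] /=; apply/negP => /mapP[r rl [qa _]].
  move/unsh_perm: ql => /perm_mem/(_ x).
  by rewrite mem_cat qa inE eqxx (negbTE xl).
rewrite (eq_map (g := (fun r => (r.1, x :: r.2)) \o snd)) // map_comp.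
by rewrite map_inj_uniq // => -[a b] [c d] [-> ->].
Qed.

(** The least letter heads whichever of [a] and [b] contains it, which fixes the recursive choice.
    With [unsh_sorted] and [unsh_uniq], this makes [unsh] on an increasing word an enumeration of
    the shuffles, each once and with its Koszul sign. *)
Lemma unsh_complete l a b : sorted ltn l -> sorted ltn a -> sorted ltn b ->
  perm_eq (a ++ b) l -> (a, b) \in map snd (unsh K p l).
Proof.
elim: l a b => [|x l IH] a b sl sa sb abl.
  by move: (perm_size abl) => /=; case: a b {sa sb abl} => [|? ?] [|? ?].
have xl := order_path_min ltn_trans sl.
have hd c : sorted ltn c -> x \in c -> {subset c <= x :: l} -> c = x :: behead c.
  case: c => //= y c sc; rewrite inE => /orP[/eqP-> //|xc] cs.
  have := cs y (mem_head _ _); rewrite inE => /orP[/eqP-> //|/(allP xl)/= xy].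
  by have /(allP (order_path_min ltn_trans sc)) := xc; rewrite /= ltnNge ltnW.
have sub c : {subset c <= a ++ b} -> {subset c <= x :: l}.
  by move=> h y /h; rewrite (perm_mem abl).
have : x \in a ++ b by rewrite (perm_mem abl) mem_head.
rewrite /= map_cat mem_cat -!map_comp mem_cat => /orP[xa|xb]; apply/orP; [left|right].
  have ea : a = x :: behead a.
    by apply: hd => //; apply: (sub _ a) => y ya; rewrite mem_cat ya.
  have := IH (behead a) b (path_sorted sl).
  rewrite ea /= in sa abl *; rewrite (path_sorted sa) sb -(perm_cons x) => /(_ isT isT abl).
  by case/mapP => q ql qe; apply/mapP; exists q => //=; rewrite -qe.
have eb : b = x :: behead b.
  by apply: hd => //; apply: (sub _ b) => y yb; rewrite mem_cat yb orbT.
have := IH a (behead b) (path_sorted sl).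
rewrite eb /= in sb abl *; rewrite (path_sorted sb) sa -(perm_cons x).
rewrite -(perm_catCA _ [:: x]) => /(_ isT isT abl).
by case/mapP => q ql qe; apply/mapP; exists q => //=; rewrite -qe.
Qed.

End IndexWords.

Section PermutationLists.
Variables (n : nat).

Lemma size_perm_seq (s : {perm 'I_n}) : size (perm_seq s) = n.
Proof. by rewrite size_map size_enum_ord. Qed.

Lemma nth_perm_seq (s : {perm 'I_n}) (i : 'I_n) : nth 0 (perm_seq s) i = s i.
Proof. by rewrite (nth_map i) ?size_enum_ord // nth_ord_enum. Qed.

Lemma perm_seq_inj : injective (@perm_seq n).
Proof.
move=> s t st; apply/permP => i; apply: val_inj => /=.
by rewrite -!nth_perm_seq st.
Qed.

Lemma perm_seq_iota (s : {perm 'I_n}) : perm_eq (perm_seq s) (iota 0 n).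
Proof.
rewrite -val_enum_ord /perm_seq [map _ _](map_comp val s (enum 'I_n)).
apply/perm_map/uniq_perm; rewrite ?map_inj_uniq ?enum_uniq //.
- by rewrite -enumT enum_uniq.
- exact: perm_inj.
- by rewrite -enumT enum_uniq.
move=> i; rewrite mem_enum; apply/mapP; exists ((s^-1)%g i); first by rewrite mem_enum.
by rewrite permKV.
Qed.

Lemma perm_seq_surj l : perm_eq l (iota 0 n) -> exists s : {perm 'I_n}, perm_seq s = l.
Proof.
move=> ln; have sl : size l = n by rewrite (perm_size ln) size_iota.
have lt_l (i : 'I_n) : (nth 0 l i < n)%N.
  have : nth 0 l i \in l by rewrite mem_nth ?sl.
  by rewrite (perm_mem ln) mem_iota.
pose f (i : 'I_n) := Ordinal (lt_l i).
have f_inj : injective f.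
  move=> i j [] /eqP; rewrite nth_uniq ?sl ?(perm_uniq ln) ?iota_uniq //.
  by move/eqP/val_inj.
exists (perm f_inj); apply: (@eq_from_nth _ 0); rewrite size_perm_seq ?sl // => i li.
by rewrite (nth_perm_seq _ (Ordinal li)) permE.
Qed.

(** [perm_seq] is a bijection from permutations to arrangements of the positions, so any
    duplicate-free list of the admissible arrangements can index the sum. *)
Lemma sum_perm_seq (M : nmodType) (P : pred (seq nat)) (F : seq nat -> M) r :
  uniq r -> (forall l, (l \in r) = perm_eq l (iota 0 n) && P l) ->
  \sum_(s : {perm 'I_n} | P (perm_seq s)) F (perm_seq s) = \sum_(l <- r) F l.
Proof.
move=> ur mr; rewrite -big_filter -(big_map _ predT F).
apply: perm_big; apply: uniq_perm => // [|l].
  by rewrite map_inj_uniq ?filter_uniq ?index_enum_uniq //; apply: perm_seq_inj.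
rewrite mr; apply/mapP/andP => [[s] | [/perm_seq_surj[s <-] Ps]].
  by rewrite mem_filter => /andP[Ps _] ->; rewrite perm_seq_iota.
by exists s => //; rewrite mem_filter Ps mem_index_enum.
Qed.

End PermutationLists.

Section KoszulSigns.
Variables (K : fieldType) (V : gradedSpace K).
Implicit Types (xs : seq (hom V)) (l : seq nat).

Lemma exprz_sign (m : int) : (-1) ^ m = (-1) ^+ odd `|m|%N :> K.
Proof.
case: m => m; first by rewrite /exprz signr_odd.
by rewrite /exprz -exprVn invrN1 signr_odd.
Qed.

Lemma exprz_hdegM (x y : hom V) : (-1) ^ (hdeg x * hdeg y) = (-1) ^+ (hp x && hp y) :> K.
Proof. by rewrite exprz_sign abszM oddM. Qed.

Definition index_parity xs (i : nat) : bool := hp (nth (hom0 V) xs i).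

(** Induction on the list of values: the pairs with [i = 0] give [inv1] of the first value, and no
    pair has [j = 0]. *)
Lemma koszulE n (s : {perm 'I_n}) xs :
  koszul s xs = (-1) ^+ ksg (index_parity xs) (perm_seq s).
Proof.
have step l (p : nat -> bool) :
  \prod_(0 <= i < size l) \prod_(0 <= j < size l | (i < j)%N && (nth 0 l j < nth 0 l i)%N)
     (-1) ^+ (p (nth 0%N l i) && p (nth 0%N l j)) = (-1) ^+ ksg p l :> K.
  elim: l => [|x l IH]; first by rewrite big_nil.
  rewrite [size _]/= big_nat_recl // -[in RHS]/(inv1 p x l (+) ksg p l) signr_addb -IH.
  congr (_ * _).
    rewrite big_mkcond big_nat_recl //= mul1r -big_mkcond /=.
    have -> : inv1 p x l =
      \big[addb/false]_(0 <= j < size l | (nth 0 l j < x)%N) (p x && p (nth 0%N l j)).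
      exact: big_nth.
    by rewrite (big_morph (fun b : bool => (-1) ^+ b : K) (@signr_addb K) (erefl : (-1) ^+ false = 1 :> K)).
  apply: eq_big_nat => i _; rewrite big_mkcond big_nat_recl //= mul1r -big_mkcond /=.
  by [].
rewrite -step size_perm_seq big_mkord; apply: eq_bigr => i _.
rewrite big_mkord; apply: eq_big => [j|j _]; rewrite !nth_perm_seq //.
by rewrite exprz_hdegM.
Qed.

End KoszulSigns.

Section ShuffleSums.
Variables (K : fieldType) (p : nat -> bool) (M : lmodType K).
Implicit Types (l a b : seq nat).

(** In an increasing word, the letters that [x] passes on its way to the front are exactly the
    smaller ones. *)
Lemma pick1_sorted l (psi : nat -> seq nat -> M) : sorted ltn l ->
  pick1 p l psi = \sum_(x <- l) (-1) ^+ inv1 p x (rem x l) *: psi x (rem x l).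
Proof.
elim: l psi => [|x l IH] psi xl; first by rewrite pick1_nil big_nil.
have lx := order_path_min ltn_trans xl.
rewrite pick1_cons big_cons /= eqxx inv1_min ?scale1r; last first.
  by apply/allP => y /(allP lx)/ltnW.
congr (_ + _); rewrite IH ?(path_sorted xl) //; apply: eq_big_seq => y yl.
have xy := allP lx _ yl; rewrite /= (ltn_eqF xy) /inv1 big_cons xy signr_addb.
by rewrite scalerA andbC mulrC.
Qed.

Hypothesis char0 : [pchar K] =i pred0.

Lemma sum_permutations l (F : seq nat -> M) : sorted ltn l ->
  \sum_(v <- permutations l) (-1) ^+ ksg p v *: F v = (size l)`!%:R *: avg p l F.
Proof.
elim: {l}(size l) {-2}l (erefl (size l)) F => [|n IH] l sl F so.
  by rewrite (size0nil sl) avg_nil big_seq1.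
have ul : uniq l by apply: (sorted_uniq ltn_trans ltnn).
rewrite (perm_big _ (permutationsE _)) ?sl //= undup_id // big_allpairs_dep.
rewrite factS natrM -scalerA scalerA mulrC -scalerA -{1}sl avg_pick //.
rewrite pick1_sorted // scaler_sumr; apply: eq_big_seq => x xl.
have sx : size (rem x l) = n by rewrite size_rem // sl.
rewrite [RHS]scalerA mulrC -scalerA -{1}sx -IH ?sx //; last first.
  by apply: subseq_sorted so; [apply: ltn_trans|apply: rem_subseq].
rewrite scaler_sumr; apply: eq_big_seq => v; rewrite mem_permutations => vx.
by rewrite /= (inv1_perm p x vx) signr_addb scalerA.
Qed.

Lemma unsh_sum l k (F : seq nat -> M) : sorted ltn l -> (k <= size l)%N ->
  \sum_(v <- [seq q.2.1 ++ q.2.2 | q <- unsh K p l & size q.2.1 == k])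
     (-1) ^+ ksg p v *: F v =
  U p l (fun a b => if size a == k then F (a ++ b) else 0).
Proof.
move=> so kl; rewrite big_map big_filter big_mkcond /=; apply: eq_big_seq => q ql.
by case: ifP => _; rewrite ?scaler0 //; have [_ _ ->] := unsh_sorted so ql.
Qed.

End ShuffleSums.

Section KoszulSums.
Variables (K : fieldType) (V : gradedSpace K) (M : lmodType K).
Implicit Types (xs : seq (hom V)).

Lemma map_nth_take n xs : (n <= size xs)%N -> map (nth (hom0 V) xs) (iota 0 n) = take n xs.
Proof. by move=> nx; rewrite map_nth_iota0. Qed.

Lemma sum_perms xs (F : seq (hom V) -> M) : [pchar K] =i pred0 ->
  ((size xs)`!%:R)^-1 *: \sum_(s : {perm 'I_(size xs)}) koszul s xs *: F (permw s xs) =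
  avg (@hp K V) xs F.
Proof.
move=> char0; set n := size xs.
have f0 : n`!%:R != 0 :> K by have /pcharf0P-> := char0; rewrite -lt0n fact_gt0.
rewrite -[RHS](scalerK f0); congr (_ *: _).
have -> : avg (@hp K V) xs F = avg (@hp K V) (map (nth (hom0 V) xs) (iota 0 n)) F.
  by rewrite map_nth_take // take_size.
rewrite (avg_map (p' := index_parity xs)) //.
have := @sum_permutations K (index_parity xs) M char0 (iota 0 n)
  (fun a => F (map (nth (hom0 V) xs) a)) (iota_ltn_sorted 0 n).
rewrite size_iota => <-.
pose G l := (-1) ^+ ksg (index_parity xs) l *: F (map (nth (hom0 V) xs) l).
rewrite -[RHS](@sum_perm_seq n _ xpredT G) ?permutations_uniq // => [|l].
  by apply: eq_bigr => s _; rewrite koszulE.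
by rewrite mem_permutations andbT.
Qed.

(** Over positions, the shuffles with blocks of sizes [k] and [n - k] are the words [a ++ b] with
    [(a, b)] listed by [unsh] and [size a = k]; [a] and [b] are recovered by cutting at [k]. *)
Lemma sum_shuffles n k xs (F : seq (hom V) -> seq (hom V) -> M) :
  (k <= n <= size xs)%N ->
  \sum_(s : {perm 'I_n} | shuffle s [:: k; n - k]%N)
     koszul s xs *: F (take k (permw s xs)) (drop k (permw s xs)) =
  U (@hp K V) (take n xs) (fun a b => if size a == k then F a b else 0).
Proof.
case/andP=> kn nx.
rewrite -map_nth_take // (U_map (p' := index_parity xs)) //.
pose G l := let v := map (nth (hom0 V) xs) l in F (take k v) (drop k v).
pose P l := sorted ltn (take k l) && sorted ltn (drop k l).
have so := iota_ltn_sorted 0 n; have un := iota_uniq 0 n.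
set r := [seq q.2.1 ++ q.2.2 | q <- unsh K (index_parity xs) (iota 0 n) & size q.2.1 == k].
transitivity (\sum_(s : {perm 'I_n} | P (perm_seq s))
    (-1) ^+ ksg (index_parity xs) (perm_seq s) *: G (perm_seq s)).
  apply: eq_big => s; last by rewrite koszulE.
  rewrite /shuffle /= andbT /P; congr (_ && sorted _ _).
  by rewrite take_oversize // size_drop size_perm_seq.
rewrite (@sum_perm_seq n _ P (fun l => (-1) ^+ ksg (index_parity xs) l *: G l) r).
- rewrite unsh_sum ?size_iota //; apply: eq_U => a b; rewrite size_map.
  case: eqP => // ak; rewrite /G map_cat take_cat drop_cat !size_map ak ltnn subnn.
  by rewrite take0 drop0 cats0.
- have -> : r = [seq q.1 ++ q.2 | q <- map snd (unsh K (index_parity xs) (iota 0 n)) & size q.1 == k].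
    by rewrite filter_map -map_comp.
  rewrite map_inj_in_uniq ?filter_uniq ?unsh_uniq // => -[a b] [c d].
  rewrite !mem_filter /= => /andP[/eqP ak _] /andP[/eqP ck _] /eqP.
  by rewrite eqseq_cat ?ak ?ck // => /andP[/eqP-> /eqP->].
move=> l; apply/mapP/andP => [[q] | [ln /andP[sa sb]]].
  rewrite mem_filter => /andP[/eqP qk ql ->]; have [sa sb _] := unsh_sorted so ql.
  by rewrite (unsh_perm ql) /P take_cat drop_cat qk ltnn subnn take0 drop0 cats0 sa sb.
have := @unsh_complete K (index_parity xs) _ _ _ so sa sb.
rewrite cat_take_drop => /(_ ln) /mapP[q ql qe]; exists q; last by rewrite -qe cat_take_drop.
by rewrite mem_filter ql -qe size_takel ?eqxx // (perm_size ln) size_iota.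
Qed.

Lemma sum_U_size n w (F : seq (hom V) -> seq (hom V) -> M) : (size w <= n)%N ->
  \sum_(0 <= k < n.+1) U (@hp K V) w (fun a b => if size a == k then F a b else 0) =
  U (@hp K V) w F.
Proof.
move=> wn; rewrite exchange_big /=; apply: eq_big_seq => q /unsh_perm/perm_size.
rewrite size_cat => qn.
rewrite -scaler_sumr -big_mkcond /= (eq_bigl (pred1 (size q.2.1))) => [|k].
  by rewrite big_nat1_eq ltnS (leq_trans _ wn) // -qn leq_addr.
by rewrite eq_sym.
Qed.

End KoszulSums.

(** * E-shuffles as block splittings *)

Section BlockSums.
Variables (K : fieldType) (p : nat -> bool).
Implicit Types (l a b : seq nat) (bs : seq (seq nat)).

Lemma sorted_ltn_rcons l y : sorted ltn (rcons l y) = sorted ltn l && all (gtn y) l.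
Proof. by rewrite !(sorted_pairwise ltn_trans) pairwise_rcons andbC. Qed.

(** The list-of-blocks form of an E-shuffle. As empty blocks are excluded, the default value in
    [last 0] is never reached. *)
Definition is_ebl l bs : bool :=
  [&& perm_eq (flatten bs) l, all (sorted ltn) bs, [::] \notin bs &
      sorted ltn (map (last 0) bs)].

Lemma flatten_rcons (T : Type) (ss : seq (seq T)) s : flatten (rcons ss s) = flatten ss ++ s.
Proof. by rewrite -cats1 flatten_cat /= cats0. Qed.

Lemma last_in bs b : [::] \notin bs -> b \in bs -> last 0 b \in flatten bs.
Proof.
move=> n0 bb; apply/flattenP; exists b => //; case: b bb => [/(negP n0)//|x b _].
exact: mem_last.
Qed.

Lemma ebl_spec n l q : sorted ltn l -> q \in ebl K p n l ->
  is_ebl l q.2 /\ q.1 = (-1) ^+ ksg p (flatten q.2).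
Proof.
elim: n l q => [|n IH] l q; first by case: l => //= _; rewrite inE => /eqP->.
case/lastP: l => [_|l y]; first by rewrite inE => /eqP->.
rewrite sorted_ltn_rcons ebl_rcons => /andP[sl ly].
move=> /flatten_mapP[u ul /mapP[r' r'u ->]]; case/mapP: r'u => r ru -> /=.
have [sa sb ->] := unsh_sorted sl ul; have ab := unsh_perm ul.
have [/and4P[ra rs r0 rl] ->] := IH _ _ sa ru.
have /andP[ay yb] : all (gtn y) u.2.1 && all (gtn y) u.2.2.
  by rewrite -all_cat (perm_all _ ab).
split.
  apply/and4P; split.
  - rewrite flatten_rcons -cats1 catA cats1 -[rcons l y]cats1 -cats1 perm_cat2r.
    by apply: perm_trans ab; rewrite perm_cat2r.
  - by rewrite all_rcons rs sorted_ltn_rcons sb yb.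
  - by rewrite mem_rcons inE negb_or r0 andbT; case: (u.2.2).
  rewrite map_rcons last_rcons sorted_ltn_rcons rl; apply/allP => _ /mapP[b bb ->] /=.
  by apply: (allP ay); rewrite -(perm_mem ra) last_in.
(* The largest letter [y] ends the last block and adds no inversion. Inversions between the earlier
   blocks and the last one depend only on which letters lie in the earlier blocks, not on their
   order there. *)
rewrite -signr_addb; congr (_ ^+ nat_of_bool _).
have sby : sorted ltn (rcons u.2.2 y) by rewrite sorted_ltn_rcons sb yb.
rewrite flatten_rcons !ksg_cat !(ksg_sorted _ sby) !(ksg_sorted _ sa) !(ksg_sorted _ sb).
rewrite !addbF addFb addbC; congr (_ (+) _); rewrite [RHS](perm_big _ ra) /=.
apply: eq_big_seq => i ia; rewrite /inv1 -cats1 big_cat /= [X in _ (+) X]big_cons big_nil.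
by rewrite ltnNge ltnW ?addbF //; apply: (allP ay).
Qed.

(** The last block can be read off the splitting, and the word of the remaining letters is recovered
    because it is increasing. *)
Lemma ebl_uniq n l : sorted ltn l -> uniq (map snd (ebl K p n l)).
Proof.
elim: n l => [|n IH] l; first by case: l.
case/lastP: l => [//|l y]; rewrite sorted_ltn_rcons ebl_rcons => /andP[sl ly].
have -> : map snd (bind (unsh K p l) (fun q =>
      [seq (r.1, rcons r.2 (rcons q.2 y)) | r <- ebl K p n q.1])) =
    [seq rcons bs (rcons q.2 y) | q <- map snd (unsh K p l), bs <- map snd (ebl K p n q.1)].
  rewrite /bind map_flatten -map_comp; congr flatten; rewrite -[RHS]map_comp.
  by apply: eq_map => q /=; rewrite -!map_comp.
have mem_u q : q \in map snd (unsh K p l) -> sorted ltn q.1.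
  by case/mapP => u ul ->; have [] := unsh_sorted sl ul.
apply: allpairs_uniq_dep; rewrite ?unsh_uniq ?(sorted_uniq ltn_trans ltnn) //.
  by move=> q /mem_u/IH.
move=> _ _ /allpairsPdep[[a b] [bs [qa qb ->]]] /allpairsPdep[[a' b'] [bs' [qa' qb' ->]]] /=.
move=> /rcons_inj[ebs /rcons_inj[eb]]; rewrite -eb -{}ebs in qa' qb' *.
have sa := mem_u _ qa; have sa' := mem_u _ qa'.
have spec c : sorted ltn c -> bs \in map snd (ebl K p n c) -> perm_eq (flatten bs) c.
  by move=> sc /mapP[r rc ->]; have [/andP[]] := ebl_spec sc rc.
have aa' : perm_eq a a'.
  by rewrite -(permPl (spec _ sa qb)) (spec _ sa' qb').
suff -> : a = a' by [].
apply: (irr_sorted_eq ltn_trans ltnn) => //; exact: perm_mem.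
Qed.

Lemma last_max b y : sorted ltn b -> y \in b -> (y <= last 0 b)%N.
Proof.
case/lastP: b => // b z; rewrite sorted_ltn_rcons last_rcons mem_rcons inE.
by case/andP => _ /allP bz /orP[/eqP-> //|/bz/ltnW].
Qed.

Lemma ebl_complete n l bs : sorted ltn l -> (size l <= n)%N -> is_ebl l bs ->
  bs \in map snd (ebl K p n l).
Proof.
have nil c : is_ebl [::] c -> c = [::].
  by case: c => [|[|x d] c] // /and4P[/perm_size].
elim: n l bs => [|n IH] l bs; case/lastP: l => [|l y]; rewrite ?size_rcons // => sl ln;
  try by move/nil ->; rewrite inE.
case/lastP: bs => [|r c] /and4P[fl].
  by move/perm_size: fl; rewrite size_rcons.
rewrite all_rcons => /andP[sc rs]; rewrite mem_rcons inE negb_or => /andP[c0 r0].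
rewrite map_rcons sorted_ltn_rcons => /andP[sr rc].
move: sl; rewrite sorted_ltn_rcons => /andP[sl ly].
case/lastP: c sc c0 fl rc => // b z; rewrite last_rcons flatten_rcons => sc _ fl rc.
have zin : z \in rcons l y by rewrite -(perm_mem fl) mem_cat mem_rcons mem_head orbT.
(* The largest letter ends the last block: every letter is at most the last letter of its own block,
   and these last letters increase up to [z]. *)
have yz : y = z.
  apply/eqP; rewrite eqn_leq; apply/andP; split; last first.
    by move: zin; rewrite mem_rcons inE => /orP[/eqP->//|/(allP ly)/ltnW].
  have : y \in flatten r ++ rcons b z by rewrite (perm_mem fl) mem_rcons mem_head.
  rewrite mem_cat => /orP[/flattenP[d dr yd]|/(last_max sc)]; last by rewrite last_rcons.
  apply: (leq_trans (last_max (allP rs _ dr) yd)).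
  by apply/ltnW/(allP rc)/map_f.
move: fl; rewrite -{}yz in sc rc * => fl.
rewrite -!cats1 catA perm_cat2r in fl.
have ul := sorted_uniq ltn_trans ltnn sl.
(* The left half of the unshuffle that splits off the last block. *)
pose a := sort leq (flatten r).
have ar : perm_eq a (flatten r) by rewrite perm_sort.
have sa : sorted ltn a.
  rewrite ltn_sorted_uniq_leq sort_sorted ?andbT; last exact: leq_total.
  by rewrite (perm_uniq ar); move: ul; rewrite -(perm_uniq fl) cat_uniq => /andP[].
move: sc; rewrite sorted_ltn_rcons => /andP[sb _].
have abl : perm_eq (a ++ b) l by rewrite (permPl (perm_cat ar (perm_refl b))).
have /mapP[u uin ue] := @unsh_complete K p _ _ _ sl sa sb abl.
have /mapP[w win we] : r \in map snd (ebl K p n a).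
  apply: IH => //.
    by rewrite -ltnS; apply: leq_trans ln; rewrite ltnS -(perm_size abl) size_cat leq_addr.
  by apply/and4P; split => //; rewrite perm_sym.
rewrite ebl_rcons; apply/mapP; exists (u.1 * w.1, rcons w.2 (rcons u.2.2 y)); last first.
  by rewrite /= -we -ue.
apply/flatten_mapP; exists u => //; apply/mapP.
exists (w.1, rcons w.2 (rcons u.2.2 y)) => //; apply/mapP; exists w => //.
by rewrite -ue.
Qed.

End BlockSums.

Section EshuffleSums.
Variables (K : fieldType) (V : gradedSpace K) (M : lmodType K).
Implicit Types (xs : seq (hom V)).

(** For fixed block sizes, [reshape] and [flatten] match E-shuffles with splittings of that shape;
    summing over all sizes meets each splitting once, at its own shape. For the empty word the left
    side would be an empty sum, while [ebl] has one term. *)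
Lemma sum_Eshuffles xs (F : seq (seq (hom V)) -> M) : xs != [::] ->
  \sum_(1 <= p < (size xs).+1)
    \sum_(k : p.-tuple 'I_(size xs).+1 |
            all (ltn 0) (map val k) && (sumn (map val k) == size xs))
      \sum_(s : {perm 'I_(size xs)} | Eshuffle s (map val k))
        koszul s xs *: F (reshape (map val k) (permw s xs)) =
  ev (ebl K (@hp K V) (size xs) xs) F.
Proof.
set n := size xs => xs0.
set q := index_parity xs.
pose X := nth (hom0 V) xs.
pose E := ebl K q n (iota 0 n).
have so := iota_ltn_sorted 0 n.
have inner (ks : seq nat) : all (ltn 0) ks -> sumn ks = n ->
  \sum_(s : {perm 'I_n} | Eshuffle s ks) koszul s xs *: F (reshape ks (permw s xs)) =
  \sum_(r <- E | shape r.2 == ks) r.1 *: F (map (map X) r.2).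
  move=> ks0 ksn.
  pose P l := all (sorted ltn) (reshape ks l) && sorted ltn (map (last 0) (reshape ks l)).
  pose G l := (-1) ^+ ksg q l *: F (reshape ks (map X l)).
  have rK bs : shape bs == ks -> reshape ks (flatten bs) = bs by move=> /eqP <-; apply: flattenK.
  transitivity (\sum_(s : {perm 'I_n} | P (perm_seq s)) G (perm_seq s)).
    by apply: eq_bigr => s _; rewrite koszulE.
  rewrite (@sum_perm_seq n _ P G [seq flatten r.2 | r <- E & shape r.2 == ks]).
  - rewrite big_map big_filter [LHS]big_seq_cond [RHS]big_seq_cond.
    apply: eq_bigr => r /andP[rE shr]; have [_ ->] := ebl_spec so rE.
    by rewrite /G -map_reshape rK.
  - have -> : [seq flatten r.2 | r <- E & shape r.2 == ks] =
      [seq flatten bs | bs <- map snd E & shape bs == ks] by rewrite filter_map -map_comp.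
    rewrite map_inj_in_uniq ?filter_uniq ?ebl_uniq // => b c.
    by rewrite !mem_filter => /andP[/rK eb _] /andP[/rK ec _] bc; rewrite -eb -ec bc.
  move=> l; apply/mapP/andP => [[r] | [ln /andP[sa sb]]].
    rewrite mem_filter => /andP[shr rE ->]; have [/and4P[fl sr _ lr] _] := ebl_spec so rE.
    by rewrite /P rK // sr lr.
  have fl : flatten (reshape ks l) = l by rewrite reshapeKr // ksn (perm_size ln) size_iota.
  have sh : shape (reshape ks l) = ks by rewrite reshapeKl // ksn (perm_size ln) size_iota.
  have /mapP[r rE re] : reshape ks l \in map snd E.
    apply: ebl_complete; rewrite ?size_iota //.
    apply/and4P; split; rewrite ?fl //.
    apply/negP => r0; have : size ([::] : seq nat) \in ks by rewrite -sh map_f.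
    by move/(allP ks0).
  by exists r; rewrite ?mem_filter -?re ?sh ?eqxx.
have -> : ev (ebl K (@hp K V) n xs) F = \sum_(r <- E) r.1 *: F (map (map X) r.2).
  have {1}-> : xs = map X (iota 0 n) by rewrite map_nth_take // take_size.
  by rewrite (ev_ebl_map (p' := q)).
pose G (r : K * seq (seq nat)) := r.1 *: F (map (map X) r.2).
transitivity (\sum_(1 <= p < n.+1) \sum_(k : p.-tuple 'I_n.+1) \sum_(r <- E)
    if shape r.2 == map val k then G r else 0).
  apply: eq_bigr => p _; rewrite big_mkcond /=; apply: eq_bigr => k _.
  case: ifP => [/andP[k0 /eqP kn]|kn].
    by rewrite (inner _ k0 kn) [LHS]big_mkcond.
  rewrite big_seq big1 // => r rE; case: eqP => // sh; move: kn.
  have [/and4P[fl _ r0 _] _] := ebl_spec so rE.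
  rewrite -sh -size_flatten (perm_size fl) size_iota eqxx andbT => /negP[].
  by apply/allP => _ /mapP[b br ->]; case: b br => //; rewrite (negPf r0).
under eq_bigr => p _ do rewrite exchange_big.
rewrite exchange_big /=; apply: eq_big_seq => r rE.
have [/and4P[fl _ r0 _] _] := ebl_spec so rE.
have sn : sumn (shape r.2) = n by rewrite -size_flatten (perm_size fl) size_iota.
have sh_le m : m \in shape r.2 -> (m <= n)%N.
  by rewrite -sn => mr; rewrite (perm_sumn (perm_to_rem mr)) /= leq_addr.
have sz_le : (0 < size r.2 <= n)%N.
  apply/andP; split.
    by case: (r.2) fl => // /perm_size; rewrite /= size_iota /n; case: (xs) xs0.
  rewrite -sn; elim: (r.2) r0 => //= b s IH; rewrite inE negb_or => /andP[b0 /IH].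
  by case: b b0 => // x b _ h; rewrite addSn ltnS (leq_trans h) // leq_addl.
transitivity (\sum_(1 <= p < n.+1 | p == size r.2) G r); last first.
  by rewrite big_nat1_eq ltnS sz_le.
rewrite [RHS]big_mkcond; apply: eq_bigr => p _; case: eqP => [->|pr]; last first.
  rewrite big1 // => k _; case: eqP => // shk; case: pr.
  by rewrite -(size_map size r.2) -/(shape _) shk size_map size_tuple.
(* Block sizes are at most [n], so the shape of the splitting is one of the tuples summed over. *)
have szk : size (map (@inord n) (shape r.2)) == size r.2 by rewrite !size_map.
have kK : map val (Tuple szk) = shape r.2.
  rewrite /= -map_comp -[RHS]map_id; apply/eq_in_map => m /sh_le mn.
  by rewrite /= inordK.
rewrite -big_mkcond (big_pred1 (Tuple szk)) // => k.
apply/eqP/eqP => [shk|->//]; apply: val_inj; apply: (inj_map val_inj).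
by rewrite kK shk.
Qed.

End EshuffleSums.

(** * The coderivation d and the homomorphism F on words *)

Section Degrees.
Variables (K : fieldType) (V : gradedSpace K).
Implicit Types (x y z : hom V) (w s t : seq (hom V)).

Lemma odd_abszD (m n : int) : odd `|(m + n)%R|%N = odd `|m|%N (+) odd `|n|%N.
Proof.
apply: (@Num.Theory.signr_inj int); rewrite signr_addb.
have e k : (-1) ^+ odd `|k|%N = (-1) ^ k :> int.
  by case: k => k; rewrite signr_odd /exprz; [|rewrite -exprVn invrN1].
by rewrite !e exprzDr ?unitrN1.
Qed.

Lemma degs_cat s t : degs (s ++ t) = degs s + degs t.
Proof. exact: big_cat. Qed.
Lemma degs_cons x w : degs (x :: w) = hdeg x + degs w.
Proof. exact: big_cons. Qed.
Lemma degs_rcons w x : degs (rcons w x) = degs w + hdeg x.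
Proof. by rewrite -cats1 degs_cat degs_cons /degs big_nil addr0. Qed.
Lemma degs_nil : degs ([::] : seq (hom V)) = 0. Proof. exact: big_nil. Qed.
Lemma degs_perm s t : perm_eq s t -> degs s = degs t.
Proof. exact: perm_big. Qed.

Lemma pw_degs w : pw (@hp K V) w = odd `|degs w|%N.
Proof.
elim: w => [|x w IH]; first by rewrite pw_nil degs_nil.
by rewrite pw_cons degs_cons odd_abszD IH.
Qed.

Lemma sign_degs w : (-1) ^ degs w = (-1) ^+ pw (@hp K V) w :> K.
Proof. by rewrite exprz_sign pw_degs. Qed.

Lemma hom_inj x y : hdeg x = hdeg y -> hval x = hval y -> x = y.
Proof.
case: x y => [[i v] iv] [[j u] ju]; rewrite /hdeg /hval /= => e1 e2.
by apply: val_inj; rewrite /= e1 e2.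
Qed.

Lemma homog_gpr i (v : V) : homog i (gpr i v).
Proof. by rewrite /homog gprE eqxx. Qed.

Definition hpr i (v : V) : hom V := mkhom (homog_gpr i v).

Lemma hprK z : hpr (hdeg z) (hval z) = z.
Proof. by apply: hom_inj => //; apply: (eqP (valP z)). Qed.

End Degrees.

Section Multilinear.
Variables (K : fieldType) (V : gradedSpace K) (M : lmodType K).

(** Multilinearity of functions of words: they factor through [Tge]. *)
Definition mlin (phi : seq (hom V) -> M) : Prop :=
  forall s t a (x y z : hom V),
    hdeg x = hdeg z -> hdeg y = hdeg z -> hval z = a *: hval x + hval y ->
    phi (s ++ z :: t) = a *: phi (s ++ x :: t) + phi (s ++ y :: t).

(** Words only accept homogeneous letters; precomposing with the projection to degree [n] turns one
    slot into a linear map on all of V, through which formal sums can be moved. *)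
Lemma mlin_slot phi s t n : mlin phi ->
  exists2 L : V -> M, linear L &
    forall z, hdeg z = n -> phi (s ++ z :: t) = L (hval z).
Proof.
move=> ml; exists (fun v => phi (s ++ hpr n v :: t)) => [a u v|z <-].
  by apply: ml => //; apply: gpr_linear.
by rewrite hprK.
Qed.

Lemma mlin_last phi y : mlin phi -> mlin (fun w => phi (rcons w y)).
Proof. by move=> ml s t a x y' z *; rewrite !rcons_cat /=; apply: ml. Qed.

End Multilinear.

Section Theta.
Variables (K : fieldType) (V : gradedSpace K) (theta : gmulti 1 V V).
Implicit Types (x y z : hom V) (w s t a b : seq (hom V)).
Local Notation U := (U (@hp K V)).
Local Notation pw := (pw (@hp K V)).

Lemma hdeg_gapp r (W : gradedSpace K) (f : gmulti r V W) w : hdeg (gapp f w) = degs w + r.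
Proof. by []. Qed.

Lemma hp_theta w : hp (gapp theta w) = ~~ pw w.
Proof. by rewrite /hp hdeg_gapp odd_abszD pw_degs addbT. Qed.

(** The formal value of d on the word [w]. *)
Definition dl w : seq (K * seq (hom V)) :=
  flatten (mkseq (fun j => [seq ((-1) ^+ pw q.2.1 * q.1,
      q.2.1 ++ gapp theta (rcons q.2.2 (nth (hom0 V) w j)) :: drop j.+1 w)
    | q <- unsh K (@hp K V) (take j w)]) (size w)).

Definition D (M : lmodType K) w (phi : seq (hom V) -> M) : M := ev (dl w) phi.

Section Module.
Variable M : lmodType K.
Implicit Types (phi : seq (hom V) -> M) (psi : seq (hom V) -> seq (hom V) -> M).

Lemma DE w phi : D w phi = \sum_(0 <= j < size w) U (take j w) (fun a b =>
  (-1) ^+ pw a *: phi (a ++ gapp theta (rcons b (nth (hom0 V) w j)) :: drop j.+1 w)).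
Proof.
rewrite /D /ev /dl big_flatten /mkseq big_map /index_iota subn0; apply: eq_bigr => j _.
by rewrite big_map; apply: eq_bigr => q _; rewrite scalerA mulrC.
Qed.

Lemma eq_D w phi phi' : phi =1 phi' -> D w phi = D w phi'.
Proof. exact: eq_ev. Qed.

Lemma D_add w phi phi' : D w (fun v => phi v + phi' v) = D w phi + D w phi'.
Proof. exact: evD. Qed.

Lemma D_scale w c phi : D w (fun v => c *: phi v) = c *: D w phi.
Proof. exact: evZ. Qed.

Lemma D_nil phi : D [::] phi = 0.
Proof. by rewrite DE big_nil. Qed.

Lemma D_rcons w y phi : D (rcons w y) phi =
  D w (fun u => phi (rcons u y)) +
  U w (fun a b => (-1) ^+ pw a *: phi (rcons a (gapp theta (rcons b y)))).
Proof.
rewrite !DE size_rcons big_nat_recr //=; congr (_ + _).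
  apply: eq_big_nat => j /andP[_ jw].
  rewrite -cats1 takel_cat ?(ltnW jw) //; apply: eq_U => a b.
  rewrite nth_cat jw drop_cat; case: ltnP => jw'.
    by rewrite rcons_cat /= cats1.
  have -> : j.+1 = size w by apply/eqP; rewrite eqn_leq jw jw'.
  by rewrite subnn drop_size rcons_cat.
rewrite -cats1 take_size_cat //; apply: eq_U => a b.
by rewrite nth_cat ltnn subnn drop_oversize ?size_cat ?addn1 ?cats1.
Qed.

Lemma D_degs w q : q \in dl w -> degs q.2 = degs w + 1.
Proof.
move=> /flatten_mapP[j]; rewrite mem_iota add0n => /andP[_ jw] /mapP[r rj ->] /=.
rewrite degs_cat degs_cons hdeg_gapp degs_rcons.
have -> : degs w = degs (take j w) + (hdeg (nth (hom0 V) w j) + degs (drop j.+1 w)).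
  by rewrite -degs_cons -drop_nth // -degs_cat cat_take_drop.
rewrite -(degs_perm (unsh_perm rj)) degs_cat.
by rewrite -!addrA; do 3!congr (_ + _); rewrite addrC.
Qed.

Lemma eq_D_in w phi phi' :
  (forall v, degs v = degs w + 1 -> phi v = phi' v) -> D w phi = D w phi'.
Proof. by move=> e; apply: eq_ev_in => q /D_degs/e. Qed.

Lemma pw_degs1 w v : degs v = degs w + 1 -> pw v = ~~ pw w.
Proof. by move=> e; rewrite !pw_degs e odd_abszD addbT. Qed.

Lemma D_U w psi : D w (fun u => U u psi) =
  U w (fun a b => D a (psi^~ b) + (-1) ^+ pw a *: D b (psi a)).
Proof.
elim/last_ind: w psi => [|w y IH] psi.
  by rewrite D_nil U_nil !D_nil scaler0 addr0.
pose z c := gapp theta (rcons c y).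
have hz c : hp (z c) = ~~ (pw c (+) hp y) by rewrite hp_theta pw_rcons.
(* In [T1] to [T4] theta does not absorb [y]: it acts in the left factor in [T1] and [T2], in the
   right one in [T3] and [T4], while [y] lies left in [T1] and [T3], right in [T2] and [T4]. In [X1]
   and [X2] theta absorbs [y] and lies left, respectively right. *)
pose T1 a b := D a (fun a' => (-1) ^+ (hp y && pw b) *: psi (rcons a' y) b).
pose T2 a b := D a (fun a' => psi a' (rcons b y)).
pose T3 a b := (-1) ^+ pw a *: D b (fun b' => (-1) ^+ (hp y && pw b') *: psi (rcons a y) b').
pose T4 a b := (-1) ^+ pw a *: D b (fun b' => psi a (rcons b' y)).
pose X1 := U w (fun a c => U a (fun a1 a2 => (-1) ^+ pw (a1 ++ a2) *:
  ((-1) ^+ (hp (z c) && pw a2) *: psi (rcons a1 (z c)) a2))).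
pose X2 := U w (fun a c => U a (fun a1 a2 =>
  (-1) ^+ pw (a1 ++ a2) *: psi a1 (rcons a2 (z c)))).
have -> : D (rcons w y) (fun u => U u psi) =
    ((U w T1 + U w T2) + (U w T3 + U w T4)) + (X1 + X2).
  rewrite D_rcons; congr (_ + _).
    rewrite (eq_D _ (fun u => U_rcons _ u y psi)) D_add !IH -!UD; apply: eq_U => a b.
    by rewrite addrACA.
  rewrite -UD; apply: eq_U => a c; rewrite U_rcons scalerDr -!UZ; congr (_ + _).
    by apply: eq_U_in => a1 a2 /(pw_perm (@hp K V)) ->.
  by apply: eq_U_in => a1 a2 /(pw_perm (@hp K V)) ->.
rewrite [RHS]U_rcons.
have -> : U w (fun a b => (-1) ^+ (hp y && pw b) *:
      (D (rcons a y) (psi^~ b) + (-1) ^+ pw (rcons a y) *: D b (psi (rcons a y)))) =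
    U w T1 + X1 + U w T3.
  (* Coassociativity and cocommutativity put the letters absorbed by theta next to the left factor
     in which its value lies. *)
  have -> : X1 = U w (fun a b => U a (fun a1 a2 =>
     (-1) ^+ (hp y && pw b) *: ((-1) ^+ pw a1 *: psi (rcons a1 (z a2)) b))).
    rewrite /X1 !U_A; apply: eq_U => a1 d; rewrite [RHS]U_C; apply: eq_U => a2 c.
    by rewrite hz; signs.
  rewrite -!UD; apply: eq_U => a b; rewrite D_rcons !scalerDr; congr (_ + _ + _).
  - by rewrite /T1 D_scale.
  - by rewrite -UZ.
  rewrite /T3 -!D_scale; apply: eq_D_in => v /pw_degs1 vb; rewrite vb; signs.
have -> : U w (fun a b => D a (psi^~ (rcons b y)) + (-1) ^+ pw a *: D (rcons b y) (psi a)) =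
    U w T2 + (U w T4 + X2).
  rewrite /X2 U_A -!UD; apply: eq_U => a b; congr (_ + _).
  rewrite D_rcons scalerDr; congr (_ + _); rewrite -UZ.
  by apply: eq_U => b1 b2; signs.
by rewrite [LHS](AC (2*2*2) ((1*5*3)*(2*(4*6)))).
Qed.

Hypothesis D_theta : forall w, D w (fun v => theta (hvals v)) = 0.

Lemma D_D w phi : mlin phi -> D w (fun v => D v phi) = 0.
Proof.
elim/last_ind: w phi => [|w y IH] phi ml; first by rewrite D_nil.
pose z c := gapp theta (rcons c y).
have hz c : hp (z c) = ~~ (pw c (+) hp y) by rewrite hp_theta pw_rcons.
rewrite D_rcons (eq_D _ (fun u => D_rcons u y phi)) D_add IH ?add0r; last exact: mlin_last.
rewrite D_U -UD.
transitivity (U w (fun a b => D b (fun b' => phi (rcons a (z b')))) +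
  U w (fun a c => U a (fun a1 a2 => (-1) ^+ pw a2 *: phi (rcons a1 (gapp theta (rcons a2 (z c))))))).
  rewrite -UD; apply: eq_U => a b.
  (* d changes the parity of the left part, so the terms with d on [a] cancel against those from
     [D (rcons a (z b))]. What remains has both operations in the last letter. *)
  rewrite [D a _](eq_D_in (phi' := fun a' => - (-1) ^+ pw a *: phi (rcons a' (z b)))); last first.
    by move=> v /pw_degs1 ->; rewrite signrN.
  rewrite D_scale D_rcons scalerDr scaleNr addrACA addNr add0r; congr (_ + _).
    by rewrite -D_scale; apply: eq_D => v; rewrite scalerA -signr_addb addbb scale1r.
  rewrite -UZ; apply: eq_U_in => a1 a2 /(pw_perm (@hp K V)) <-; signs.
rewrite U_A -UD -[RHS](U0 (@hp K V) _ w); apply: eq_U => a c.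
(* The two sums are the two parts of d(c y), placed under an outer theta. *)
transitivity (D (rcons c y) (fun v => phi (rcons a (gapp theta v)))).
  by rewrite D_rcons.
(* Two operations of degree 1 act on [rcons c y], whence the degree of the slot. *)
have [L linL e] := mlin_slot a [::] (degs (rcons c y) + 1 + 1) ml.
rewrite (eq_D_in (phi' := fun v => L (theta (hvals v)))) => [|v vw].
  by rewrite /D -(ev_lin _ _ linL) [ev _ _]D_theta lin0.
by rewrite -cats1 e // hdeg_gapp vw.
Qed.

End Module.
End Theta.

Section MultilinearTheory.
Variables (K : fieldType) (V : gradedSpace K) (M : lmodType K).
Implicit Types (x y z : hom V) (w s t a b : seq (hom V)).
Local Notation U := (U (@hp K V)).
Local Notation pw := (pw (@hp K V)).

Lemma hp_hdeg x y : hdeg x = hdeg y -> hp x = hp y.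
Proof. by rewrite /hp => ->. Qed.

Lemma pw_slot s t x z : hdeg x = hdeg z -> pw (s ++ x :: t) = pw (s ++ z :: t).
Proof. by move=> /hp_hdeg xz; rewrite !pw_cat !pw_cons xz. Qed.

Lemma mlin_sign (c : bool -> K) (phi : seq (hom V) -> M) :
  mlin phi -> mlin (fun w => c (pw w) *: phi w).
Proof.
move=> ml s t a x y z xz yz e; rewrite (ml s t a x y z) // scalerDr.
by rewrite (pw_slot _ _ xz) (pw_slot _ _ yz) !scalerA mulrC.
Qed.

Lemma mlin_cons x (phi : seq (hom V) -> M) : mlin phi -> mlin (fun w => phi (x :: w)).
Proof. by move=> ml s; apply: (ml (x :: s)). Qed.

Lemma U_mlin (phi : seq (hom V) -> seq (hom V) -> M) :
  (forall b, mlin (phi^~ b)) -> (forall a, mlin (phi a)) -> mlin (fun w => U w phi).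
Proof.
move=> + + s t a x y z xz yz e; elim: s phi => [|u s IH] phi ml mr /=.
  rewrite !U_cons scalerDr addrACA; congr (_ + _); rewrite -UZ -UD; apply: eq_U => c d.
    by rewrite (ml d [::] c a x y z).
  rewrite (hp_hdeg xz) (hp_hdeg yz) (mr c [::] d a x y z) // scalerDr !scalerA.
  by rewrite [a * _]mulrC.
rewrite !U_cons scalerDr addrACA; congr (_ + _); apply: IH => [b|c].
- exact: mlin_cons (ml b).
- exact: mr.
- exact: (mlin_sign (fun p => (-1) ^+ (hp u && p)) (ml (u :: b))).
move=> s' t' a' x' y' z' *; rewrite (mr c (u :: s') t' a' x' y' z') //.
by rewrite scalerDr !scalerA [a' * _]mulrC.
Qed.

Lemma gmulti_slot r (W : gradedSpace K) (f : gmulti r V W) s t c x y z :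
  hdeg x = hdeg z -> hdeg y = hdeg z -> hval z = c *: hval x + hval y ->
  hval (gapp f (s ++ z :: t)) = c *: hval (gapp f (s ++ x :: t)) + hval (gapp f (s ++ y :: t)).
Proof.
by move=> _ _ e; rewrite /hval /gapp /= !map_cat /= -gm_linear -e.
Qed.

Lemma mlin_gapp r (W : gradedSpace K) (f : gmulti r V W) (s t : seq (hom W)) (phi : seq (hom W) -> M) :
  mlin phi -> mlin (fun w => phi (s ++ gapp f w :: t)).
Proof.
move=> ml s' t' c x y z xz yz e; apply: ml; rewrite ?hdeg_gapp.
- by rewrite !degs_cat !degs_cons xz.
- by rewrite !degs_cat !degs_cons yz.
exact: gmulti_slot.
Qed.

(** What lets d descend to the tensor coalgebra. The slot lies inside the theta block, where theta
    is multilinear, or outside it, where [phi] is. *)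
Lemma D_mlin (theta : gmulti 1 V V) (phi : seq (hom V) -> M) :
  mlin phi -> mlin (fun w => D theta w phi).
Proof.
move=> ml s t; elim/last_ind: t phi ml => [|t u IH] phi ml c x y z xz yz e.
  rewrite !cats1 !D_rcons scalerDr addrACA -D_scale -D_add -UZ -UD.
  congr (_ + _); first by apply: eq_D => v; rewrite -!cats1; apply: ml.
  apply: eq_U => a b; rewrite scalerA [c * _]mulrC -scalerA -scalerDr; congr (_ *: _).
  by have := mlin_gapp theta a [::] ml b [::] xz yz e; rewrite !cats1.
rewrite -!rcons_cons -!rcons_cat !D_rcons scalerDr addrACA; congr (_ + _).
  by apply: IH => //; apply: mlin_last.
apply: U_mlin => // [b|a].
  apply: (mlin_sign (fun p => (-1) ^+ p)); exact: mlin_last.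
move=> s' t' c' x' y' z' xz' yz' e'.
rewrite scalerA [c' * _]mulrC -scalerA -scalerDr; congr (_ *: _).
rewrite -!cats1 -!catA /= !cats1.
by have := mlin_gapp theta a [::] ml s' (rcons t' u) xz' yz' e'; rewrite !cats1.
Qed.

End MultilinearTheory.

(** * The coalgebra map F and its compatibility with d *)

Section Blocks.
Variables (K : fieldType) (V W : gradedSpace K) (f : gmulti 0 V W).
Implicit Types (x y z : hom V) (w s t a b : seq (hom V)).
Local Notation UV := (U (@hp K V)).
Local Notation UW := (U (@hp K W)).
Local Notation pv := (pw (@hp K V)).
Local Notation pww := (pw (@hp K W)).

Lemma hp_f w : hp (gapp f w) = pv w.
Proof. by rewrite /hp hdeg_gapp addr0 pw_degs. Qed.

(** [phi] applied to the formal value of F on the word [w]. *)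
Definition B (M : lmodType K) w (phi : seq (hom W) -> M) : M :=
  ev (ebl K (@hp K V) (size w) w) (fun bs => phi (map (gapp f) bs)).

Section Module.
Variable M : lmodType K.
Implicit Types (phi : seq (hom W) -> M) (psi : seq (hom W) -> seq (hom W) -> M).

Lemma B_nil phi : B [::] phi = phi [::].
Proof. exact: ev_ebl_nil. Qed.

Lemma B_rcons w y phi : B (rcons w y) phi =
  UV w (fun a b => B a (fun u => phi (rcons u (gapp f (rcons b y))))).
Proof.
rewrite /B size_rcons ev_ebl_rcons; apply: eq_U_in => a b /perm_size ab.
rewrite (@ebl_fuel _ _ _ _ _ (size a)) // => [|]; last by rewrite -ab size_cat leq_addr.
by apply: eq_ev => bs; rewrite map_rcons.
Qed.

Lemma eq_B w phi phi' : phi =1 phi' -> B w phi = B w phi'.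
Proof. by move=> e; apply: eq_ev => bs; rewrite e. Qed.

Lemma gapp_blocks_degs bs : degs (map (gapp f) bs) = degs (flatten bs).
Proof.
elim: bs => [|b bs IH]; first by rewrite !degs_nil.
by rewrite /= degs_cons degs_cat IH hdeg_gapp addr0.
Qed.

Lemma eq_B_in w phi phi' :
  (forall u, degs u = degs w -> phi u = phi' u) -> B w phi = B w phi'.
Proof.
by move=> e; apply: eq_ev_in => q /ebl_perm/degs_perm qw; rewrite e // gapp_blocks_degs.
Qed.

Lemma B_D w phi phi' : B w (fun v => phi v + phi' v) = B w phi + B w phi'.
Proof. exact: evD. Qed.

Lemma B_scale w c phi : B w (fun v => c *: phi v) = c *: B w phi.
Proof. exact: evZ. Qed.

Lemma pw_degs0 w u : degs u = degs w -> pww u = pv w.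
Proof. by move=> e; rewrite !pw_degs e. Qed.

Lemma BU_C (X : eqType) (p : X -> bool) v w (phi : seq (hom W) -> seq X -> seq X -> M) :
  B w (fun u => U p v (phi u)) = U p v (fun c d => B w (fun u => phi u c d)).
Proof. exact: ev_ev. Qed.

(** The induction is on length, because removing the last letter removes its whole block. The value
    of f on that block goes to the left or the right factor, and coassociativity carries the letters
    of the block along. *)
Lemma B_U w psi : B w (fun u => UW u psi) =
  UV w (fun a b => B a (fun u => B b (psi u))).
Proof.
elim: {w}(size w) {-2}w (leqnn (size w)) psi => [|n IH] w.
  by rewrite leqn0 => /nilP-> psi; rewrite B_nil !U_nil !B_nil.
case/lastP: w => [_ psi|w y]; first by rewrite B_nil !U_nil !B_nil.
rewrite size_rcons ltnS => wn psi; pose z c := gapp f (rcons c y).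
have hz c : hp (z c) = pv c (+) hp y by rewrite hp_f pw_rcons.
transitivity (UV w (fun a c => UV a (fun a1 a2 => (-1) ^+ (hp (z c) && pv a2) *:
      B a1 (fun u => B a2 (psi (rcons u (z c)))))) +
   UV w (fun a c => UV a (fun a1 a2 => B a1 (fun u => B a2 (fun v => psi u (rcons v (z c))))))).
  rewrite B_rcons -UD; apply: eq_U_in => a c /perm_size ac.
  rewrite (eq_B _ (fun u => U_rcons _ u _ psi)) B_D.
  have an : (size a <= n)%N by apply: leq_trans wn; rewrite -ac size_cat leq_addr.
  rewrite !IH //; congr (_ + _); apply: eq_U => a1 a2; rewrite -B_scale.
  by apply: eq_B => u; rewrite -B_scale; apply: eq_B_in => v /pw_degs0 ->.
rewrite U_rcons !U_A; congr (_ + _); last first.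
  apply: eq_U => a b; rewrite -BU_C; apply: eq_B => u; by rewrite B_rcons.
transitivity (UV w (fun a b => UV a (fun a1 a2 => (-1) ^+ (hp y && pv b) *:
    B a1 (fun u => B b (psi (rcons u (z a2))))))); last first.
  by apply: eq_U => a b; rewrite B_rcons -UZ.
rewrite U_A; apply: eq_U => a d; rewrite [RHS]U_C; apply: eq_U => a2 c.
by rewrite hz; signs.
Qed.

End Module.
End Blocks.

Section Morphism.
Variables (K : fieldType) (V W : gradedSpace K) (f : gmulti 0 V W).
Variables (theta : gmulti 1 V V) (theta' : gmulti 1 W W) (M : lmodType K).
Implicit Types (x y z : hom V) (w s t a b : seq (hom V)) (phi : seq (hom W) -> M).
Local Notation UV := (U (@hp K V)).
Local Notation UW := (U (@hp K W)).
Local Notation pv := (pw (@hp K V)).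
Local Notation pww := (pw (@hp K W)).

Lemma B_mlin phi : mlin phi -> mlin (fun w => B f w phi).
Proof.
have Bn n : forall phi, mlin phi -> mlin (fun w =>
    ev (ebl K (@hp K V) n w) (fun bs => phi (map (gapp f) bs))).
  elim: n => [|n IH] {}phi ml s t c x y z xz yz e.
    by case: s => *; rewrite /ev !big_nil scaler0 addr0.
  case/lastP: t => [|t u].
    rewrite !cats1 !ev_ebl_rcons -UZ -UD; apply: eq_U => a b.
    rewrite -evZ -evD; apply: eq_ev => bs; rewrite !map_rcons -!cats1.
    exact: (mlin_gapp f (map (gapp f) bs) [::] ml).
  rewrite -!rcons_cons -!rcons_cat !ev_ebl_rcons.
  apply: (U_mlin (phi := fun a b => ev (ebl K (@hp K V) n a)
     (fun bs => phi (map (gapp f) (rcons bs (rcons b u)))))) => // [b|a].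
    have h := IH _ (mlin_last (gapp f (rcons b u)) ml).
    have E v : ev (ebl K (@hp K V) n v) (fun bs => phi (map (gapp f) (rcons bs (rcons b u)))) =
      ev (ebl K (@hp K V) n v) (fun bs => phi (rcons (map (gapp f) bs) (gapp f (rcons b u)))).
      by apply: eq_ev => bs; rewrite map_rcons.
    by move=> s' t' *; rewrite !E; apply: h.
  move=> s' t' c' x' y' z' xz' yz' e'; rewrite -evZ -evD; apply: eq_ev => bs.
  rewrite !map_rcons -!cats1 -!catA /=.
  exact: (mlin_gapp f (map (gapp f) bs) [::] ml).
move=> ml s t c x y z; have := Bn (size (s ++ z :: t)) phi ml s t c x y z.
by rewrite /B !size_cat.
Qed.

Hypothesis f_theta : forall w,
  D theta w (fun v => f (hvals v)) = B f w (fun v => theta' (hvals v)).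

Lemma D_B w phi : mlin phi ->
  D theta w (fun u => B f u phi) = B f w (fun u => D theta' u phi).
Proof.
elim: {w}(size w) {-2}w (leqnn (size w)) phi => [|n IH] w.
  by rewrite leqn0 => /nilP-> phi ml; rewrite B_nil !D_nil.
case/lastP: w => [_ phi ml|w y]; first by rewrite B_nil !D_nil.
rewrite size_rcons ltnS => wn phi ml; pose z c := gapp f (rcons c y).
(* The terms in which d' (on the other side d, by induction) acts before the last block. Besides
   them, each side has F(a) followed by one letter: f(d(c y)) on the left and theta'(F(c y)) on the
   right. *)
pose S1 := UV w (fun a b => B f a (fun u => D theta' u (fun v => phi (rcons v (z b))))).
transitivity (S1 + UV w (fun a c => (-1) ^+ pv a *:
   B f a (fun u => B f (rcons c y) (fun v => phi (rcons u (gapp theta' v)))))); last first.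
  rewrite B_rcons.
  rewrite [RHS](_ : _ = UV w (fun a b => B f a (fun u => D theta' u (fun v => phi (rcons v (z b)))) +
     B f a (fun u => UW u (fun u1 u2 => (-1) ^+ pww u1 *:
        phi (rcons u1 (gapp theta' (rcons u2 (z b)))))))); last first.
    by apply: eq_U => a b; rewrite -B_D; apply: eq_B => u; rewrite D_rcons.
  rewrite UD; congr (_ + _).
  transitivity (UV w (fun a b => UV a (fun a1 a2 => (-1) ^+ pv a1 *:
     B f a1 (fun u => B f a2 (fun v => phi (rcons u (gapp theta' (rcons v (z b))))))))); last first.
    apply: eq_U => a b; rewrite B_U; apply: eq_U => a1 a2; rewrite -B_scale.
    apply: eq_B_in => u /pw_degs0 ->; by rewrite B_scale.
  rewrite U_A; apply: eq_U => a c; rewrite UZ -BU_C; congr (_ *: _).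
  by apply: eq_B => u; rewrite B_rcons.
transitivity (S1 + UV w (fun a c => (-1) ^+ pv a *:
   B f a (fun u => D theta (rcons c y) (fun v => phi (rcons u (gapp f v)))))); last first.
  congr (_ + _); apply: eq_U => a c; congr (_ *: _); apply: eq_B => u.
  (* f(d(c y)) and theta'(F(c y)) both have this degree, so the homomorphism axiom can be applied
     inside the last slot. *)
  have [L linL e] := mlin_slot u [::] (degs (rcons c y) + 1) ml.
  rewrite (@eq_D_in _ _ theta _ _ _ (fun v => L (f (hvals v)))) => [|v vw]; last first.
    by rewrite -cats1 e // hdeg_gapp vw addr0.
  rewrite /D -(ev_lin _ _ linL) [ev _ _]f_theta (ev_lin _ _ linL).
  rewrite -/(B f (rcons c y) (fun v => L (theta' (hvals v)))).
  apply: eq_B_in => v vw; by rewrite -cats1 e // hdeg_gapp vw.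
rewrite D_rcons (eq_D theta _ (fun u => B_rcons f u y phi)) D_U.
have -> : UV w (fun a b => D theta a (fun a' => B f a' (fun u => phi (rcons u (z b)))) +
    (-1) ^+ pv a *: D theta b (fun b' => B f a (fun u => phi (rcons u (z b'))))) =
  S1 + UV w (fun a b => (-1) ^+ pv a *: B f a (fun u => D theta b (fun b' => phi (rcons u (z b'))))).
  rewrite -UD; apply: eq_U_in => a b /perm_size ab; congr (_ + _).
    by rewrite IH //; [apply: leq_trans wn; rewrite -ab size_cat leq_addr|apply: mlin_last].
  by rewrite /D /B -ev_ev.
rewrite -addrA; congr (_ + _).
transitivity (UV w (fun a b => (-1) ^+ pv a *: B f a (fun u => D theta b (fun b' => phi (rcons u (z b')))))
  + UV w (fun a b => UV b (fun b1 b2 => (-1) ^+ pv a *: ((-1) ^+ pv b1 *: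
    B f a (fun u => phi (rcons u (gapp f (rcons b1 (gapp theta (rcons b2 y)))))))))).
  congr (_ + _); rewrite -U_A; apply: eq_U => a b; rewrite B_rcons -UZ.
  by apply: eq_U_in => a1 a2 /(pw_perm (@hp K V)) <-; signs.
rewrite -UD; apply: eq_U => a c; rewrite UZ -scalerDr; congr (_ *: _).
under eq_U do rewrite -B_scale.
by rewrite -BU_C -B_D; apply: eq_B => u; rewrite D_rcons.
Qed.

End Morphism.

(** * Agreement with the sums in the definitions *)

Section Sums.
Variables (K : fieldType) (V W : gradedSpace K) (M : lmodType K).
Implicit Types (xs : seq (hom V)).

Lemma big_triangle (R : nmodType) n (G : nat -> nat -> R) :
  \sum_(0 <= i < n) \sum_(0 <= k < n - i) G k (k + i)%N =
  \sum_(0 <= j < n) \sum_(0 <= k < j.+1) G k j.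
Proof.
elim: n => [|n IH]; first by rewrite !big_geq.
transitivity (\sum_(0 <= i < n.+1)
    (\sum_(0 <= k < n - i) G k (k + i)%N + G (n - i)%N n)).
  apply: eq_big_nat => i /andP[_]; rewrite ltnS => le_in.
  by rewrite subSn // big_nat_recr //= subnK.
rewrite big_split /= big_nat_recr //= subnn [X in _ + X + _]big_geq // addr0 IH.
rewrite [RHS]big_nat_recr //=; congr (_ + _).
by rewrite big_nat_rev; apply: eq_big_nat => i /andP[_ le_in]; rewrite add0n subSS subKn.
Qed.

(** With indices counted from 0, [k] letters stay in front of theta, which takes [i] further letters
    and the one at position [j = k + i]. For fixed [j] the sum over [k] runs through all unshuffles
    of [take j xs]. *)
Lemma theta_sumE (theta : gmulti 1 V V) (phi : seq (hom V) -> M) xs :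
  theta_sum theta phi xs = D theta xs phi.
Proof.
rewrite /theta_sum DE; set n := size xs.
pose F j (a b : seq (hom V)) := (-1) ^+ pw (@hp K V) a *:
  phi (a ++ gapp theta (rcons b (nth (hom0 V) xs j)) :: drop j.+1 xs).
pose G k j := U (@hp K V) (take j xs) (fun a b => if size a == k then F j a b else 0).
transitivity (\sum_(0 <= i < n) \sum_(0 <= k < n - i) G k (k + i)%N); last first.
  rewrite big_triangle; apply: eq_big_nat => j /andP[_ jn].
  by apply: sum_U_size; rewrite size_takel // ltnW.
rewrite big_add1 /=; apply: eq_big_nat => i /andP[_ lin].
rewrite big_add1 /= addn1 subnSK //; apply: eq_big_nat => k /andP[_ kin].
have kin' : (k + i < n)%N by rewrite addnC -ltn_subRL.
have kn : (k <= k + i <= size xs)%N by rewrite leq_addr ltnW.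
have := sum_shuffles (F (k + i)%N) kn; rewrite /G => <-.
rewrite addKn; apply: eq_bigr => s _.
by rewrite sign_degs mulrC -scalerA.
Qed.

Lemma block_sumE (f : gmulti 0 V W) (phi : seq (hom W) -> M) xs : xs != [::] ->
  block_sum f phi xs = B f xs phi.
Proof. exact: sum_Eshuffles. Qed.

End Sums.

(** * The reduced tensor coalgebra *)

Section GradedSupport.
Variables (K : fieldType) (V : gradedSpace K).
Implicit Types (v : V).

Lemma gsupp_uniq v : uniq (gsupp v).
Proof. by rewrite /gsupp; case: (cid2 (gdec v)). Qed.

Lemma gsupp_sum v : v = \sum_(i <- gsupp v) gpr i v.
Proof. by rewrite /gsupp; case: (cid2 (gdec v)). Qed.

Lemma gsupp_out v i : i \notin gsupp v -> gpr i v = 0.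
Proof.
move=> iv; rewrite {1}[v]gsupp_sum raddf_sum big_seq big1 //= => j jv.
by rewrite gprE; case: eqP iv => // ->; rewrite jv.
Qed.

(** [gsupp] is a chosen list, with no relation between the choices for different vectors; sums over
    it are compared on a common larger list. *)
Lemma gsupp_sum_over (M : nmodType) (l : int -> V -> M) v (r : seq int) :
  (forall i, l i 0 = 0) -> uniq r -> {subset gsupp v <= r} ->
  \sum_(i <- gsupp v) l i (gpr i v) = \sum_(i <- r) l i (gpr i v).
Proof.
move=> l0 ur sr; rewrite [RHS](bigID (mem (gsupp v))) /= [X in _ + X]big1 ?addr0.
  rewrite -[RHS]big_filter; apply: perm_big; apply: uniq_perm; rewrite ?gsupp_uniq ?filter_uniq //.
  by move=> i; rewrite mem_filter; case: (boolP (i \in gsupp v)) => // /sr ->.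
by move=> i /gsupp_out ->.
Qed.

Lemma gsupp_sum_linear (M : lmodType K) (l : int -> V -> M) :
  (forall i, linear (l i)) -> linear (fun v => \sum_(i <- gsupp v) l i (gpr i v)).
Proof.
move=> ll a u v /=.
pose r := undup (gsupp (a *: u + v) ++ gsupp u ++ gsupp v).
have l0 i : l i 0 = 0 by apply: lin0.
rewrite !(@gsupp_sum_over _ l _ r) ?undup_uniq //; last first.
- by move=> i h; rewrite mem_undup !mem_cat h.
- by move=> i h; rewrite mem_undup !mem_cat h orbT.
- by move=> i h; rewrite mem_undup !mem_cat h !orbT.
rewrite scaler_sumr -big_split; apply: eq_bigr => i _.
by rewrite /= linearP ll.
Qed.

Lemma gsupp_sum_homog (M : nmodType) (l : int -> V -> M) i v :
  (forall j, l j 0 = 0) -> homog i v -> \sum_(j <- gsupp v) l j (gpr j v) = l i v.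
Proof.
move=> l0 iv; have [ii|ii] := boolP (i \in gsupp v).
  rewrite (bigD1_seq i) ?gsupp_uniq //= iv big1 ?addr0 // => j ji.
  by rewrite -iv gprE (negbTE ji) l0.
have v0 : v = 0 by rewrite -iv gsupp_out.
by rewrite v0 l0 big1 // => j _; rewrite raddf0 l0.
Qed.

Lemma homog_ext (M : lmodType K) (f g : V -> M) : linear f -> linear g ->
  (forall i v, homog i v -> f v = g v) -> f =1 g.
Proof.
move=> lf lg e v; rewrite [v]gsupp_sum (lin_sum _ _ lf) (lin_sum _ _ lg).
by apply: eq_bigr => i _; apply: (e i); rewrite /homog gprE eqxx.
Qed.

End GradedSupport.

Section TensorProductMaps.
Variable K : fieldType.

Section Tens.
Variables A B : lmodType K.

Lemma tensDl a (x y : A) (z : B) : tens (a *: x + y) z = a *: tens x z + tens y z.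
Proof.
have /eqP := qcl_rel (bilinl a x y z).
by rewrite !linearB linearZ_LR /= -addrA -opprD subr_eq0 => /eqP.
Qed.

Lemma tensDr a (x : A) (y z : B) : tens x (a *: y + z) = a *: tens x y + tens x z.
Proof.
have /eqP := qcl_rel (bilinr a x y z).
by rewrite !linearB linearZ_LR /= -addrA -opprD subr_eq0 => /eqP.
Qed.

Lemma tens0l (z : B) : tens (0 : A) z = 0.
Proof. by apply: (lin0 (f := fun x : A => tens x z)) => a x y; apply: tensDl. Qed.

Lemma tens0r (x : A) : tens x (0 : B) = 0.
Proof. by apply: (lin0 (f := tens x)) => a y z; apply: tensDr. Qed.

Lemma tprod_ind (P : tprod A B -> Prop) :
  P 0 -> (forall a x y z, P z -> P (a *: tens x y + z)) -> forall z, P z.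
Proof.
move=> P0 Ps z; have [x ->] := qcl_surj z.
rewrite -(freeg_sumE x) raddf_sum /=.
elim: (dom x) => [|p s IH]; first by rewrite big_nil.
rewrite big_cons; have -> : << coeff p x *g p >> = coeff p x *: << p >> :> {freeg (A * B)%type / K}.
  by apply/eqP/freeg_eqP => k; rewrite coeffZ !coeffU mul1r.
by rewrite linearZ_LR; case: p => u v; apply: Ps.
Qed.

Lemma tprod_ext (M : lmodType K) (f g : tprod A B -> M) : linear f -> linear g ->
  (forall x y, f (tens x y) = g (tens x y)) -> f =1 g.
Proof.
move=> lf lg e; elim/tprod_ind => [|a x y z IH]; first by rewrite !lin0.
by rewrite lf lg e IH.
Qed.

End Tens.

Section TMap.
Variables (A B A' B' : lmodType K) (f : A -> A') (g : B -> B').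
Hypotheses (lf : linear f) (lg : linear g).

Let tmap_rel (r : {freeg (A * B)%type / K}) : bilin_rel r ->
  (fglift (fun p : A * B => tens (f p.1) (g p.2)) : {freeg (A * B)%type / K} -> tprod A' B') r = 0.
Proof.
case=> a x y z; rewrite !linearB linearZ_LR /= !liftU !scale1r /=.
  by rewrite lf tensDl -addrA -opprD subrr.
by rewrite lg tensDr -addrA -opprD subrr.
Qed.

Lemma tmapE x y : tmap f g (tens x y) = tens (f x) (g y).
Proof.
pose F : {linear {freeg (A * B)%type / K} -> tprod A' B'} :=
  fglift (fun p : A * B => tens (f p.1) (g p.2)).
rewrite /tmap /tens (qliftE (f := F)) // /F /= liftU scale1r //.
Qed.

Lemma tmap_linear : linear (tmap f g).
Proof.
pose F : {linear {freeg (A * B)%type / K} -> tprod A' B'} :=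
  fglift (fun p : A * B => tens (f p.1) (g p.2)).
move=> a z1 z2; have [x ->] := qcl_surj z1; have [y ->] := qcl_surj z2.
by rewrite -linearP /tmap !(qliftE (f := F)) // linearP.
Qed.

End TMap.

Lemma tmap_comp (A B A' B' A'' B'' : lmodType K) (f : A -> A') (g : B -> B')
    (f' : A' -> A'') (g' : B' -> B'') z :
  linear f -> linear g -> linear f' -> linear g' ->
  tmap f' g' (tmap f g z) = tmap (f' \o f) (g' \o g) z.
Proof.
move=> lf lg lf' lg'.
have lff : linear (f' \o f) by move=> a x y /=; rewrite lf lf'.
have lgg : linear (g' \o g) by move=> a x y /=; rewrite lg lg'.
apply: (tprod_ext (f := fun z => tmap f' g' (tmap f g z))) => [a x y||x y].
- by rewrite !tmap_linear.
- exact: tmap_linear.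
by rewrite !tmapE.
Qed.

End TensorProductMaps.

Section WordModules.
Variables (K : fieldType) (m : nat) (V : gradedSpace K).
Implicit Types (s t : seq (hom V)) (R : freeWords m V -> Prop).

Lemma word_ext R (M : lmodType K) (f g : wordMod R -> M) : linear f -> linear g ->
  (forall s, (m <= size s)%N -> f (wcl R s) = g (wcl R s)) -> f =1 g.
Proof.
move=> lf lg e z; have [t [/allP tm ->]] := wordMod_span z.
have E (h : wordMod R -> M) : linear h ->
    h (\sum_(p <- t) p.1 *: wcl R p.2) = \sum_(p <- t) p.1 *: h (wcl R p.2).
  by move=> lh; apply: (ev_lin t (fun s => wcl R s) lh).
by rewrite !E //; apply: eq_big_seq => p /tm pm; rewrite e.
Qed.

Section Lift.
Variables (M : lmodType K) (phi : seq (hom V) -> M).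
Hypothesis ml : mlin phi.

Lemma mlin_tensor_rel r : tensor_rel (m := m) r -> fwlift phi r = 0.
Proof.
case=> s t a x y z xz yz e; rewrite !linearB linearZ_LR /= !fwlift_fword !size_cat /=.
case: ifP => _; last by rewrite scaler0 !subr0.
by rewrite (@ml s t a x y z) // -addrA -opprD subrr.
Qed.

Lemma mlin_sym_rel r : symf (@hp K V) phi -> sym_rel (m := m) r -> fwlift phi r = 0.
Proof.
move=> sy [{}r /mlin_tensor_rel // | s t x y].
rewrite !linearB linearZ_LR /= !fwlift_fword !size_cat /=.
case: ifP => _; last by rewrite scaler0 subr0.
by rewrite sy exprz_hdegM subrr.
Qed.

End Lift.

Lemma mlin_wcl R : (forall r, tensor_rel r -> R r) -> mlin (wcl R).
Proof.
move=> TR s t a x y z xz yz e.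
have /eqP := qcl_rel (TR _ (tensor_relP m s t xz yz e)).
by rewrite !linearB linearZ_LR /= -addrA -opprD subr_eq0 => /eqP.
Qed.

Lemma mlin_tw : mlin (@tw K m V). Proof. exact: mlin_wcl. Qed.
Lemma mlin_sw : mlin (@sw K m V). Proof. apply: mlin_wcl; exact: sym_tensor. Qed.

Lemma symf_sw : symf (@hp K V) (@sw K m V).
Proof.
move=> s x y t; have /eqP := qcl_rel (sym_swap m s t x y).
by rewrite linearB linearZ_LR /= subr_eq0 exprz_hdegM => /eqP.
Qed.

Lemma gpr_tw i s : gpr i (tw m s) = if degs s == i then tw m s else 0.
Proof. exact: (wpr_wcl (@tensor_homog K m V)). Qed.

Lemma homog_tw s : homog (degs s) (tw m s).
Proof. by rewrite /homog gpr_tw eqxx. Qed.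

Lemma T_lin (M : lmodType K) (phi : seq (hom V) -> M) : mlin phi ->
  linear (wlift phi : Tge m V -> M).
Proof. by move=> ml; apply: wlift_linear => r /mlin_tensor_rel; apply. Qed.

Lemma T_liftE (M : lmodType K) (phi : seq (hom V) -> M) s : mlin phi -> (m <= size s)%N ->
  wlift phi (tw m s) = phi s.
Proof. by move=> ml; apply: wliftE => r /mlin_tensor_rel; apply. Qed.

Lemma S_lin (M : lmodType K) (phi : seq (hom V) -> M) : mlin phi -> symf (@hp K V) phi ->
  linear (wlift phi : Sge m V -> M).
Proof. by move=> ml sy; apply: wlift_linear => r; apply: mlin_sym_rel. Qed.

Lemma S_liftE (M : lmodType K) (phi : seq (hom V) -> M) s : mlin phi -> symf (@hp K V) phi ->
  (m <= size s)%N -> wlift phi (sw m s) = phi s.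
Proof. by move=> ml sy; apply: wliftE => r; apply: mlin_sym_rel. Qed.

End WordModules.

Section Reduced.
Variables (K : fieldType) (V : gradedSpace K).

Lemma tw1_nil : tw 1 [::] = 0 :> Tge 1 V. Proof. exact: wcl_short. Qed.
Lemma sw1_nil : sw 1 [::] = 0 :> Sge 1 V. Proof. exact: wcl_short. Qed.

Lemma T1_liftE (M : lmodType K) (phi : seq (hom V) -> M) s : mlin phi -> phi [::] = 0 ->
  wlift phi (tw 1 s) = phi s.
Proof.
move=> ml p0; case: s => [|x s]; last by rewrite T_liftE.
by rewrite tw1_nil lin0 //; apply: T_lin.
Qed.

Lemma S1_liftE (M : lmodType K) (phi : seq (hom V) -> M) s : mlin phi ->
  symf (@hp K V) phi -> phi [::] = 0 -> wlift phi (sw 1 s) = phi s.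
Proof.
move=> ml sy p0; case: s => [|x s]; last by rewrite S_liftE.
by rewrite sw1_nil lin0 //; apply: S_lin.
Qed.

End Reduced.

Lemma homog_linear (K : fieldType) (V W : gradedSpace K) m (R : freeWords m V -> Prop)
    (hR : homog_rel R) (d : int) (f : gradedWordMod hR -> W) : linear f ->
  (forall s, homog (degs s + d) (f (wcl R s))) ->
  forall i x, homog i x -> homog (i + d) (f x).
Proof.
move=> lf fs i x ix; rewrite /homog -ix; move: x {ix}.
apply: word_ext => [a u v|a u v|s _].
- by rewrite linearP lf linearP.
- by rewrite linearP lf.
have -> : gpr i (wcl R s : gradedWordMod hR) = if degs s == i then wcl R s else 0.
  exact: wpr_wcl.
case: eqP => [<-|_]; [exact: fs | by rewrite lin0 // raddf0].
Qed.

Section Coproducts.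
Variables (K : fieldType) (V : gradedSpace K).
Implicit Types (s : seq (hom V)).
Local Notation U := (U (@hp K V)).

(** Since [tw 1 [::] = 0], the terms with an empty factor vanish, and this is the reduced coshuffle
    coproduct. *)
Definition Tdelta : Tbar V -> tprod (Tbar V) (Tbar V) :=
  wlift (fun s => U s (fun a b => @tens K (Tbar V) (Tbar V) (tw 1 a) (tw 1 b))).

Definition Tc : gcoalg K := GCoalg Tdelta.

Lemma mlin_tens m (R : freeWords m V -> Prop) : (forall r, tensor_rel r -> R r) ->
  mlin (fun s => U s (fun a b => @tens K (wordMod R) (wordMod R) (wcl R a) (wcl R b))).
Proof.
move=> TR; apply: (U_mlin (phi := fun a b => tens (wcl R a) (wcl R b))) => [b|a];
  move=> s t c x y z xz yz e; rewrite (mlin_wcl TR _ _ xz yz e).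
  exact: tensDl.
exact: tensDr.
Qed.

Lemma Tdelta_linear : linear Tdelta.
Proof. apply: (@T_lin K 1); exact: mlin_tens. Qed.

Lemma TdeltaE s : Tdelta (tw 1 s) =
  U s (fun a b => @tens K (Tbar V) (Tbar V) (tw 1 a) (tw 1 b)).
Proof.
by rewrite /Tdelta T1_liftE //; [apply: mlin_tens|rewrite U_nil tw1_nil tens0l].
Qed.

Lemma symf_tens : symf (@hp K V)
  (fun s => U s (fun a b => @tens K (Sbar V) (Sbar V) (sw 1 a) (sw 1 b))).
Proof.
apply: U_symf => [b|a] s x y t; rewrite symf_sw.
  by have := tensDl ((-1) ^+ (hp x && hp y)) (sw 1 (s ++ y :: x :: t) : Sbar V) 0 (sw 1 b : Sbar V);
    rewrite addr0 tens0l addr0.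
by have := tensDr ((-1) ^+ (hp x && hp y)) (sw 1 a : Sbar V) (sw 1 (s ++ y :: x :: t) : Sbar V) 0;
    rewrite addr0 tens0r addr0.
Qed.

(** The terms [i = 0] and [i = n], absent from the definition, have an empty factor and vanish. *)
Lemma Sdelta_lift : @Sdelta K V =
  wlift (fun s => U s (fun a b => @tens K (Sbar V) (Sbar V) (sw 1 a) (sw 1 b))).
Proof.
rewrite /Sdelta; congr (@wlift _ _ _ _ _ _); apply: funext => s /=.
set n := size s; pose F a b := @tens K (Sbar V) (Sbar V) (sw 1 a) (sw 1 b).
transitivity (\sum_(1 <= k < n) U s (fun a b => if size a == k then F a b else 0)).
  apply: eq_big_nat => k /andP[_ kn]; have := sum_shuffles (xs := s) (n := n) (k := k) F.
  by rewrite take_size; apply; rewrite (ltnW kn) leqnn.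
rewrite -[RHS](@sum_U_size _ _ _ n s F) //.
have U00 : U s (fun a b => if size a == 0 then F a b else 0) = 0.
  rewrite -[RHS](U0 (@hp K V) _ s); apply: eq_U => a b; case: eqP => // /size0nil->.
  by rewrite /F sw1_nil tens0l.
have Unn : U s (fun a b => if size a == n then F a b else 0) = 0.
  rewrite -[RHS](U0 (@hp K V) _ s); apply: eq_U_in => a b /perm_size ab.
  case: eqP => // an; have b0 : b = [::].
    apply: size0nil; apply/eqP; rewrite -(eqn_add2l (size a)) addn0 -size_cat ab.
    by rewrite an.
  by rewrite b0 /F sw1_nil tens0r.
rewrite [RHS]big_nat_recr //= Unn addr0.
case: n U00 {Unn} => [|n] U00; first by rewrite !big_geq.
by rewrite [RHS]big_nat_recl // U00 add0r big_add1.
Qed.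

Lemma Sdelta_linear : linear (@Sdelta K V).
Proof.
rewrite Sdelta_lift; apply: (@S_lin K 1); last exact: symf_tens.
by apply: mlin_tens; apply: sym_tensor.
Qed.

Lemma SdeltaE s : Sdelta (sw 1 s : Sbar V) =
  U s (fun a b => @tens K (Sbar V) (Sbar V) (sw 1 a) (sw 1 b)).
Proof.
rewrite Sdelta_lift S1_liftE //; last by rewrite U_nil sw1_nil tens0l.
- by apply: mlin_tens; apply: sym_tensor.
exact: symf_tens.
Qed.

End Coproducts.

Section GSign.
Variables (K : fieldType) (V : gradedSpace K).

Lemma gsign_linear : linear (@gsign K V).
Proof.
apply: (gsupp_sum_linear (l := fun i (x : V) => (-1) ^ i *: x)) => i a x y.
by rewrite scalerDr !scalerA mulrC.
Qed.

Lemma gsign_homog i (x : V) : homog i x -> gsign x = (-1) ^ i *: x.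
Proof.
move=> ix; apply: (gsupp_sum_homog (l := fun i (x : V) => (-1) ^ i *: x)) => // j.
by rewrite scaler0.
Qed.

End GSign.

Lemma homog_ev (K : fieldType) (A : eqType) (V : gradedSpace K) (t : seq (K * A)) i
    (phi : A -> V) :
  (forall p, p \in t -> homog i (phi p.2)) -> homog i (ev t phi).
Proof.
by move=> h; rewrite /homog (ev_lin _ _ (@gpr_linear _ V i)); apply: eq_ev_in.
Qed.

(** * d and F on the reduced tensor coalgebra *)

Section LeibnizTensor.
Variables (K : fieldType).
Local Notation U G := (U (@hp K G)).

Section Differential.
Variable G : leibnizInf K.
Local Notation theta := (lz_theta G).

Lemma dT_lift : dT (G := G) = wlift (fun s => D theta s (@tw K 1 G)).
Proof.
by rewrite /dT; congr (@wlift _ _ _ _ _ _); apply: funext => s; apply: theta_sumE.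
Qed.

Lemma dT_linear : linear (dT (G := G)).
Proof. rewrite dT_lift; apply: (@T_lin K 1); apply: D_mlin; exact: mlin_tw. Qed.

Lemma dTE s : dT (tw 1 s : Tbar G) = D theta s (@tw K 1 G).
Proof.
rewrite dT_lift T1_liftE ?D_nil //; apply: D_mlin; exact: mlin_tw.
Qed.

Lemma lz_D w : D theta w (fun v => theta (hvals v)) = 0.
Proof. by rewrite -theta_sumE lz_axiom. Qed.

Lemma dT_codifferential : is_codifferential (C := Tc G) (dT (G := G)).
Proof.
have dl := dT_linear; have idl : linear (@id (Tbar G)) by [].
have gl := @gsign_linear K (Tbar G).
split; first split; first exact: dl.
- apply: (homog_linear (hR := @tensor_homog K 1 G)) => [|s]; first exact: dl.
  rewrite -/(tw 1 s) dTE; apply: homog_ev => p /D_degs <-; exact: homog_tw.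
- have Tl := @Tdelta_linear K G.
  move=> x /=; move: x; apply: word_ext => [||s _].
  + exact: (lin_comp dl Tl).
  + exact: (lin_add (lin_comp Tl (tmap_linear dl idl)) (lin_comp Tl (tmap_linear gl dl))).
  rewrite -/(tw 1 s) dTE TdeltaE (ev_lin _ _ (@Tdelta_linear _ G)).
  rewrite (eq_ev _ (@TdeltaE K G)) -/(D _ _ _) D_U.
  rewrite !(U_lin _ _ _ (tmap_linear _ _)) // -UD; apply: eq_U => a b.
  rewrite !tmapE // !dTE; congr (_ + _).
    by rewrite (ev_lin (f := fun x => tens x (tw 1 b)) _ _ (fun c x y => tensDl c x y _)).
  rewrite (gsign_homog (homog_tw _ _)) sign_degs -[_ *: tw 1 a]addr0 tensDl tens0l addr0.
  by congr (_ *: _); rewrite (ev_lin (f := tens (tw 1 a)) _ _ (fun c x y => tensDr c _ x y)).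
apply: word_ext => [a x y|a x y|s _]; rewrite ?scaler0 ?addr0 ?dl //.
rewrite -/(tw 1 s) dTE (ev_lin _ _ dl) (eq_ev _ dTE).
by apply: D_D; [apply: lz_D|apply: mlin_tw].
Qed.

End Differential.

Section Morphisms.
Variables (G G' : leibnizInf K) (f : leibnizInfHom G G').
Local Notation B := (B (lh_fun f)).

Lemma FT_mlin : mlin (fun s => B s (@tw K 1 G')).
Proof. by apply: B_mlin; apply: mlin_tw. Qed.

Lemma FT_lift : FT f = wlift (fun s => B s (@tw K 1 G')).
Proof.
rewrite /FT; congr (@wlift _ _ _ _ _ _); apply: funext => -[|x s]; last exact: block_sumE.
by rewrite B_nil tw1_nil /block_sum big_geq.
Qed.

Lemma FT_linear : linear (FT f).
Proof. rewrite FT_lift; apply: (@T_lin K 1); exact: FT_mlin. Qed.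

Lemma FTE s : FT f (tw 1 s : Tbar G) = B s (@tw K 1 G').
Proof.
by rewrite FT_lift T1_liftE ?B_nil ?tw1_nil //; apply: FT_mlin.
Qed.

Lemma lh_B w : D (lz_theta G) w (fun v => lh_fun f (hvals v)) =
  B w (fun v => lz_theta G' (hvals v)).
Proof.
have [->|w0] := eqVneq w [::]; first by rewrite D_nil B_nil gm_nil.
by rewrite -theta_sumE lh_axiom block_sumE.
Qed.

Lemma FT_coalg_hom : is_coalg_hom (C := Tc G) (C' := Tc G') (FT f).
Proof.
have fl := FT_linear; split; first exact: fl.
- move=> i x ix; rewrite -[i]addr0; move: i x ix.
  apply: (homog_linear (hR := @tensor_homog K 1 G)) => [|s]; first exact: fl.
  rewrite -/(tw 1 s) FTE addr0; apply: homog_ev => q /ebl_perm/degs_perm <-.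
  rewrite -(gapp_blocks_degs (lh_fun f)); exact: homog_tw.
move=> x /=; move: x; apply: word_ext => [||s _].
+ exact: (lin_comp fl (@Tdelta_linear K G')).
+ exact: (lin_comp (@Tdelta_linear K G) (tmap_linear fl fl)).
rewrite -/(tw 1 s) FTE TdeltaE (ev_lin _ _ (@Tdelta_linear _ G')).
rewrite (eq_ev _ (fun bs => TdeltaE _)).
rewrite -/(B s (fun u => U G' u (fun a b => @tens K (Tbar G') (Tbar G') (tw 1 a) (tw 1 b)))).
rewrite B_U !(U_lin _ _ _ (tmap_linear _ _)) //; apply: eq_U => a b.
rewrite !tmapE // !FTE.
rewrite (ev_lin (f := fun x => tens x (B b (@tw K 1 G'))) _ _ (fun c x y => tensDl c x y _)).
by apply: eq_ev => bs; rewrite (ev_lin (f := tens (tw 1 _)) _ _ (fun c x y => tensDr c _ x y)).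
Qed.

Lemma FT_dT x : FT f (dT x) = dT (FT f x).
Proof.
have fl := FT_linear; have dl := dT_linear; move: x.
apply: word_ext => [a x y|a x y|s _]; rewrite ?dl ?fl ?dl //.
rewrite -/(tw 1 s) dTE (ev_lin _ _ fl) (eq_ev _ FTE) FTE (ev_lin _ _ (@dl G')).
rewrite (eq_ev _ (fun bs => dTE _)).
by apply: D_B; [apply: lh_B|apply: mlin_tw].
Qed.

End Morphisms.
End LeibnizTensor.

(** * Lie elements and the enveloping algebra *)

Section WordProduct.
Variables (K : fieldType) (V : gradedSpace K) (R : freeWords 0 V -> Prop).
Hypothesis Rl : forall s r, R r -> fwlift (fun t => wcl R (s ++ t)) r = 0.
Hypothesis Rr : forall t r, R r -> fwlift (fun s => wcl R (s ++ t)) r = 0.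

Lemma fwlift_ev (M : lmodType K) (phi : seq (hom V) -> M) (r : freeWords 0 V) :
  fwlift phi r = ev [seq (coeff u r, val u) | u <- dom r] phi.
Proof.
rewrite /ev big_map -{1}(freeg_sumE r) raddf_sum; apply: eq_bigr => u _ /=.
by rewrite /fwlift liftU.
Qed.

Lemma wmulE s t : wmul (wcl R s) (wcl R t) = wcl R (s ++ t).
Proof.
rewrite /wmul; have -> : (fun s => wlift (fun t => wcl R (s ++ t)) (wcl R t)) =
    (fun s => wcl R (s ++ t)).
  by apply: funext => u; rewrite (wliftE (Rl u)).
by rewrite (wliftE (Rr t)).
Qed.

Lemma wmul_linr x : linear (fun y => wmul x y : wordMod R).
Proof.
have linw s : linear (wlift (fun t => wcl R (s ++ t)) : wordMod R -> wordMod R).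
  exact: wlift_linear (Rl s).
(* With the chosen representative of [x] fixed, the product is a combination of maps linear in
   [y]. *)
have E y : wmul x y = ev [seq (coeff u (repr x), val u) | u <- dom (repr x)]
    (fun s => wlift (fun t => wcl R (s ++ t)) y) by apply: fwlift_ev.
by move=> a y z; rewrite !E -evZ -evD; apply: eq_ev => s; apply: linw.
Qed.

Lemma wmul_linl y : linear (fun x => wmul x y : wordMod R).
Proof.
apply: wlift_linear => r Rr'.
rewrite fwlift_ev; have [t [_ ->]] := wordMod_span y.
have E s : wlift (fun t => wcl R (s ++ t)) (\sum_(p <- t) p.1 *: wcl R p.2) =
    ev t (fun v => wcl R (s ++ v)).
  rewrite -/(ev t (fun v => wcl R v)) (ev_lin _ _ (wlift_linear (Rl s))).
  by apply: eq_ev => v; rewrite (wliftE (Rl s)).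
rewrite (eq_ev _ E) ev_ev -[RHS](ev0 _ t); apply: eq_ev => v.
by rewrite -fwlift_ev Rr.
Qed.

End WordProduct.

Section TensorAlgebra.
Variables (K : fieldType) (V : gradedSpace K).
Implicit Types (a b c e s t w : seq (hom V)).
Local Notation T := (Tge 0 V).
Local Notation tw0 := (@tw K 0 V).
Local Notation U := (U (@hp K V)).
Local Notation pw := (pw (@hp K V)).

Lemma mlin_catl (M : lmodType K) s (phi : seq (hom V) -> M) : mlin phi ->
  mlin (fun t => phi (s ++ t)).
Proof. by move=> ml s' t a x y z *; rewrite !catA; apply: ml. Qed.

Lemma mlin_catr (M : lmodType K) t (phi : seq (hom V) -> M) : mlin phi ->
  mlin (fun s => phi (s ++ t)).
Proof. by move=> ml s t' a x y z *; rewrite -!catA; apply: ml. Qed.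

Let Tl s r : tensor_rel (m := 0) r -> fwlift (fun t => tw0 (s ++ t)) r = 0.
Proof. by apply: mlin_tensor_rel; apply: mlin_catl; apply: mlin_tw. Qed.
Let Tr t r : tensor_rel (m := 0) r -> fwlift (fun s => tw0 (s ++ t)) r = 0.
Proof. by apply: mlin_tensor_rel; apply: mlin_catr; apply: mlin_tw. Qed.

Lemma tmulE s t : tmul (tw0 s) (tw0 t) = tw0 (s ++ t).
Proof. exact: wmulE. Qed.

Lemma tmul_linr (x : T) : linear (tmul x).
Proof. exact: (wmul_linr Tl). Qed.

Lemma tmul_linl (y : T) : linear (fun x : T => tmul x y).
Proof. exact: (wmul_linl Tl Tr). Qed.

Definition hcomm i j (x y : T) : T := tmul x y - (-1) ^ (i * j) *: tmul y x.

Lemma hcomm_linr i j x : linear (hcomm i j x).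
Proof.
move=> a y z; rewrite /hcomm tmul_linr tmul_linl scalerDr opprD addrACA scalerBr.
by rewrite !scalerA mulrC.
Qed.

Lemma hcomm_linl i j y : linear (hcomm i j ^~ y).
Proof.
move=> a x z; rewrite /hcomm tmul_linr tmul_linl scalerDr opprD addrACA scalerBr.
by rewrite !scalerA mulrC.
Qed.

Lemma tbr_linl (y : T) : linear (fun x : T => tbr x y).
Proof.
apply: (gsupp_sum_linear (l := fun i (x : T) => \sum_(j <- gsupp y) hcomm i j x (gpr j y))).
move=> i a x z; rewrite scaler_sumr -big_split; apply: eq_bigr => j _.
exact: hcomm_linl.
Qed.

Lemma tbrE (x y : T) : tbr x y =
  \sum_(j <- gsupp y) \sum_(i <- gsupp x) hcomm i j (gpr i x) (gpr j y).
Proof. exact: exchange_big. Qed.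

Lemma tbr_linr (x : T) : linear (tbr x).
Proof.
move=> a y z; rewrite !tbrE.
apply: (gsupp_sum_linear (l := fun j (y : T) => \sum_(i <- gsupp x) hcomm i j (gpr i x) y)).
move=> j b u v; rewrite scaler_sumr -big_split; apply: eq_bigr => i _.
exact: hcomm_linr.
Qed.

Lemma tbr_homog i j (x y : T) : homog i x -> homog j y -> tbr x y = hcomm i j x y.
Proof.
move=> ix jy; rewrite tbrE.
have l0 k l (u : T) : hcomm k l u 0 = 0 by rewrite lin0 //; apply: hcomm_linr.
have r0 k l (u : T) : hcomm k l 0 u = 0 by rewrite (lin0 (hcomm_linl k l u)).
rewrite (gsupp_sum_homog (l := fun j (y : T) => \sum_(i <- gsupp x) hcomm i j (gpr i x) y) _ jy).
  by rewrite (gsupp_sum_homog (l := fun i (x : T) => hcomm i j x y) _ ix).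
by move=> l; rewrite big1.
Qed.

Lemma tbr_tw a b : tbr (tw0 a) (tw0 b) =
  tw0 (a ++ b) - (-1) ^+ (pw a && pw b) *: tw0 (b ++ a).
Proof.
rewrite (tbr_homog (homog_tw 0 a) (homog_tw 0 b)) /hcomm !tmulE exprz_sign.
by rewrite abszM oddM !pw_degs.
Qed.

Lemma ev_tbr (r t : seq (K * seq (hom V))) : tbr (ev r tw0) (ev t tw0) =
  ev r (fun c => ev t (fun e => tw0 (c ++ e) - (-1) ^+ (pw c && pw e) *: tw0 (e ++ c))).
Proof.
rewrite (ev_lin _ _ (tbr_linl _)); apply: eq_ev => c.
by rewrite (ev_lin _ _ (@tbr_linr _)); apply: eq_ev => e; rewrite tbr_tw.
Qed.

(** [prim t] expresses formally, on words of homogeneous elements and before any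
    multilinearity is used, that (the class of) [t] is primitive. *)
Definition prim (t : seq (K * seq (hom V))) : Prop :=
  forall (M : lmodType K) (phi : seq (hom V) -> seq (hom V) -> M) w,
    ev t (fun c => U (c ++ w) phi) =
    ev t (fun c => U w (fun a b => phi (c ++ a) b + (-1) ^+ (pw c && pw a) *: phi a (c ++ b))).

Implicit Types (r : seq (K * seq (hom V))).

Lemma prim_cat r r' : prim r -> prim r' -> prim (r ++ r').
Proof. by move=> pt pt' M phi w; rewrite !ev_cat pt pt'. Qed.

Definition scalef k r := [seq (k * q.1, q.2) | q <- r].

Lemma ev_scalef (M : lmodType K) k r (phi : seq (hom V) -> M) :
  ev (scalef k r) phi = k *: ev r phi.
Proof.
by rewrite ev_map /ev scaler_sumr; apply: eq_bigr => q _; rewrite scalerA.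
Qed.

Lemma prim_scale k r : prim r -> prim (scalef k r).
Proof. by move=> pt M phi w; rewrite !ev_scalef pt. Qed.

Lemma prim_gen x : prim [:: (1, [:: x])].
Proof.
move=> M phi w; rewrite !ev1 /= U_cons -UD; apply: eq_U => a b.
by rewrite pw_cons pw_nil addbF.
Qed.

Definition fcomm r r' : seq (K * seq (hom V)) :=
  bind r (fun c => bind r' (fun e =>
    [:: (1, c ++ e); (- (-1) ^+ (pw c && pw e), e ++ c)])).

Lemma ev_fcomm (M : lmodType K) r r' (phi : seq (hom V) -> M) : ev (fcomm r r') phi =
  ev r (fun c => ev r' (fun e => phi (c ++ e) - (-1) ^+ (pw c && pw e) *: phi (e ++ c))).
Proof.
rewrite ev_bind; apply: eq_ev => c; rewrite ev_bind; apply: eq_ev => e.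
by rewrite /ev !big_cons big_nil addr0 scale1r scaleNr.
Qed.

Lemma prim_mul (M : lmodType K) (phi : seq (hom V) -> seq (hom V) -> M) r r' w :
  prim r -> prim r' ->
  ev r (fun c => ev r' (fun e => U ((c ++ e) ++ w) phi)) =
  ev r (fun c => ev r' (fun e => U w (fun a b =>
    (phi ((c ++ e) ++ a) b + (-1) ^+ (pw c && pw (e ++ a)) *: phi (e ++ a) (c ++ b)) +
    ((-1) ^+ (pw e && pw a) *: phi (c ++ a) (e ++ b) +
     (-1) ^+ (pw (c ++ e) && pw a) *: phi a ((c ++ e) ++ b))))).
Proof.
move=> pr pr'; rewrite ev_ev.
transitivity (ev r' (fun e => ev r (fun c => U (e ++ w) (fun a b =>
    phi (c ++ a) b + (-1) ^+ (pw c && pw a) *: phi a (c ++ b))))).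
  by apply: eq_ev => e; rewrite -pr; apply: eq_ev => c; rewrite catA.
rewrite ev_ev; apply: eq_ev => c; rewrite pr'; apply: eq_ev => e; apply: eq_U => a b.
rewrite scalerDr -!catA; congr (_ + (_ + _)); signs.
Qed.

Lemma ev2_lin (M : lmodType K) r r' (f g : seq (hom V) -> seq (hom V) -> M) k :
  ev r (fun c => ev r' (fun e => f c e + k *: g c e)) =
  ev r (fun c => ev r' (f c)) + k *: ev r (fun c => ev r' (g c)).
Proof.
rewrite -evZ -evD; apply: eq_ev => c; rewrite -evZ -evD; exact: eq_ev.
Qed.

(** Of the four terms in the coproduct of a product of primitives, the two mixed ones cancel in the
    graded commutator. Constant parities on [r] and [r'] make the commutator sign a single
    scalar. *)
Lemma prim_fcomm r r' p q : prim r -> prim r' ->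
  (forall u, u \in r -> pw u.2 = p) -> (forall u, u \in r' -> pw u.2 = q) ->
  prim (fcomm r r').
Proof.
move=> pr pr' rp r'q M phi w.
have E (N : lmodType K) (psi : seq (hom V) -> N) : ev (fcomm r r') psi =
    ev r (fun c => ev r' (fun e => psi (c ++ e))) +
    (- (-1) ^+ (p && q)) *: ev r (fun c => ev r' (fun e => psi (e ++ c))).
  rewrite ev_fcomm -ev2_lin; apply: eq_ev_in => c /rp ->; apply: eq_ev_in => e /r'q ->.
  by rewrite scaleNr.
rewrite !E (prim_mul _ _ pr pr') [X in _ + _ *: X]ev_ev (prim_mul _ _ pr' pr).
rewrite [X in _ + _ *: X]ev_ev -!ev2_lin.
apply: eq_ev_in => c /rp cp; apply: eq_ev_in => e /r'q eq.
rewrite -!UZ -!UD; apply: eq_U => a b.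
rewrite !pw_cat cp eq !scalerDr !scalerA !mulNr -!signr_addb !scaleNr.
(* Terms 2 and 7, and terms 3 and 6, are the mixed ones that cancel. *)
rewrite [LHS](AC ((2*2)*(2*2)) (((1*4)*(5*8))*((2*7)*(3*6)))) /=.
rewrite !andb_addr [q && p]andbC !addbA !addbb !addFb.
by rewrite !subrr !addr0.
Qed.

End TensorAlgebra.

(** * Primitive lifts of Lie elements *)

Section LieElements.
Variables (K : fieldType) (V : gradedSpace K).
Local Notation T := (Tge 0 V).
Local Notation tw0 := (@tw K 0 V).
Local Notation L := (Lie V).
Local Notation pw := (pw (@hp K V)).
Implicit Types (r : seq (K * seq (hom V))) (x y z : hom L) (xs ys s t : seq (hom L)).

(** Iterated brackets of generators are homogeneous of a known degree and span Lie(V), so statements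
    about Lie elements reduce to them by linearity. *)
Inductive bracket : int -> T -> Prop :=
| bracket_gen (v : hom V) : bracket (hdeg v) (tw0 [:: v])
| bracket_br i j (u v : T) : bracket i u -> bracket j v -> bracket (i + j) (tbr u v).

Lemma bracket_inLie i u : bracket i u -> inLie u.
Proof. by elim=> [v|j k a b _ ? _ ?]; [apply: inLie_gen|apply: inLie_br]. Qed.

Definition lift_of i r u :=
  [/\ prim r, forall q, q \in r -> degs q.2 = i /\ q.2 != [::] & u = ev r tw0].

Lemma fcomm_degs r r' i j :
  (forall q, q \in r -> degs q.2 = i /\ q.2 != [::]) ->
  (forall q, q \in r' -> degs q.2 = j /\ q.2 != [::]) ->
  forall q, q \in fcomm r r' -> degs q.2 = i + j /\ q.2 != [::].
Proof.
move=> dr dr' q /flatten_mapP[c /dr[ci c0] /mapP[q' q'm ->]].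
case/flatten_mapP: q'm => e /dr'[ej e0] /mapP[q'' q''m ->] /=.
move: q''m; rewrite !inE => /orP[] /eqP -> /=; rewrite degs_cat ci ej; split=> //.
- by case: (c.2) c0.
- by rewrite addrC.
by case: (e.2) e0.
Qed.

Lemma bracket_lift i u : bracket i u -> exists r, lift_of i r u.
Proof.
elim=> {i u} [v|i j u v _ [r [pr dr ->]] _ [r' [pr' dr' ->]]].
  exists [:: (1, [:: v])]; split; first exact: prim_gen.
    by move=> q; rewrite inE => /eqP -> /=; rewrite /degs big_seq1.
  by rewrite ev1.
exists (fcomm r r'); split; last by rewrite ev_fcomm ev_tbr.
  apply: (prim_fcomm (p := odd `|i|%N) (q := odd `|j|%N)) => // q.
    by move/dr => [<- _]; rewrite pw_degs.
  by move/dr' => [<- _]; rewrite pw_degs.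
exact: (fcomm_degs dr dr').
Qed.

Lemma bracket_homog i u : bracket i u -> homog i u.
Proof.
move=> /bracket_lift[r [_ dr ->]]; apply: homog_ev => q /dr[<- _]; exact: homog_tw.
Qed.

Lemma inLie_span u : inLie u -> exists t : seq (K * (int * T)),
  (forall q, q \in t -> bracket q.2.1 q.2.2) /\ u = ev t snd.
Proof.
elim=> {u} [v||k u v _ [t [bt ->]] _ [t' [bt' ->]]|i u _ [t [bt ->]]|].
- exists [:: (1, (hdeg v, tw0 [:: v]))]; split; last by rewrite ev1.
  by move=> q; rewrite inE => /eqP->; apply: bracket_gen.
- by exists [::]; split=> //; rewrite /ev big_nil.
- exists ([seq (k * q.1, q.2) | q <- t] ++ t'); split.
    by move=> q; rewrite mem_cat => /orP[/mapP[q' /bt ? ->]|/bt'].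
  rewrite ev_cat ev_map; congr (_ + _); rewrite /ev scaler_sumr.
  by apply: eq_bigr => q _; rewrite scalerA.
(* Brackets are homogeneous, so projecting to degree [i] keeps those of degree [i]. *)
- exists [seq q <- t | q.2.1 == i]; split.
    by move=> q; rewrite mem_filter => /andP[_ /bt].
  rewrite (ev_lin _ _ (@gpr_linear _ T i)) /ev big_filter [RHS]big_mkcond.
  apply: eq_big_seq => q /bt/bracket_homog qh; rewrite -qh gprE eq_sym.
  by case: eqP => //; rewrite scaler0.
move=> u v _ [t [bt ->]] _ [t' [bt' ->]].
exists (bind t (fun q => [seq (q'.1, (q.1 + q'.2.1, tbr q.2 q'.2.2)) | q' <- t'])); split.
  move=> q /flatten_mapP[c /bt bc /mapP[q' q'm ->]]; case/mapP: q'm => e /bt' be -> /=.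
  exact: bracket_br.
rewrite ev_bind (ev_lin _ _ (tbr_linl _)); apply: eq_ev => c.
by rewrite (ev_lin _ _ (@tbr_linr _ _ _)) ev_map.
Qed.

Lemma Lie_val_linear : linear (fun x : L => val x : T).
Proof. exact: linearP. Qed.

Lemma bracket_hom i u : bracket i u -> exists2 z : hom L, hdeg z = i & val (hval z) = u.
Proof.
move=> bu; pose w : L := exist _ u (asboolT (bracket_inLie bu)).
have wh : homog i w by apply: val_inj; apply: bracket_homog.
by exists (mkhom wh).
Qed.

Lemma Lie_span z : exists t : seq (K * hom L),
  [/\ forall q, q \in t -> hdeg q.2 = hdeg z,
      forall q, q \in t -> bracket (hdeg q.2) (val (hval q.2)) &
      hval z = ev t (@hval K L)].
Proof.
have [t [bt zt]] := inLie_span (asboolW (valP (hval z))).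
have zg : val (hval z) = ev [seq q <- t | q.2.1 == hdeg z] snd.
  have /(congr1 val) /= <- := eqP (valP z).
  rewrite -[LHS]/(gpr (hdeg z) (val (hval z))) zt (ev_lin _ _ (@gpr_linear _ T _)).
  rewrite /ev big_filter [RHS]big_mkcond; apply: eq_big_seq => q /bt/bracket_homog qh.
  by rewrite -qh gprE eq_sym; case: eqP => //; rewrite scaler0.
(* The default [z] is never reached for entries of [t]. *)
pose lf (q : int * T) : hom L :=
  if pselect (exists2 y : hom L, hdeg y = q.1 & val (hval y) = q.2) is left e
  then s2val (cid2 e) else z.
have lfP q : q \in t -> hdeg (lf q.2) = q.2.1 /\ val (hval (lf q.2)) = q.2.2.
  move=> /bt/bracket_hom e; rewrite /lf; case: pselect => // e'.
  by case: (cid2 e').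
exists [seq (q.1, lf q.2) | q <- t & q.2.1 == hdeg z]; split.
- by move=> q /mapP[q']; rewrite mem_filter => /andP[/eqP qz /lfP[qd _]] -> /=; rewrite qd.
- move=> q /mapP[q']; rewrite mem_filter => /andP[/eqP qz qt] -> /=.
  by have [-> ->] := lfP _ qt; apply: bt.
apply: val_inj; rewrite zg (ev_lin _ _ Lie_val_linear) ev_map.
apply: eq_big_seq => q; rewrite mem_filter => /andP[_ /lfP[_ e]].
by rewrite /= e.
Qed.

Lemma lift_exists z : exists r, lift_of (hdeg z) r (val (hval z)).
Proof.
have [t [dt bt ->]] := Lie_span z.
rewrite (ev_lin _ _ Lie_val_linear); elim: t dt bt => [|q t IH] dt bt.
  by exists [::]; split => // [M phi w|]; rewrite /ev !big_nil.
have [|q' q't|r [pr dr er]] := IH; first by move=> q' q't; rewrite dt ?inE ?q't ?orbT.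
  by apply: bt; rewrite inE q't orbT.
have [r' [pr' dr' er']] := bracket_lift (bt q (mem_head _ _)).
exists (scalef q.1 r' ++ r); split.
- by apply: prim_cat => //; apply: prim_scale.
- move=> u; rewrite mem_cat => /orP[/mapP[u' /dr'[d n] ->]|/dr//].
  by rewrite (dt q (mem_head _ _)) in d.
by rewrite ev_cat ev_scalef -er -er' /ev big_cons.
Qed.

Definition lifting z : seq (K * seq (hom V)) := sval (cid (lift_exists z)).

Lemma liftingP z : lift_of (hdeg z) (lifting z) (val (hval z)).
Proof. by rewrite /lifting; case: cid. Qed.

(** A multilinear function factors through T(V), so it does not see the choice of the lift. *)
Lemma ev_lift (M : lmodType K) z (phi : seq (hom V) -> M) : mlin phi ->
  ev (lifting z) phi = wlift phi (val (hval z) : T).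
Proof.
move=> ml; have [_ _ ->] := liftingP z; rewrite (ev_lin _ _ (T_lin ml)).
by apply: eq_ev => c; rewrite T_liftE.
Qed.

End LieElements.

Lemma lbr_homog (K : fieldType) (V : gradedSpace K) (x y : hom (Lie V)) :
  homog (hdeg x + hdeg y) (lbr (hval x) (hval y)).
Proof.
apply: val_inj; rewrite -[LHS]/(gpr (hdeg x + hdeg y) (tbr (val (hval x)) (val (hval y)))).
have [_ dr er] := liftingP x; have [_ dr' er'] := liftingP y.
rewrite -[RHS]/(tbr (val (hval x)) (val (hval y))) er er' ev_tbr -ev_fcomm.
apply: homog_ev => q /(fcomm_degs dr dr')[<- _]; exact: homog_tw.
Qed.

Section LieWords.
Variables (K : fieldType) (V : gradedSpace K).
Local Notation T := (Tge 0 V).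
Local Notation L := (Lie V).
Local Notation pl := (pw (@hp K L)).
Local Notation pw := (pw (@hp K V)).
Local Notation UV := (U (@hp K V)).
Local Notation UL := (U (@hp K L)).
Implicit Types (x y z : hom L) (xs ys s t : seq (hom L)) (c e w : seq (hom V)).

Lemma pw_lift z q : q \in lifting z -> pw q.2 = hp z.
Proof. by have [_ dr _] := liftingP z; move=> /dr[d _]; rewrite pw_degs d. Qed.

(** The product in T(V) of a word of elements of Lie(V), lifted to words. *)
Fixpoint plist xs : seq (K * seq (hom V)) :=
  if xs is x :: xs' then
    bind (lifting x) (fun c => [seq (q.1, c ++ q.2) | q <- plist xs'])
  else [:: (1, [::])].

Definition pev (M : lmodType K) xs (phi : seq (hom V) -> M) : M := ev (plist xs) phi.

Lemma plist_degs xs q : q \in plist xs -> degs q.2 = degs xs.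
Proof.
elim: xs q => [|x xs IH] q /=; first by rewrite inE => /eqP ->; rewrite !degs_nil.
have [_ dr _] := liftingP x; move=> /flatten_mapP[c /dr[dc _] /mapP[q' q'm ->]].
case/mapP: q'm => r /IH rd -> /=.
by rewrite degs_cat degs_cons dc rd.
Qed.

Lemma plist_nil xs q : q \in plist xs -> (q.2 == [::]) = (xs == [::]).
Proof.
case: xs => [|x xs] /=; first by rewrite inE => /eqP->.
have [_ dr _] := liftingP x; move=> /flatten_mapP[c /dr[_ c0] /mapP[q' q'm ->]].
case/mapP: q'm => r _ -> /=; by case: (c.2) c0.
Qed.

Section Module.
Variable M : lmodType K.
Implicit Types (phi : seq (hom V) -> M).

Lemma pev_nil phi : pev [::] phi = phi [::].
Proof. exact: ev1. Qed.

Lemma pev_cons x xs phi : pev (x :: xs) phi = ev (lifting x) (fun c => pev xs (fun w => phi (c ++ w))).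
Proof. by rewrite /pev /= ev_bind; apply: eq_ev => c; rewrite ev_map. Qed.

Lemma eq_pev xs phi phi' : phi =1 phi' -> pev xs phi = pev xs phi'.
Proof. exact: eq_ev. Qed.

Lemma eq_pev_in xs phi phi' :
  (forall w, degs w = degs xs -> (w == [::]) = (xs == [::]) -> phi w = phi' w) ->
  pev xs phi = pev xs phi'.
Proof. by move=> e; apply: eq_ev_in => q qx; rewrite e ?(plist_degs qx) ?(plist_nil qx). Qed.

(** Every lifted letter is primitive, so the coproduct of a product of Lie elements is the coshuffle
    of its factors; primitivity is applied to one factor at a time. *)
Lemma pev_U xs (phi : seq (hom V) -> seq (hom V) -> M) :
  pev xs (fun w => UV w phi) = UL xs (fun a b => pev a (fun u => pev b (phi u))).
Proof.
elim: xs phi => [|x xs IH] phi; first by rewrite pev_nil !U_nil !pev_nil.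
have [px _ _] := liftingP x.
rewrite pev_cons ev_ev.
transitivity (pev xs (fun w => ev (lifting x) (fun c => UV w (fun a b =>
    phi (c ++ a) b + (-1) ^+ (hp x && pw a) *: phi a (c ++ b))))).
  apply: eq_ev => w; rewrite px; apply: eq_ev_in => q /pw_lift qx.
  by apply: eq_U => a b; rewrite qx.
rewrite [LHS]ev_ev U_cons -UD.
transitivity (ev (lifting x) (fun c => UL xs (fun a b => pev a (fun u => pev b (fun v =>
   phi (c ++ u) v + (-1) ^+ (hp x && pl a) *: phi u (c ++ v)))))).
  apply: eq_ev => c; rewrite -/(pev _ _) IH; apply: eq_U => a b.
  apply: eq_pev_in => u ua _; apply: eq_pev => v.
  by rewrite !pw_degs ua.
rewrite -U_ev; apply: eq_U => a b.
have -> : pev a (fun u => pev (x :: b) (phi u)) =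
    ev (lifting x) (fun c => pev a (fun u => pev b (fun v => phi u (c ++ v)))).
  rewrite [RHS]ev_ev; apply: eq_pev => u; exact: pev_cons.
rewrite pev_cons -evZ -evD; apply: eq_ev => c; rewrite /pev -evZ -evD.
by apply: eq_ev => u; rewrite -evZ -evD.
Qed.

Lemma pev_mlin phi : mlin phi -> mlin (fun xs => pev xs phi).
Proof.
move=> + s t a x y z xz yz e; elim: s phi => [|u s IH] phi ml /=.
  have mlt : mlin (fun c => pev t (fun w => phi (c ++ w))).
    move=> s' t' b x' y' z' h1 h2 h3; rewrite /pev -evZ -evD; apply: eq_ev => w.
    exact: (mlin_catr w ml).
  by rewrite !pev_cons !ev_lift // e Lie_val_linear T_lin.
rewrite !pev_cons -evZ -evD; apply: eq_ev => c; apply: IH; exact: mlin_catl.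
Qed.

End Module.

Lemma hval_lin_slot a (x y z : hom V) :
  hval z = a *: hval x + hval y -> hdeg x = hdeg z -> hdeg y = hdeg z ->
  hval (lin z) = a *: hval (lin x) + hval (lin y).
Proof.
move=> e xz yz; apply: val_inj; rewrite Lie_val_linear /=.
exact: (@mlin_tw K 0 V [::] [::] a x y z).
Qed.

Lemma mlin_map_lin (M : lmodType K) (phi : seq (hom L) -> M) :
  mlin phi -> mlin (fun vs => phi (map (@lin K V) vs)).
Proof.
move=> ml s t a x y z xz yz e; rewrite !map_cat /=; apply: ml => //.
exact: hval_lin_slot.
Qed.

(** The chosen lift of a generator may differ from the one-letter word, but multilinear functions
    agree on the two. *)
Lemma pev_lin (M : lmodType K) (phi : seq (hom V) -> M) vs : mlin phi ->
  pev (map (@lin K V) vs) phi = phi vs.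
Proof.
elim: vs phi => [|v vs IH] phi ml; first exact: pev_nil.
rewrite /= pev_cons.
rewrite [LHS](eq_ev _ (fun c => IH _ (mlin_catl c ml))).
by rewrite (ev_lift _ (mlin_catr vs ml)) T_liftE //; apply: mlin_catr.
Qed.

End LieWords.

(** * The inverse of Phi *)

Section Enveloping.
Variables (K : fieldType) (V : gradedSpace K).
Local Notation T := (Tge 0 V).
Local Notation L := (Lie V).
Local Notation env := (env_rel (@lbr K V)).
Local Notation uw := (wcl env).
Local Notation pw := (pw (@hp K V)).
Implicit Types (x y z : hom L) (xs ys s t : seq (hom L)) (vs : seq (hom V)).

Lemma mlin_uw : mlin uw.
Proof. by apply: mlin_wcl; apply: env_tensor. Qed.

Lemma uw_br s t x y z : hdeg z = hdeg x + hdeg y -> hval z = lbr (hval x) (hval y) ->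
  uw (s ++ x :: y :: t) = (-1) ^+ (hp x && hp y) *: uw (s ++ y :: x :: t) + uw (s ++ z :: t).
Proof.
move=> dz ez; have /eqP := qcl_rel (env_br s t dz ez).
by rewrite !linearB linearZ_LR /= -addrA -opprD subr_eq0 exprz_hdegM => /eqP.
Qed.

(** Compatibility with the relations x y = (-1)^(|x||y|) y x + [x, y] of U(Lie(V)). *)
Definition envf (M : lmodType K) (phi : seq (hom L) -> M) := forall s t x y z,
  hdeg z = hdeg x + hdeg y -> hval z = lbr (hval x) (hval y) ->
  phi (s ++ x :: y :: t) = (-1) ^+ (hp x && hp y) *: phi (s ++ y :: x :: t) + phi (s ++ z :: t).

Lemma env_lift (M : lmodType K) (phi : seq (hom L) -> M) : mlin phi -> envf phi ->
  forall r, env r -> fwlift phi r = 0.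
Proof.
move=> ml ph r [{}r /(mlin_tensor_rel ml) // | s t x y z dz ez].
rewrite !linearB linearZ_LR /= !fwlift_fword /= (ph s t x y z) // exprz_hdegM.
by rewrite -addrA -opprD subrr.
Qed.

Let envl s r : env r -> fwlift (fun t => uw (s ++ t)) r = 0.
Proof.
apply: env_lift; first by apply: mlin_catl; apply: mlin_uw.
by move=> s' t x y z dz ez; rewrite !catA; apply: uw_br.
Qed.

Let envr t r : env r -> fwlift (fun s => uw (s ++ t)) r = 0.
Proof.
apply: env_lift; first by apply: mlin_catr; apply: mlin_uw.
by move=> s' t' x y z dz ez; rewrite -!catA; apply: uw_br.
Qed.

Lemma uprodE xs : uprod (@lbr K V) xs = uw xs.
Proof.
elim: xs => [|x xs IH] //.
by rewrite -[LHS]/(wmul (uw [:: x]) (uprod _ xs)) IH (wmulE envl envr).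
Qed.

Lemma Phi_mlin : mlin (fun vs => uprod (@lbr K V) (map (@lin K V) vs)).
Proof.
have -> : (fun vs => uprod (@lbr K V) (map (@lin K V) vs)) =
    (fun vs => uw (map (@lin K V) vs)) by apply: funext => vs; rewrite uprodE.
exact: mlin_map_lin mlin_uw.
Qed.

Lemma Phi_linear m : linear (@Phi K m V).
Proof. apply: T_lin; exact: Phi_mlin. Qed.

Lemma PhiE m vs : (m <= size vs)%N -> Phi (tw m vs) = uw (map (@lin K V) vs).
Proof. by move=> mv; rewrite /Phi T_liftE ?uprodE //; apply: Phi_mlin. Qed.

(** The unit goes to [tw 1 [::] = 0], so this map inverts [Phi] on the augmentation ideal. *)
Definition Lambda : ULie V -> Tbar V := wlift (fun ys => pev ys (@tw K 1 V)).

Lemma lbr_val (x y : L) : val (lbr x y) = tbr (val x) (val y) :> T.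
Proof. by []. Qed.

(** For multilinear [phi], the lift of the single letter [x, y] may be replaced by the commutator of
    the lifts of x and y. *)
Lemma envf_pev (M : lmodType K) (phi : seq (hom V) -> M) : mlin phi ->
  envf (fun ys => pev ys phi).
Proof.
move=> + s t x y z dz ez; elim: s phi => [|u s IH] phi ml /=; last first.
  rewrite !pev_cons -evZ -evD; apply: eq_ev => c; apply: IH; exact: mlin_catl.
have mlt : mlin (fun c => pev t (fun w => phi (c ++ w))).
  move=> s' t' b x' y' z' h1 h2 h3; rewrite /pev -evZ -evD; apply: eq_ev => w.
  exact: (mlin_catr w ml).
have E x' y' : pev (x' :: y' :: t) phi = ev (lifting x') (fun c => ev (lifting y') (fun e =>
    pev t (fun w => phi ((c ++ e) ++ w)))).
  rewrite pev_cons; apply: eq_ev => c; rewrite pev_cons; apply: eq_ev => e.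
  by apply: eq_pev => w; rewrite catA.
rewrite !E pev_cons (ev_lift _ mlt) ez lbr_val.
have [_ _ ->] := liftingP x; have [_ _ ->] := liftingP y.
rewrite ev_tbr (ev_lin _ _ (T_lin mlt)) [X in _ *: X]ev_ev -evZ -evD.
apply: eq_ev_in => c /pw_lift cx; rewrite (ev_lin _ _ (T_lin mlt)) -evZ -evD.
apply: eq_ev_in => e /pw_lift ey; rewrite cx ey -scaleNr [tw 0 _ + _]addrC (T_lin mlt).
by rewrite !T_liftE // scaleNr addrA subrr add0r.
Qed.

Lemma Lambda_rel r : env r -> fwlift (fun ys => pev ys (@tw K 1 V)) r = 0.
Proof. by apply: env_lift; [apply: pev_mlin|apply: envf_pev]; apply: mlin_tw. Qed.

Lemma Lambda_linear : linear Lambda.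
Proof. exact: wlift_linear Lambda_rel. Qed.

Lemma LambdaE ys : Lambda (uw ys) = pev ys (@tw K 1 V).
Proof. exact: (wliftE Lambda_rel). Qed.

Lemma Phi_lin1 (u : Tbar V) : Lambda (Phi u) = u.
Proof.
move: u; apply: word_ext => [||vs vs0].
- exact: (lin_comp (@Phi_linear 1) Lambda_linear).
- by [].
rewrite -/(tw 1 vs) PhiE // LambdaE pev_lin //; exact: mlin_tw.
Qed.

(** In U(Lie(V)) a bracket expanded into products of generators equals the bracket as a single
    letter: the relation [x, y] = xy - (-1)^(|x||y|) yx unfolds one bracket at a time, inside
    arbitrary contexts [s] and [t]. This gives [Phi] after [Lambda]. *)
Lemma bracket_uw i u z s t : bracket i u -> hdeg z = i -> val (hval z) = u ->
  wlift (fun c => uw (s ++ map (@lin K V) c ++ t)) u = uw (s ++ z :: t).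
Proof.
have ml s' t' : mlin (fun c => uw (s' ++ map (@lin K V) c ++ t')).
  apply: (mlin_map_lin (phi := fun c => uw (s' ++ c ++ t'))).
  exact: (mlin_catr t' (mlin_catl s' mlin_uw)).
pose good (x : hom L) := forall s t,
  wlift (fun c => uw (s ++ map (@lin K V) c ++ t)) (val (hval x) : T) = uw (s ++ x :: t).
move=> bu; elim: bu z s t => {i u} [v|i j u v bu IHu bv IHv] z s t zi zu.
  rewrite T_liftE //=; congr (wcl _ (s ++ _ :: t)).
  by apply: hom_inj => //; apply: val_inj.
have [x xi xu] := bracket_hom bu; have [y yj yv] := bracket_hom bv.
have ez : hval z = lbr (hval x) (hval y) by apply: val_inj; rewrite zu lbr_val xu yv.
have gx : good x by move=> s' t'; rewrite xu; apply: IHu.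
have gy : good y by move=> s' t'; rewrite yv; apply: IHv.
have E x' y' : good x' -> good y' -> ev (lifting x') (fun c => ev (lifting y') (fun e =>
    uw (s ++ map (@lin K V) (c ++ e) ++ t))) = uw (s ++ x' :: y' :: t).
  move=> gx' gy'; rewrite -gx' -ev_lift //; apply: eq_ev => c.
  rewrite catA -gy' -ev_lift //; apply: eq_ev => e; by rewrite map_cat !catA.
have dz : hdeg z = hdeg x + hdeg y by rewrite zi xi yj.
have := uw_br s t dz ez; rewrite -!E // => /eqP.
rewrite addrC -subr_eq => /eqP <-.
rewrite -xu -yv; have [_ _ ->] := liftingP x; have [_ _ ->] := liftingP y.
rewrite ev_tbr (ev_lin _ _ (T_lin (ml s t))) [X in _ - _ *: X]ev_ev -scaleNr -evZ -evD.
apply: eq_ev_in => c /pw_lift cx; rewrite (ev_lin _ _ (T_lin (ml s t))) -evZ -evD.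
apply: eq_ev_in => e /pw_lift ey; rewrite cx ey -scaleNr [tw 0 _ + _]addrC (T_lin (ml s t)).
by rewrite !T_liftE // addrC.
Qed.

Lemma ev_lift_uw z s t :
  ev (lifting z) (fun c => uw (s ++ map (@lin K V) c ++ t)) = uw (s ++ z :: t).
Proof.
have ml : mlin (fun c => uw (s ++ map (@lin K V) c ++ t)).
  apply: (mlin_map_lin (phi := fun c => uw (s ++ c ++ t))).
  exact: (mlin_catr t (mlin_catl s mlin_uw)).
have [r [dr br er]] := Lie_span z.
have [l ll le] := mlin_slot s t (hdeg z) mlin_uw.
rewrite ev_lift // le // er (ev_lin _ _ (@Lie_val_linear K V)) (ev_lin _ _ (T_lin ml)).
rewrite (ev_lin _ _ ll); apply: eq_ev_in => q qr.
by rewrite -le ?dr //; apply: (bracket_uw s t (br q qr)); rewrite ?dr.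
Qed.

Lemma pev_uw s ys : pev ys (fun w => uw (s ++ map (@lin K V) w)) = uw (s ++ ys).
Proof.
elim: ys s => [|y ys IH] s; first by rewrite pev_nil.
rewrite pev_cons -ev_lift_uw; apply: eq_ev => c.
by rewrite catA -IH; apply: eq_pev => w; rewrite map_cat catA.
Qed.

Lemma Phi_Lambda ys : ys != [::] -> Phi (Lambda (uw ys)) = uw ys.
Proof.
move=> y0; rewrite LambdaE /pev (ev_lin _ _ (@Phi_linear 1)) -[RHS](pev_uw [::]).
by apply: eq_pev_in => -[|v w] _; rewrite (negbTE y0) // PhiE.
Qed.

End Enveloping.

(** * The Poincare-Birkhoff-Witt isomorphism *)

Section Retraction.
Variables (K : fieldType) (M : lmodType K) (P : M -> Prop).
Hypotheses (P0 : P 0) (Plin : forall a x y, P x -> P y -> P (a *: x + y)).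

Lemma spanned_sub (A B : M -> Prop) x : (forall y, A y -> B y) -> spanned A x -> spanned B x.
Proof.
move=> AB; elim=> [|a r y Ar _ IH]; first exact: spanned0.
by apply: spannedD => //; apply: AB.
Qed.

(** A maximal set whose span meets [P] trivially spans a complement of [P]. *)
Lemma complement_exists : exists B : M -> Prop,
  (forall b, spanned B b -> P b -> b = 0) /\
  (forall t, exists2 l, P l & spanned B (t - l)).
Proof.
pose good (B : M -> Prop) := forall b, spanned B b -> P b -> b = 0.
have [|B [gB maxB]] := @classical_sets.Zorn_bigcup M good.
  move=> F Fg tot b sb Pb.
  (* A combination involves finitely many elements, so one member of the chain contains them all;
     the first alternative covers the empty combination. *)
  have : b = 0 \/ exists2 X, F X & spanned X b.
    elim: sb {Pb} => [|a r x [X FX Xr] _ [->|[Y FY sY]]]; first by left.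
      by right; exists X => //; apply: spannedD => //; apply: spanned0.
    right; have [XY|YX] := tot _ _ FX FY.
      by exists Y => //; apply: spannedD => //; apply: XY.
    by exists X => //; apply: spannedD => //; apply: spanned_sub sY.
  by case=> // -[X FX sX]; apply: (Fg X FX).
exists B; split=> // t; apply: contrapT => nt.
have Bt : ~ B t.
  move=> Bt; apply: nt; exists 0 => //; rewrite subr0; exact: spanned_rel.
apply: (maxB (fun x => B x \/ x = t)).
  by split=> [x Bx|sub]; [left|apply: Bt; apply: sub; right].
move=> b sb Pb.
have [c [u [su bu]]] : exists c u, spanned B u /\ b = c *: t + u.
  elim: sb {Pb} => [|a r x [Br|->] _ [c [u [su ->]]]].
  - by exists 0, 0; split; [apply: spanned0|rewrite scale0r addr0].
  - exists c, (a *: r + u); split; first exact: spannedD.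
    by rewrite addrCA.
  by exists (a + c), u; split=> //; rewrite scalerDl addrA.
have [c0|c0] := eqVneq c 0.
  by apply: gB => //; rewrite bu c0 scale0r add0r.
(* For [c] nonzero, [t - c^-1 *: b] lies in the span of [B], a decomposition of [t] that was
   excluded. *)
case: nt; exists (c^-1 *: b).
  by rewrite -[_ *: b]addr0; apply: Plin.
rewrite bu scalerDr scalerA mulVf // scale1r opprD addrA subrr add0r -scaleNr.
exact: spanned_scale.
Qed.

(** The component in [P] is unique, which makes its choice linear. *)
Lemma retraction_exists : exists r : M -> M,
  [/\ linear r, forall x, P (r x) & forall x, P x -> r x = x].
Proof.
have [B [B0 BP]] := complement_exists.
pose r t := s2val (cid2 (BP t)).
have rP t : P (r t) by rewrite /r; case: (cid2 _).
have rB t : spanned B (t - r t) by rewrite /r; case: (cid2 _).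
have uniq t l : P l -> spanned B (t - l) -> r t = l.
  move=> Pl Bl; apply/eqP; rewrite -subr_eq0; apply/eqP; apply: B0.
    have -> : r t - l = (t - l) + (-1) *: (t - r t).
      by rewrite scaleN1r opprB [RHS]addrC subrKA.
    by apply: spanned_add => //; apply: spanned_scale.
  by rewrite addrC -scaleN1r; apply: Plin.
exists r; split=> // [a x y|x Px]; apply: uniq => //; first exact: Plin.
  rewrite opprD addrACA -scalerBr; apply: spanned_add => //; exact: spanned_scale.
by rewrite subrr; apply: spanned0.
Qed.

End Retraction.

(** * Psi as symmetrisation, and its surjectivity *)

Section Symmetrization.
Variables (K : fieldType) (V : gradedSpace K).
Hypothesis char0 : [pchar K] =i pred0.
Local Notation tw1 := (@tw K 1 V).
Local Notation L := (Lie V).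
Local Notation sw1 := (@sw K 1 L).
Local Notation env := (env_rel (@lbr K V)).
Local Notation uw := (wcl env).
Local Notation UV := (U (@hp K V)).
Local Notation UL := (U (@hp K L)).
Local Notation avgL := (avg (@hp K L)).
Implicit Types (x y z : hom L) (xs ys s t : seq (hom L)) (c e w : seq (hom V)).

Lemma avg_mlin (M : lmodType K) (phi : seq (hom L) -> M) : mlin phi ->
  mlin (fun xs => avgL xs phi).
Proof.
have sn n : forall phi : seq (hom L) -> M, mlin phi ->
    mlin (fun xs => ev (sl K (@hp K L) n xs) phi).
  elim: n => [|n IH] f ml.
    by move=> [|? ?] t c x y z *; rewrite /ev !big_nil scaler0 addr0.
  move=> s t c x y z xz yz e; rewrite !Sn_rec scalerA mulrC -scalerA -scalerDr.
  congr (_ *: _); apply: (U_mlin (phi := fun a b =>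
     if a is [:: x] then ev (sl K (@hp K L) n b) (fun u => f (x :: u)) else 0)) xz yz e => [b|a].
    move=> [|? [|? ?]] [|? ?] c' x' y' z' xz yz e; rewrite ?scaler0 ?addr0 //=.
    by rewrite -evZ -evD; apply: eq_ev => u; apply: (ml [::] u).
  case: a => [|u [|u' a]]; try by move=> *; rewrite scaler0 addr0.
  by apply: IH; apply: mlin_cons.
move=> ml s t c x y z; have := sn (size (s ++ z :: t)) phi ml s t c x y z.
by rewrite /avg !size_cat.
Qed.

Lemma Psi_lift m : @Psi K m V = wlift (fun xs => avgL xs uw).
Proof.
rewrite /Psi; congr (@wlift _ _ _ _ _ _); apply: funext => xs.
rewrite -(sum_perms xs uw char0); congr (_ *: _); apply: eq_bigr => s _.
by rewrite uprodE.
Qed.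

Lemma Psi_linear m : linear (@Psi K m V).
Proof.
rewrite Psi_lift; apply: S_lin; first by apply: avg_mlin; apply: mlin_uw.
exact: avg_symf.
Qed.

Lemma PsiE xs : xs != [::] -> Psi (sw1 xs) = avgL xs uw.
Proof.
move=> x0; rewrite Psi_lift S_liftE //; first by apply: avg_mlin; apply: mlin_uw.
  exact: avg_symf.
by case: xs x0.
Qed.

(** Written with [Lambda], which is linear by construction, instead of chosen preimages under
    [Phi]. *)
Definition Theta (x : Sbar L) : Tbar V := Lambda (Psi x).

Lemma Theta_linear : linear Theta.
Proof. exact: (lin_comp (@Psi_linear 1) (@Lambda_linear K V)). Qed.

(** The value of a function of words on the symmetrised product of [xs]. *)
Definition Th (M : lmodType K) xs (psi : seq (hom V) -> M) : M :=
  avgL xs (fun ys => pev ys psi).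

Lemma ThetaE xs : Theta (sw1 xs) = Th xs tw1.
Proof.
have [->|x0] := eqVneq xs [::].
  by rewrite /Th sw1_nil avg_nil pev_nil tw1_nil lin0 //; apply: Theta_linear.
rewrite /Theta PsiE // (ev_lin _ _ (@Lambda_linear K V)); apply: eq_ev => ys.
exact: LambdaE.
Qed.

(** On the reduced part [Psi] takes values in combinations of nonempty products, where [Phi] after
    [Lambda] is the identity. *)
Lemma Phi_Theta (v : Sbar L) : Phi (Theta v) = Psi v.
Proof.
move: v; apply: word_ext => [||xs xs0].
- exact: (lin_comp Theta_linear (@Phi_linear K V 1)).
- exact: Psi_linear.
have x0 : xs != [::] by case: xs xs0.
rewrite -/(sw1 xs) PsiE // /Theta PsiE //.
rewrite (ev_lin _ _ (lin_comp (@Lambda_linear K V) (@Phi_linear K V 1))).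
apply: (@eq_avg_in _ _ _ _ xs (fun v => Phi (Lambda (uw v)))) => v vx.
by rewrite Phi_Lambda // -size_eq0 (perm_size vx) size_eq0.
Qed.

(** Modulo the image of Psi, words of a given length are graded symmetric by
    induction on the length, hence equal to their own symmetrisation. *)
Lemma Psi_surj ys : ys != [::] -> exists x : Sbar L, uw ys = Psi x.
Proof.
pose R (u : ULie V) := exists x : Sbar L, u = Psi x.
have RS u : spanned R u -> R u.
  elim=> [|a _ v [x ->] _ [y ->]].
    by exists 0; rewrite lin0 //; apply: Psi_linear.
  by exists (a *: x + y); apply: esym; apply: (Psi_linear (m := 1)).
have R0 u : qcl R u = 0 -> R u.
  rewrite -(lin0 (@qcl_is_linear _ _ R)) => /eqmodP/asboolP.
  by rewrite subr0; apply: RS.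
move=> y0; apply: R0.
elim: {ys}(size ys) {-2}ys (leqnn (size ys)) y0 => [|n IH] ys.
  by rewrite leqn0 => /nilP->.
move=> yn y0; pose phi s := qcl R (uw s) : quot R.
have -> : qcl R (uw ys) = avgL ys phi.
  rewrite (avg_sym char0 (n := size ys)) // => s x y t st.
  rewrite /phi (@uw_br _ _ s t x y (mkhom (lbr_homog x y))) // linearD linearZ_LR /=.
  (* The bracket term has one letter fewer, hence is zero modulo the image of [Psi]. *)
  rewrite [X in _ + X]IH ?addr0 //; last by case: (s).
  by rewrite -ltnS (leq_trans _ yn) // -st size_cat /= addnS.
have -> : avgL ys phi = qcl R (avgL ys uw).
  by rewrite [RHS](ev_lin _ _ (@qcl_is_linear _ _ R)).
rewrite -PsiE //.
by apply: qcl_rel; exists (sw1 ys).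
Qed.

(** As [Lambda] undoes [Phi], it suffices that [Psi] reaches the product of generators to which
    [Phi] sends a word. *)
Lemma Theta_surj (u : Tbar V) : exists v, Theta v = u.
Proof.
have [t [/allP tm ->]] := wordMod_span u.
elim: t tm => [|q t IH] tm; first by exists 0; rewrite big_nil lin0 //; apply: Theta_linear.
have [|x ex] := IH; first by move=> p pt; apply: tm; rewrite inE pt orbT.
have q0 : q.2 != [::] by have := tm q (mem_head _ _); case: (q.2).
have [|y ey] := @Psi_surj (map (@lin K V) q.2); first by case: (q.2) q0.
exists (q.1 *: y + x); rewrite Theta_linear big_cons ex /Theta -ey -(PhiE (m := 1)).
  by rewrite Phi_lin1.
by case: (q.2) q0.
Qed.

(** Composes two compatibilities with coproducts: that of multiplication, from primitivity of the
    letters, and that of symmetrisation. *)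
Lemma Th_U (M : lmodType K) xs (phi : seq (hom V) -> seq (hom V) -> M) :
  Th xs (fun w => UV w phi) = UL xs (fun a b => Th a (fun u => Th b (phi u))).
Proof.
rewrite /Th (eq_avg _ _ (fun ys => pev_U ys phi)) (avg_U _ char0).
apply: eq_U => a b; apply: eq_avg => a'; exact: ev_ev.
Qed.

Lemma Th_nil (M : lmodType K) (psi : seq (hom V) -> M) : Th [::] psi = psi [::].
Proof. by rewrite /Th avg_nil pev_nil. Qed.

Lemma Th0 (M : lmodType K) xs : Th xs (fun=> 0 : M) = 0.
Proof.
transitivity (avgL xs (fun=> 0 : M)); last exact: ev0.
by apply: eq_avg => ys; apply: ev0.
Qed.

Lemma Th_single (M : lmodType K) x (psi : seq (hom V) -> M) :
  Th [:: x] psi = ev (lifting x) psi.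
Proof.
rewrite /Th avg_single pev_cons; apply: eq_ev => c.
by rewrite pev_nil cats0.
Qed.

Lemma eq_Th_in (M : lmodType K) xs (psi psi' : seq (hom V) -> M) :
  (forall w, degs w = degs xs -> (w == [::]) = (xs == [::]) -> psi w = psi' w) ->
  Th xs psi = Th xs psi'.
Proof.
move=> e; apply: eq_avg_in => ys yx; apply: eq_pev_in => w; rewrite (degs_perm yx).
by rewrite -[ys == _]size_eq0 (perm_size yx) size_eq0; apply: e.
Qed.

Lemma Th_lin (M N : lmodType K) (f : M -> N) xs psi : linear f ->
  f (Th xs psi) = Th xs (fun w => f (psi w)).
Proof.
move=> lf; rewrite /Th (ev_lin _ _ lf); apply: eq_ev => ys; exact: ev_lin.
Qed.

End Symmetrization.

(** * Injectivity of Theta *)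

Section Injectivity.
Variables (K : fieldType) (V : gradedSpace K).
Hypothesis char0 : [pchar K] =i pred0.
Local Notation T := (Tge 0 V).
Local Notation tw0 := (@tw K 0 V).
Local Notation tw1 := (@tw K 1 V).
Local Notation L := (Lie V).
Local Notation sw1 := (@sw K 1 L).
Local Notation UV := (U (@hp K V)).
Implicit Types (x y z : hom L) (xs ys s t : seq (hom L)) (c e w : seq (hom V)).

Lemma Lie_retraction : exists2 r : T -> L, linear r & forall x : L, r (val x) = x.
Proof.
have [|a u v|r [rl rP rK]] := @retraction_exists K T (@inLie K V).
- exact: inLie0.
- exact: inLieP.
exists (fun u => exist _ (r u) (asboolT (rP u)) : L) => [a u v|x].
  by apply: val_inj; rewrite /= rl.
by apply: val_inj; rewrite /= rK //; apply: (asboolW (valP x)).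
Qed.

Definition retr : T -> L := s2val (cid2 Lie_retraction).

Lemma retr_linear : linear retr.
Proof. by rewrite /retr; case: cid2. Qed.

Lemma retrK (x : L) : retr (val x) = x.
Proof. by rewrite /retr; case: cid2. Qed.

(** The retraction need not be graded, so one projects to the degree of [c]. *)
Definition rho c : hom L := hpr (degs c) (retr (tw0 c)).

Lemma mlin_rho (M : lmodType K) s t (phi : seq (hom L) -> M) : mlin phi ->
  mlin (fun c => phi (s ++ rho c :: t)).
Proof.
move=> ml s' t' a x y z xz yz e.
have dx : degs (s' ++ x :: t') = degs (s' ++ z :: t') by rewrite !degs_cat !degs_cons xz.
have dy : degs (s' ++ y :: t') = degs (s' ++ z :: t') by rewrite !degs_cat !degs_cons yz.
apply: ml => //; rewrite /rho dx dy.
rewrite -[hval _]/(gpr _ _) (mlin_tw 0 s' t' xz yz e) retr_linear; exact: gpr_linear.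
Qed.

(** Summed over a lift of [x], [rho] reassembles the retraction of [x], which is [x]; all words of
    the lift have the degree of [x], so the projection changes nothing. *)
Lemma ev_lift_rho (M : lmodType K) x s t (phi : seq (hom L) -> M) : mlin phi ->
  ev (lifting x) (fun c => phi (s ++ rho c :: t)) = phi (s ++ x :: t).
Proof.
move=> ml; have [l ll le] := mlin_slot s t (hdeg x) ml.
have [_ dr er] := liftingP x.
rewrite le // -[in RHS](eqP (valP x) : gpr (hdeg x) (hval x) = hval x) -[in RHS](retrK (hval x)).
rewrite er (ev_lin _ _ retr_linear) (ev_lin _ _ (@gpr_linear _ L (hdeg x))) (ev_lin _ _ ll).
by apply: eq_ev_in => q /dr[qx _]; rewrite le -qx.
Qed.

(** The [p]-fold convolution power of the projection of T(V) onto Lie(V),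
    with values in words: on the symmetrised product of [n] elements it vanishes
    for [n < p] and is [p`!] times the identity for [n = p]. *)
Fixpoint rl p w : seq (K * seq (hom L)) :=
  if p is p'.+1 then
    bind (unsh K (@hp K V) w) (fun q => if q.1 is [::] then [::] else
      [seq (r.1, rho q.1 :: r.2) | r <- rl p' q.2])
  else if w is [::] then [:: (1, [::])] else [::].

Section Module.
Variable M : lmodType K.
Implicit Types phi : seq (hom L) -> M.

Lemma rlS p w phi : ev (rl p.+1 w) phi =
  UV w (fun a b => if a is [::] then 0 else ev (rl p b) (fun ys => phi (rho a :: ys))).
Proof.
rewrite /= ev_bind; apply: eq_ev => -[[|v a] b]; rewrite /ev ?big_nil //= big_map.
by [].
Qed.

Lemma rl_mlin p phi : mlin phi -> mlin (fun w => ev (rl p w) phi).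
Proof.
elim: p phi => [|p IH] phi ml.
  by move=> [|? ?] t a x y z *; rewrite /ev !big_nil scaler0 addr0.
move=> s t k x y z xz yz e; rewrite !rlS.
apply: (U_mlin (phi := fun a b => if a is [::] then 0 else
   ev (rl p b) (fun ys => phi (rho a :: ys)))) xz yz e => [b|a].
  move=> s' t' k' x' y' z' xz yz e.
  have ne v : (if s' ++ v :: t' is [::] then 0 else
      ev (rl p b) (fun ys => phi (rho (s' ++ v :: t') :: ys))) =
      ev (rl p b) (fun ys => phi (rho (s' ++ v :: t') :: ys)) by case: (s').
  rewrite !ne -evZ -evD; apply: eq_ev => ys.
  exact: (mlin_rho [::] ys ml).
case: a => [|v a]; first by move=> *; rewrite scaler0 addr0.
by apply: IH; apply: mlin_cons.
Qed.

(** The first convolution factor takes a nonempty part [a] of [xs]. By induction the others vanish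
    unless they receive exactly [p] letters, which leaves one letter in [a], and the retraction
    returns it. Symmetry of [phi] makes the [p.+1] choices of that letter equal. *)
Lemma Th_rl p xs phi : mlin phi -> symf (@hp K L) phi -> (size xs <= p)%N ->
  Th xs (fun w => ev (rl p w) phi) = if size xs == p then p`!%:R *: phi xs else 0.
Proof.
elim: p xs phi => [|p IH] xs phi ml sy.
  by rewrite leqn0 => /nilP->; rewrite Th_nil /= /ev big_seq1 !scale1r.
move=> xp; pose G a b := if a is [::] then 0 else
  ev (rl p b) (fun ys => phi (rho a :: ys)).
have -> : Th xs (fun w => ev (rl p.+1 w) phi) = Th xs (fun w => UV w G).
  by apply: eq_Th_in => w _ _; apply: rlS.
rewrite (Th_U char0).
transitivity (pick1 (@hp K L) xs (fun x b => if size b == p then p`!%:R *: phi (x :: b) else 0)).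
  apply: eq_U_in => a b /perm_size; rewrite size_cat => ab.
  case: a ab => [|x a] ab.
    by rewrite Th_nil; apply: Th0.
  have bp : (size b <= p)%N.
    by rewrite -ltnS (leq_trans _ xp) // -ab /= addSn ltnS leq_addl.
  transitivity (Th (x :: a) (fun u => if size b == p then p`!%:R *: phi (rho u :: b) else 0)).
    apply: eq_Th_in => -[|v u] _ // _.
    apply: (IH b (fun ys => phi (rho (v :: u) :: ys))) => //; first exact: mlin_cons.
    by move=> s y z t; apply: (sy (_ :: s)).
  case: a ab => [|y a] ab.
    rewrite Th_single; case: eqP => _; last exact: ev0.
    by rewrite evZ (ev_lift_rho x [::] b ml).
  (* Two or more letters in [a] would leave fewer than [p] in [b]. *)
  case: eqP => [bp'|_].
    by move: xp; rewrite -ab /= bp' !addSn !ltnS addnC -ltn_subRL subnn.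
  exact: Th0.
have [xs_p|xs_p] := eqVneq (size xs) p.+1.
  transitivity (pick1 (@hp K L) xs (fun x b => p`!%:R *: phi (x :: b))).
    apply: eq_pick1_in => x b /perm_size; rewrite xs_p => -[->].
    by rewrite eqxx.
  have -> : pick1 (@hp K L) xs (fun x b => p`!%:R *: phi (x :: b)) =
      p`!%:R *: pick1 (@hp K L) xs (fun x b => phi (x :: b)).
    by rewrite /pick1 -UZ; apply: eq_U => -[|? [|? ?]] ?; rewrite ?scaler0.
  rewrite (@pick1_sym _ _ _ _ p.+1) //.
  by rewrite scalerA -natrM mulnC -factS.
rewrite -[RHS](U0 (@hp K L) M xs); apply: eq_U_in => -[|x [|y a]] b // /perm_size /= xb.
case: eqP => // bp; by rewrite -xb bp eqxx in xs_p.
Qed.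

End Module.

(** Induction on a bound for the word lengths: the convolution power of top order kills all shorter
    words and is a nonzero multiple of the identity on the longest, so their contribution to [v] is
    zero and the bound drops. *)
Lemma Theta_inj (v : Sbar L) : Theta v = 0 -> v = 0.
Proof.
have [t [_ ->]] := wordMod_span v => {v}.
rewrite -/(ev t sw1).
have : forall q, q \in t -> (size q.2 <= \max_(q <- t) size q.2)%N.
  by move=> q qt; exact: (@leq_bigmax_seq _ t xpredT (fun q => size q.2) q qt isT).
move: (\max_(q <- t) size q.2)%N => m; elim: m t => [|m IH] t tm.
  move=> _; rewrite /ev big_seq big1 // => q /tm.
  by rewrite leqn0 => /nilP ->; rewrite sw1_nil scaler0.
move=> Tv0; pose t1 := [seq q <- t | size q.2 == m.+1].
pose t2 := [seq q <- t | size q.2 != m.+1].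
have tE : ev t sw1 = ev t1 sw1 + ev t2 sw1.
  by rewrite /ev /t1 /t2 !big_filter (bigID (fun q => size q.2 == m.+1)).
have mlr := rl_mlin m.+1 (@mlin_sw K 1 L).
have r0 : ev (rl m.+1 [::]) sw1 = 0 by rewrite rlS U_nil.
have t10 : ev t1 sw1 = 0.
  have : wlift (fun w => ev (rl m.+1 w) sw1) (Theta (ev t sw1)) = 0.
    by rewrite Tv0 lin0 //; apply: (T_lin mlr).
  rewrite (ev_lin _ _ (Theta_linear char0)) (ev_lin _ _ (T_lin mlr)).
  move/(congr1 (fun v : Sbar L => ((m.+1)`!%:R)^-1 *: v)); rewrite scaler0 => e.
  rewrite -[RHS]e /t1 /ev big_filter big_mkcond scaler_sumr; apply: eq_big_seq => q /tm qm.
  rewrite (ThetaE char0) (Th_lin _ _ (T_lin mlr)).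
  have -> : Th q.2 (fun w => wlift (fun w => ev (rl m.+1 w) sw1) (tw1 w)) =
      Th q.2 (fun w => ev (rl m.+1 w) sw1).
    by apply: eq_Th_in => w _ _; apply: T1_liftE.
  rewrite Th_rl //; [|exact: mlin_sw|exact: symf_sw].
  case: ifP => _; last by rewrite !scaler0.
  rewrite [q.1 *: (_ *: _)]scalerA mulrC -scalerA scalerK // (pcharf0P K).1 //.
  by rewrite -lt0n fact_gt0.
rewrite tE t10 add0r; apply: IH => [q|].
  by rewrite mem_filter => /andP[qm /tm]; rewrite leq_eqVlt (negbTE qm) ltnS.
by move: Tv0; rewrite tE t10 add0r.
Qed.

End Injectivity.

(** * Transport along an isomorphism of coalgebras *)

Section CoalgebraIso.
Variable K : fieldType.

Definition coalg_iso (C C' : gcoalg K) (th : C -> C') : Prop :=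
  [/\ is_coalg_hom th, forall x, th x = 0 -> x = 0 & forall y, exists x, th x = y].

Section Inverse.
Variables (C C' : gcoalg K) (th : C -> C').
Hypothesis iso : coalg_iso th.

Let th_lin : linear th. Proof. by case: iso => -[]. Qed.

Lemma iso_inj : injective th.
Proof.
move=> x y e; have [_ inj _] := iso; apply/eqP; rewrite -subr_eq0; apply/eqP/inj.
by rewrite -scaleN1r addrC th_lin e scaleN1r addrC subrr.
Qed.

Lemma iso_inverse : exists g : C' -> C, [/\ linear g, cancel th g & cancel g th].
Proof.
have [_ _ surj] := iso; pose g y := projT1 (cid (surj y)).
have gK : cancel g th by move=> y; rewrite /g; case: (cid _).
exists g; split=> // [a x y|x]; apply: iso_inj; last exact: gK.
by rewrite th_lin !gK.
Qed.

(** The tensor square of the linear inverse is a left inverse. *)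
Lemma iso_tmap_inj : injective (tmap th th).
Proof.
have [g [gl thK gK]] := iso_inverse => u v e.
have K2 z : tmap g g (tmap th th z) = z.
  rewrite tmap_comp //.
  have idl : linear (@id C) by [].
  apply: (@tprod_ext K C C _ (tmap (g \o th) (g \o th)) id) => // [|x y].
    by apply: tmap_linear => a x y /=; rewrite !thK.
  by rewrite tmapE /= ?thK // => a x' y' /=; rewrite !thK.
by rewrite -(K2 u) e K2.
Qed.

Lemma iso_gpr i x : th (gpr i x) = gpr i (th x).
Proof.
have [[_ hom_th _] _ _] := iso; move: x.
apply: homog_ext => [||k x kx].
- exact: (lin_comp (@gpr_linear _ C i) th_lin).
- exact: (lin_comp th_lin (@gpr_linear _ C' i)).
have thx : gpr k (th x) = th x := hom_th _ _ kx.
rewrite -[in LHS]kx -[in RHS]thx !gprE kx thx.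
by case: eqP => // _; apply: lin0.
Qed.

Lemma iso_homog i x : homog i (th x) -> homog i x.
Proof. by move=> h; apply: iso_inj; rewrite iso_gpr. Qed.

Lemma iso_gsign x : th (gsign x) = gsign (th x).
Proof.
have [[_ hom_th _] _ _] := iso; move: x.
apply: homog_ext => [||i x ix].
- exact: (lin_comp (@gsign_linear K C) th_lin).
- exact: (lin_comp th_lin (@gsign_linear K C')).
rewrite (gsign_homog ix) (gsign_homog (hom_th _ _ ix)).
by rewrite -[_ *: x]addr0 th_lin lin0 ?addr0.
Qed.

End Inverse.

Lemma iso_codifferential (C C' : gcoalg K) (th : C -> C') (D : C -> C) (d : C' -> C') :
  coalg_iso th -> is_codifferential d -> (forall x, th (D x) = d (th x)) ->
  is_codifferential D.
Proof.
move=> iso [[dl dh dc] dd] E; have inj := iso_inj iso.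
have [[tl thom tc] _ _] := iso.
have Dl : linear D by move=> a x y; apply: inj; rewrite E tl dl tl !E.
have idl (A : lmodType K) : linear (@id A) by [].
have [sl sl'] := (@gsign_linear K C, @gsign_linear K C').
split; last by move=> x; apply: inj; rewrite !E dd lin0.
split=> // [i x ix|x].
  by apply: (iso_homog iso); rewrite E; apply/dh/thom.
apply: (iso_tmap_inj iso); rewrite -tc E dc tc.
have tml := tmap_linear tl tl.
(* A coefficient 1 is inserted so that linearity of [tmap th th] applies to the sum. *)
rewrite -[X in _ = tmap th th (X + _)]scale1r tml scale1r !tmap_comp //.
congr (_ + _); congr (tmap _ _ _); apply: funext => y //=.
by rewrite iso_gsign.
Qed.

Lemma iso_coalg_hom (C1 C1' C2 C2' : gcoalg K) (th1 : C1 -> C1') (th2 : C2 -> C2')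
    (H : C1 -> C2) (F : C1' -> C2') :
  coalg_iso th1 -> coalg_iso th2 -> is_coalg_hom F -> (forall x, th2 (H x) = F (th1 x)) ->
  is_coalg_hom H.
Proof.
move=> iso1 iso2 [Fl Fh Fc] E; have inj := iso_inj iso2.
have [[tl1 thom1 tc1] _ _] := iso1; have [[tl2 thom2 tc2] _ _] := iso2.
have Hl : linear H by move=> a x y; apply: inj; rewrite E tl1 Fl tl2 !E.
split=> // [i x ix|x].
  by apply: (iso_homog iso2); rewrite E; apply/Fh/thom1.
apply: (iso_tmap_inj iso2); rewrite -tc2 E Fc tc1 !tmap_comp //.
by congr (tmap _ _ _); apply: funext => y /=.
Qed.

End CoalgebraIso.

Section PBW.
Variables (K : fieldType).
Hypothesis char0 : [pchar K] =i pred0.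

Lemma Theta_iso (V : gradedSpace K) : coalg_iso (C := Sc (Lie V)) (C' := Tc V) (@Theta K V).
Proof.
have tl := @Theta_linear K V char0.
split; [split; first exact: tl | exact: Theta_inj | exact: Theta_surj].
- move=> i x ix; rewrite -[i]addr0; move: i x ix.
  apply: (homog_linear (hR := @sym_homog K 1 (Lie V))) => [|s]; first exact: tl.
  rewrite -/(sw 1 s) (ThetaE char0) addr0.
  apply: homog_ev => q /(sl_perm erefl)/degs_perm <-.
  by apply: homog_ev => r /plist_degs <-; apply: homog_tw.
move=> x /=; move: x; apply: word_ext => [||s _].
- exact: (lin_comp tl (@Tdelta_linear K V)).
- exact: (lin_comp (@Sdelta_linear K (Lie V)) (tmap_linear tl tl)).
rewrite -/(sw 1 s) (ThetaE char0) SdeltaE.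
rewrite (Th_lin _ _ (@Tdelta_linear K V)) (U_lin _ _ _ (tmap_linear tl tl)).
transitivity (Th s (fun w => U (@hp K V) w (fun a b =>
   @tens K (Tbar V) (Tbar V) (tw 1 a) (tw 1 b)))).
  by apply: eq_Th_in => w _ _; apply: TdeltaE.
rewrite (Th_U char0); apply: eq_U => a b; rewrite tmapE // !(ThetaE char0).
rewrite (Th_lin (f := fun x => tens x _) _ _ (fun c x y => tensDl c x y _)).
apply: eq_Th_in => w _ _.
by rewrite (Th_lin (f := tens _) _ _ (fun c x y => tensDr c _ x y)).
Qed.

Lemma invfK (A : lmodType K) (B : Type) (f : A -> B) y : (exists x, f x = y) ->
  f (invf f y) = y.
Proof. by rewrite /invf; case: pselect => // e _; case: (cid e). Qed.

(** [invf] returns a genuine preimage once one exists: for [Phi] it is provided by [Phi_Theta], for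
    [Psi] by surjectivity of [Theta]. Since [Lambda] undoes [Phi], the preimage under [Phi] of
    [Psi x] is [Theta x]. *)
Lemma Theta_PBWconj (V W : gradedSpace K) (E : Tbar V -> Tbar W) (x : Sbar (Lie V)) :
  Theta (PBWconj E x) = E (Theta x).
Proof.
rewrite /PBWconj /=.
have -> : invf (@Phi K 1 V) (Psi x) = Theta x.
  have e : Phi (invf (@Phi K 1 V) (Psi x)) = Psi x.
    by apply: invfK; exists (Theta x); apply: Phi_Theta.
  by rewrite -[LHS]Phi_lin1 e.
rewrite {1}/Theta invfK ?Phi_lin1 //.
have [v <-] := Theta_surj char0 (E (Theta x)).
by exists v; rewrite Phi_Theta.
Qed.

End PBW.

Theorem theorem6p20 (K : fieldType) (charK0 : [pchar K] =i pred0)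
    (G G' : leibnizInf K) (f : leibnizInfHom G G') :
  let D : Sc (Lie G) -> Sc (Lie G) := PBWconj (@dT K G) in
  let D' : Sc (Lie G') -> Sc (Lie G') := PBWconj (@dT K G') in
  let H : Sc (Lie G) -> Sc (Lie G') := PBWconj (FT f) in
  is_codiff_hom D D' H /\
  exists (codD : is_codifferential D) (codD' : is_codifferential D'),
    is_Linf_hom (g := LinfAlgebra codD) (g' := LinfAlgebra codD') H.
Proof.
move=> D D' H; have [iso iso'] := (Theta_iso charK0 G, Theta_iso charK0 G').
have codD : is_codifferential D.
  by apply: (iso_codifferential iso (dT_codifferential G)) => x; apply: Theta_PBWconj.
have codD' : is_codifferential D'.
  by apply: (iso_codifferential iso' (dT_codifferential G')) => x; apply: Theta_PBWconj.
have homH : is_coalg_hom H.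
  by apply: (iso_coalg_hom iso iso' (FT_coalg_hom f)) => x; apply: Theta_PBWconj.
have HD x : H (D x) = D' (H x).
  (* After applying the injective [Theta], both sides become F d and d' F evaluated at [Theta x]. *)
  by apply: (iso_inj iso'); rewrite !Theta_PBWconj // FT_dT.
by split; [split | exists codD, codD'].
Qed.
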